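(* The complete graphs ($k=1$) and complete $k$-partite graphs ($k\ge 2$) are classified with respect to intrinsic linking by the following lists $L_k$ (linked) and $U_k$ (not linked), where $n$ ranges over all positive integers. - $k=1$: $L_1=\{K_6\}$; $U_1=\{K_5\}$. - $k=2$: $L_2=\{K_{4,4}\}$; $U_2=\{K_{n,3}\}$. - $k=3$: $L_3=\{K_{3,3,1},K_{4,2,2}\}$; $U_3=\{K_{3,2,2},K_{n,2,1}\}$. - $k=4$: $L_4=\{K_{2,2,2,2},K_{3,2,1,1}\}$; $U_4=\{K_{2,2,2,1},K_{n,1,1,1}\}$. - $k=5$: $L_5=\{K_{2,2,1,1,1},K_{3,1,1,1,1}\}$; $U_5=\{K_{2,1,1,1,1}\}$. - $k\ge 6$: every complete $k$-partite graph is intrinsically linked. That is, for $1\le k\le 5$: every graph in $L_k$ is intrinsically linked, no graph in $U_k$ is intrinsically linked, and every complete $k$-partite graph (for $k=1$: every complete graph) either contains a graph in $L_k$ as a minor (and so is intrinsically linked) or is a minor of a graph in $U_k$ (and so is not intrinsically linked). For $k\ge 6$ every complete $k$-partite graph is intrinsically linked.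
   Context: A graph is intrinsically linked if every tame embedding of it in $\mathbb{R}^3$ contains a pair of disjoint cycles that are non-trivially linked. $K_{a_1,\dots,a_p}$ denotes the complete $p$-partite graph with parts of sizes $a_1,\dots,a_p$ (all positive; order is irrelevant), and $K_n$ the complete graph on $n$ vertices. Convention: the case $k=1$ refers to complete graphs $K_n$. A minor of a graph is any graph obtained from it by finitely many vertex deletions, edge deletions and edge contractions. *)

(* Defs.v *)
From HB Require Import structures.
From mathcomp Require Import all_boot all_order all_algebra.
From mathcomp Require Import all_classical all_reals all_analysis.
Import Order.TTheory GRing.Theory Num.Theory.
Import numFieldNormedType.Exports.

Set Implicit Arguments.
Unset Strict Implicit.
Unset Printing Implicit Defensive.

Local Open Scope classical_set_scope.
Local Open Scope ring_scope.

Record sgraph := SGraph {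
  vert :> finType;
  adj : rel vert;
  adj_sym : symmetric adj;
  adj_irr : irreflexive adj }.
Arguments adj {_}.

Definition sgraph_iso (G H : sgraph) : Prop :=
  exists2 f : G -> H, bijective f & forall x y, adj (f x) (f y) = adj x y.

Section Operations.
Variables (G : sgraph) (u v : G).

Let minus_vertex := {x : G | x != v}.

Definition del_vertex_rel : rel minus_vertex := fun x y => adj (val x) (val y).
Fact del_vertex_sym : symmetric del_vertex_rel.
Proof. by move=> x y; rewrite /del_vertex_rel adj_sym. Qed.
Fact del_vertex_irr : irreflexive del_vertex_rel.
Proof. by move=> x; rewrite /del_vertex_rel adj_irr. Qed.
Definition del_vertex : sgraph := SGraph del_vertex_sym del_vertex_irr.

Definition del_edge_rel : rel G := fun x y =>
  adj x y && ~~ (((x == u) && (y == v)) || ((x == v) && (y == u))).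
Fact del_edge_sym : symmetric del_edge_rel.
Proof.
move=> x y; rewrite /del_edge_rel adj_sym orbC.
by congr (_ && ~~ (_ || _)); rewrite andbC.
Qed.
Fact del_edge_irr : irreflexive del_edge_rel.
Proof. by move=> x; rewrite /del_edge_rel adj_irr. Qed.
Definition del_edge : sgraph := SGraph del_edge_sym del_edge_irr.

(* Contraction of uv: the surviving vertex u inherits the neighbours of v;
   loops and parallel edges are suppressed. *)
Definition contract_rel : rel minus_vertex := fun x y =>
  (x != y) && [|| adj (val x) (val y),
                  (val x == u) && adj v (val y)
                | (val y == u) && adj v (val x)].
Fact contract_sym : symmetric contract_rel.
Proof.
by move=> x y; rewrite /contract_rel eq_sym adj_sym; congr (_ && (_ || _));
  rewrite orbC.
Qed.
Fact contract_irr : irreflexive contract_rel.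
Proof. by move=> x; rewrite /contract_rel eqxx. Qed.
Definition contract : sgraph := SGraph contract_sym contract_irr.

End Operations.

(* [is_minor H G]: H is a minor of G. *)
Inductive is_minor (H : sgraph) : sgraph -> Prop :=
| MinorIso (G : sgraph) : sgraph_iso H G -> is_minor H G
| MinorDelVertex (G : sgraph) (v : G) :
    is_minor H (del_vertex v) -> is_minor H G
| MinorDelEdge (G : sgraph) (u v : G) :
    adj u v -> is_minor H (del_edge u v) -> is_minor H G
| MinorContract (G : sgraph) (u v : G) :
    adj u v -> is_minor H (contract u v) -> is_minor H G.

Section Complete.
Variables (n : nat) (a : seq nat).

Definition complete_rel : rel 'I_n := fun x y => x != y.
Fact complete_sym : symmetric complete_rel.
Proof. by move=> x y; rewrite /complete_rel eq_sym. Qed.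
Fact complete_irr : irreflexive complete_rel.
Proof. by move=> x; rewrite /complete_rel eqxx. Qed.
Definition complete_graph : sgraph := SGraph complete_sym complete_irr.

Let part_vertex := {i : 'I_(size a) & 'I_(nth 0%N a i)}.
Definition multipartite_rel : rel part_vertex := fun x y => tag x != tag y.
Fact multipartite_sym : symmetric multipartite_rel.
Proof. by move=> x y; rewrite /multipartite_rel eq_sym. Qed.
Fact multipartite_irr : irreflexive multipartite_rel.
Proof. by move=> x; rewrite /multipartite_rel eqxx. Qed.
Definition multipartite_graph : sgraph :=
  SGraph multipartite_sym multipartite_irr.

End Complete.

Notation "''K_' n" := (complete_graph n)
  (at level 8, n at level 2, format "''K_' n").
Notation "''KP' a" := (multipartite_graph a)
  (at level 8, a at level 2, format "''KP'  a").

Local Notation "G ~= H" := (sgraph_iso G H) (at level 70).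

(* For k = 1 the complete graphs, by convention; part sizes in any order. *)
Definition complete_partite (k : nat) (G : sgraph) : Prop :=
  if k == 1%N then exists2 n : nat, (0 < n)%N & G ~= 'K_n
  else exists a : seq nat, [/\ size a = k, all (ltn 0%N) a & G ~= 'KP a].

Definition linked_list (k : nat) (G : sgraph) : Prop :=
  match k with
  | 1 => G ~= 'K_6
  | 2 => G ~= 'KP [:: 4; 4]
  | 3 => G ~= 'KP [:: 3; 3; 1] \/ G ~= 'KP [:: 4; 2; 2]
  | 4 => G ~= 'KP [:: 2; 2; 2; 2] \/ G ~= 'KP [:: 3; 2; 1; 1]
  | 5 => G ~= 'KP [:: 2; 2; 1; 1; 1] \/ G ~= 'KP [:: 3; 1; 1; 1; 1]
  | _ => False
  end%N.

Definition unlinked_list (k : nat) (G : sgraph) : Prop :=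
  match k with
  | 1 => G ~= 'K_5
  | 2 => exists2 n, 0 < n & G ~= 'KP [:: n; 3]
  | 3 => G ~= 'KP [:: 3; 2; 2] \/ exists2 n, 0 < n & G ~= 'KP [:: n; 2; 1]
  | 4 => G ~= 'KP [:: 2; 2; 2; 1] \/ exists2 n, 0 < n & G ~= 'KP [:: n; 1; 1; 1]
  | 5 => G ~= 'KP [:: 2; 1; 1; 1; 1]
  | _ => False
  end%N.

Section Linking.
Variable R : realType.
Local Notation R3 := 'rV[R]_3.

Definition segment (m : nat) (x y : 'rV[R]_m) : set 'rV[R]_m :=
  [set (1 - t) *: x + t *: y | t in [set t : R | 0 <= t <= 1]].

Definition polygonal (A : set R3) : Prop :=
  exists s : seq (R3 * R3), A = \bigcup_(p in [set` s]) segment p.1 p.2.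

Definition homeomorphism (h : R3 -> R3) : Prop :=
  continuous h /\
  exists g : R3 -> R3, [/\ continuous g, cancel h g & cancel g h].

(* Geometric realization of G inside the standard simplex on its vertices. *)
Definition vertex_point (G : sgraph) (v : G) : 'rV[R]_#|G| :=
  delta_mx 0 (enum_rank v).

Definition edge_cell (G : sgraph) (u v : G) : set 'rV[R]_#|G| :=
  segment (vertex_point u) (vertex_point v).

Definition realization (G : sgraph) : set 'rV[R]_#|G| :=
  [set x | exists u v : G, ((u == v) || adj u v) /\ edge_cell u v x].
Arguments realization : clear implicits.

(* The realization is compact, so an injective continuous map on it is a
   homeomorphism onto its image. Values outside the realization are irrelevant. *)
Definition is_embedding (G : sgraph) (f : 'rV[R]_#|G| -> R3) : Prop :=
  {within realization G, continuous f} /\ set_inj (realization G) f.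

(* Tame: equivalent, by a homeomorphism of the ambient space, to an embedding
   all of whose edges are polygonal arcs. *)
Definition tame (G : sgraph) (f : 'rV[R]_#|G| -> R3) : Prop :=
  exists2 h : R3 -> R3, homeomorphism h &
    forall u v : G, adj u v -> polygonal (h @` (f @` edge_cell u v)).

(* A and B are separated by a tame 2-sphere, i.e. by the preimage of the round
   unit sphere under a homeomorphism of the ambient space. *)
Definition split_link (A B : set R3) : Prop :=
  let sqnorm (x : R3) := \sum_i x ord0 i ^+ 2 in
  exists2 h : R3 -> R3, homeomorphism h &
    ((forall x, A x -> sqnorm (h x) < 1) /\ (forall x, B x -> 1 < sqnorm (h x)))
    \/
    ((forall x, B x -> sqnorm (h x) < 1) /\ (forall x, A x -> 1 < sqnorm (h x))).

Definition graph_cycle (G : sgraph) (s : seq G) : bool :=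
  (2 < size s)%N && ucycleb adj s.

Definition cycle_cell (G : sgraph) (s : seq G) : set 'rV[R]_#|G| :=
  \bigcup_(x in [set` s]) edge_cell x (next s x).

Definition intrinsically_linked (G : sgraph) : Prop :=
  forall f : 'rV[R]_#|G| -> R3, is_embedding f -> tame f ->
  exists s1 s2 : seq G,
    [/\ graph_cycle s1, graph_cycle s2, {in s1, forall x, x \notin s2}
      & ~ split_link (f @` cycle_cell s1) (f @` cycle_cell s2)].

End Linking.

(* Main.v *)
Require Import Defs.
From HB Require Import structures.
From mathcomp Require Import all_boot all_order all_algebra.
From mathcomp Require Import all_classical all_reals all_analysis.
From mathcomp Require Import ring lra zify.
Import Order.TTheory GRing.Theory Num.Theory.
Import numFieldNormedType.Exports.

Set Implicit Arguments.
Unset Strict Implicit.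
Unset Printing Implicit Defensive.

(* A graph is linked as soon as it contains K_6, K_{3,3,1} or K_{4,4}. Each of
   these consists of a base E (the edges of K_5 or K_{3,3}) and paths X u from the
   base vertices to an apex; for every base edge e there is a cycle C_e through e
   and the paths at its ends, and a disjoint cycle D_e formed by the base edges
   disjoint from e. Approximate an embedding by polygons in general position and
   let lk(C_e, D_e) count modulo 2 the places where C_e passes over D_e in the
   projection to the xy-plane. The edges disjoint from a given one form an even
   graph, so in the sum of the lk(C_e, D_e) the paths X u cancel, and what is left
   is the number of crossings between disjoint base edges. This parity does not
   change when the edges are replaced by straight segments, for closed curves
   cross evenly, and it is then odd by counting over the 4-subsets of points. But
   if C_e and D_e were separated by a sphere, one of them could be contracted to
   a point off the other, by a homotopy through small triangles, each of which
   contributes 0; so all the lk(C_e, D_e) would vanish.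

   Conversely, the graphs in the lists U_k are subgraphs of cones over plane
   graphs. Drawn with straight edges and with the apex above the plane, one of any
   two disjoint cycles lies in the plane and the other one does not go below it; a
   vertical shear makes them separable by a round sphere. *)

Local Open Scope classical_set_scope.
Local Open Scope ring_scope.

(** * Points in general position in the plane *)

Section PlaneGeometry.
Variable R : realType.
Local Notation P := 'rV[R]_3.
Implicit Types (a b c d p q r s x : P) (S : seq P).

(** For a base K_5 or K_{3,3} the parity that remains is the van Kampen obstruction to drawing the
    base in the plane; this is why one pair of cycles per base edge is enough. The edges are
    arbitrary arcs, so a linking number of the cycles themselves is never defined. Instead, a
    separating sphere is shown to make [overs] vanish for all generic closed chains within some
    radius of the two cycles, and one radius serves for the finitely many pairs. Fine chains may
    repeat points, so the identities must survive degenerate segments: [generic] constrains distinct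
    points only, and a degenerate triple counts as not [ccw]. No contraction is ever performed. The
    graphs in the lists L_k other than K_6 contain K_{3,3,1} or K_{4,4} once some parts are merged
    by forgetting the edges between them. The unlinked graphs all lie in one of two drawings: a path
    joined to a triangle, and the cone over the octahedron. *)

Definition xc p : R := p ord0 (@Ordinal 3 0 isT).
Definition yc p : R := p ord0 (@Ordinal 3 1 isT).
Definition zc p : R := p ord0 (@Ordinal 3 2 isT).

Definition orient a b c : R :=
  (xc b - xc a) * (yc c - yc a) - (yc b - yc a) * (xc c - xc a).

Definition ccw a b c : bool := 0 < orient a b c.

(** Repeated points are allowed in S. The first condition is what makes the collinearity polynomials
    in [perturb1] nonzero. *)
Definition generic S :=
  [/\ forall a b, a \in S -> b \in S -> a != b -> (xc a, yc a) != (xc b, yc b)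
    & forall a b c, a \in S -> b \in S -> c \in S ->
        a != b -> b != c -> a != c -> orient a b c != 0].

Definition cross a b c d : bool :=
  (ccw a b c != ccw a b d) && (ccw c d a != ccw c d b).

Definition in_tri a b c x : bool :=
  (ccw a b x == ccw b c x) && (ccw b c x == ccw c a x).

Lemma orient_rot a b c : orient b c a = orient a b c.
Proof. rewrite /orient; ring. Qed.

Lemma orient_swap a b c : orient b a c = - orient a b c.
Proof. rewrite /orient; ring. Qed.

Lemma orientaac a c : orient a a c = 0.
Proof. rewrite /orient; ring. Qed.

Lemma ccw_rot a b c : ccw b c a = ccw a b c.
Proof. by rewrite /ccw orient_rot. Qed.

Lemma ccwaac a c : ccw a a c = false.
Proof. by rewrite /ccw orientaac ltxx. Qed.

Lemma ccwE a b c : orient a b c != 0 ->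
  (ccw b c a = ccw a b c) * (ccw c a b = ccw a b c) * (ccw b a c = ~~ ccw a b c) *
  (ccw c b a = ~~ ccw a b c) * (ccw a c b = ~~ ccw a b c).
Proof.
move=> h; have e : ccw b a c = ~~ ccw a b c.
  by rewrite /ccw orient_swap oppr_gt0; case: ltgtP h.
by rewrite (ccw_rot a c b) (ccw_rot b a c) (ccw_rot b c a) (ccw_rot a b c) e.
Qed.

Lemma crossC a b c d : cross a b c d = cross c d a b.
Proof. by rewrite /cross andbC. Qed.

Lemma cross_pt a c d : cross a a c d = false.
Proof. by rewrite /cross !ccwaac. Qed.

Lemma generic_orient S a b c : generic S -> a \in S -> b \in S -> c \in S ->
  a != b -> b != c -> a != c -> orient a b c != 0.
Proof. by move=> [_ +]; apply. Qed.

Lemma cross_swap S a b c d : generic S -> a \in S -> b \in S -> c \in S ->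
  d \in S -> a != c -> a != d -> b != c -> b != d ->
  cross b a c d = cross a b c d.
Proof.
move=> gS aS bS cS dS ac ad bc bd; rewrite /cross.
have [->//|ab] := eqVneq a b.
have oc : orient a b c != 0 by exact: (generic_orient gS).
have od : orient a b d != 0 by exact: (generic_orient gS).
by rewrite ?(ccwE oc) ?(ccwE od) [in RHS](eq_sym (ccw c d a)); do 2!case: (ccw a b _).
Qed.

Lemma three_term (u v w : R) : u - v + w = 0 ->
  ~~ [&& 0 < u, ~~ (0 < v) & 0 < w] /\ ~~ [&& ~~ (0 < u), 0 < v & ~~ (0 < w)].
Proof.
by move=> e; split; apply/negP => /and3P[]; rewrite -!leNgt => *; lra.
Qed.

Lemma gt0_mul (u v : R) : u != 0 -> v != 0 -> (0 < u * v) = ((0 < u) == (0 < v)).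
Proof.
move=> u0 v0; case: (ltgtP 0 u) u0 => // hu _; case: (ltgtP 0 v) v0 => // hv _.
- exact: mulr_gt0.
- by apply/negbTE; rewrite -leNgt ltW// pmulr_rlt0.
- by apply/negbTE; rewrite -leNgt ltW// nmulr_rlt0.
- by rewrite nmulr_rgt0.
Qed.

Lemma four_sign (u v w t : R) :
  u - v + w - t = 0 ->
  ~~ [&& 0 < u, ~~ (0 < v), 0 < w & ~~ (0 < t)] /\
  ~~ [&& ~~ (0 < u), 0 < v, ~~ (0 < w) & 0 < t].
Proof.
by move=> e; split; apply/negP => /and4P[]; rewrite -!leNgt => *; lra.
Qed.

(** Either the points are in convex position and exactly one of the three pairings crosses, or
    exactly one point lies in the triangle of the others. The linear relation between the four
    orientations excludes two sign patterns; the others are checked one by one. *)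
Lemma four_points S a b c d : generic S -> a \in S -> b \in S -> c \in S ->
  d \in S -> uniq [:: a; b; c; d] ->
  cross a b c d (+) cross a c b d (+) cross a d b c (+) in_tri a b c d (+)
  in_tri a b d c (+) in_tri a c d b (+) in_tri b c d a.
Proof.
move=> gS aS bS cS dS; rewrite /= !inE !negb_or !andbT.
move=> /and3P[/and3P[ab ac ad] /andP[bc bd] cd].
have o1 : orient a b c != 0 by exact: (generic_orient gS).
have o2 : orient a b d != 0 by exact: (generic_orient gS).
have o3 : orient a c d != 0 by exact: (generic_orient gS).
have o4 : orient b c d != 0 by exact: (generic_orient gS).
have e : orient b c d - orient a c d + orient a b d - orient a b c = 0.
  by rewrite /orient; ring.
have [] := four_sign e.
rewrite /cross /in_tri ?(ccwE o1) ?(ccwE o2) ?(ccwE o3) ?(ccwE o4).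
by rewrite /ccw; do 4!case: (0 < _).
Qed.

(** The four triangles are the projected faces of a tetrahedron, which cover every generic point an
    even number of times. The signs that can occur are limited by the three-term Grassmann-Plücker
    relation with pivot x. *)
Lemma in_tri_tetra S a b c d x : generic S -> a \in S -> b \in S -> c \in S ->
  d \in S -> x \in S -> uniq [:: a; b; c; d; x] ->
  in_tri a b c x (+) in_tri a b d x (+) in_tri a c d x (+) in_tri b c d x = false.
Proof.
move=> gS aS bS cS dS xS; rewrite /= !inE !negb_or !andbT.
move=> /and4P[/and4P[ab ac ad ax] /and3P[bc bd bx] /andP[cd cx] dx].
have o1 : orient x a b != 0 by apply: (generic_orient gS); rewrite // eq_sym.
have o2 : orient x a c != 0 by apply: (generic_orient gS); rewrite // eq_sym.
have o3 : orient x a d != 0 by apply: (generic_orient gS); rewrite // eq_sym.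
have o4 : orient x b c != 0 by apply: (generic_orient gS); rewrite // eq_sym.
have o5 : orient x b d != 0 by apply: (generic_orient gS); rewrite // eq_sym.
have o6 : orient x c d != 0 by apply: (generic_orient gS); rewrite // eq_sym.
have e : orient x a b * orient x c d - orient x a c * orient x b d
         + orient x a d * orient x b c = 0 by rewrite /orient; ring.
have [] := three_term e.
rewrite !gt0_mul// /in_tri ?(ccwE o1) ?(ccwE o2) ?(ccwE o3) ?(ccwE o4) ?(ccwE o5) ?(ccwE o6).
rewrite -/(ccw x a b) -/(ccw x a c) -/(ccw x a d) -/(ccw x b c) -/(ccw x b d) -/(ccw x c d).
by do 6!case: (ccw x _ _).
Qed.

(** A segment meets the boundary of a triangle an odd number of times exactly when it has one end
    inside. Two four-point relations and the Grassmann-Plücker relations with pivots a, b and c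
    exclude all bad patterns among the ten signs. *)
Lemma cross_tri S a b c r s : generic S -> a \in S -> b \in S -> c \in S ->
  r \in S -> s \in S -> uniq [:: a; b; c; r; s] ->
  cross a b r s (+) cross b c r s (+) cross c a r s = in_tri a b c r (+) in_tri a b c s.
Proof.
move=> gS aS bS cS rS sS; rewrite /= !inE !negb_or !andbT.
move=> /and4P[/and4P[ab ac ar as_] /and3P[bc br bs] /andP[cr cs] rs].
have abr : orient a b r != 0 by exact: (generic_orient gS).
have abs : orient a b s != 0 by exact: (generic_orient gS).
have bcr : orient b c r != 0 by exact: (generic_orient gS).
have bcs : orient b c s != 0 by exact: (generic_orient gS).
have acr : orient a c r != 0 by exact: (generic_orient gS).
have acs : orient a c s != 0 by exact: (generic_orient gS).
have ars : orient a r s != 0 by exact: (generic_orient gS).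
have brs : orient b r s != 0 by exact: (generic_orient gS).
have crs : orient c r s != 0 by exact: (generic_orient gS).
have abc : orient a b c != 0 by exact: (generic_orient gS).
have e1 : orient a b c - orient a b r + orient a c r - orient b c r = 0 by rewrite /orient; ring.
have e2 : orient a b c - orient a b s + orient a c s - orient b c s = 0 by rewrite /orient; ring.
have ea : orient a b c * orient a r s
  - orient a b r * orient a c s + orient a b s * orient a c r = 0.
  by rewrite /orient; ring.
have eb : orient a b c * orient b r s
  - orient a b r * orient b c s + orient a b s * orient b c r = 0.
  by rewrite /orient; ring.
have ec : orient a b c * orient c r s
  - orient a c r * orient b c s + orient a c s * orient b c r = 0.
  by rewrite /orient; ring.
have [] := three_term ea.
have [] := three_term eb.
have [] := three_term ec.
have := four_sign e1; have := four_sign e2.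
rewrite !gt0_mul//.
rewrite /cross /in_tri ?(ccwE abr) ?(ccwE abs) ?(ccwE acr) ?(ccwE acs) ?(ccwE bcr) ?(ccwE bcs).
rewrite ?(ccwE ars) ?(ccwE brs) ?(ccwE crs) /ccw.
by do 10!case: (0 < _).
Qed.

End PlaneGeometry.

(** * Segments and triangles in space *)

Notation "\xor_ ( i <- r ) F" := (\big[addb/false]_(i <- r) F)
  (at level 41, F at level 41, i, r at level 50,
   format "'[' \xor_ ( i  <-  r ) '/  '  F ']'").
Notation "\xor_ ( i <- r | C ) F" := (\big[addb/false]_(i <- r | C) F)
  (at level 41, F at level 41, i, r at level 50,
   format "'[' \xor_ ( i  <-  r  |  C ) '/  '  F ']'").

Section SpaceGeometry.
Variable R : realType.
Local Notation P := 'rV[R]_3.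
Implicit Types (a b c d p q r s x : P) (S : seq P).

Lemma xcD a b : xc (a + b) = xc a + xc b. Proof. by rewrite /xc mxE. Qed.
Lemma ycD a b : yc (a + b) = yc a + yc b. Proof. by rewrite /yc mxE. Qed.
Lemma zcD a b : zc (a + b) = zc a + zc b. Proof. by rewrite /zc mxE. Qed.
Lemma xcZ t a : xc (t *: a) = t * xc a. Proof. by rewrite /xc mxE. Qed.
Lemma ycZ t a : yc (t *: a) = t * yc a. Proof. by rewrite /yc mxE. Qed.
Lemma zcZ t a : zc (t *: a) = t * zc a. Proof. by rewrite /zc mxE. Qed.
Definition coordE := (xcD, ycD, zcD, xcZ, ycZ, zcZ).

Lemma coord_inj a b : xc a = xc b -> yc a = yc b -> zc a = zc b -> a = b.
Proof.
move=> ex ey ez; apply/rowP => -[[|[|[|//]]] i]; rewrite (bool_irrelevance i isT).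
- exact: ex.
- exact: ey.
- exact: ez.
Qed.

(* Height of the point of ab lying above or below the line cd; a junk value
   unless these lines cross in the projection. *)
Definition height a b c d : R :=
  (orient c d a * zc b - orient c d b * zc a) / (orient c d a - orient c d b).

Definition overpass a b c d : bool :=
  cross a b c d && (height c d a b < height a b c d).

Lemma cross_point a b c d : cross a b c d -> exists t u : R,
  [/\ 0 <= t <= 1, 0 <= u <= 1,
      (1 - t) * xc a + t * xc b = (1 - u) * xc c + u * xc d
      /\ (1 - t) * yc a + t * yc b = (1 - u) * yc c + u * yc d,
      (1 - t) * zc a + t * zc b = height a b c d
    & (1 - u) * zc c + u * zc d = height c d a b].
Proof.
have frac (e1 e2 : R) : (0 < e1) != (0 < e2) ->
    e1 - e2 != 0 /\ 0 <= e1 / (e1 - e2) <= 1.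
  case: (ltP 0 e1) => h1; case: (ltP 0 e2) => h2 // _.
    have h : 0 < e1 - e2 by lra.
    by rewrite gt_eqF//; split => //; rewrite divr_ge0 ?(ltW h1) ?(ltW h)// ler_pdivrMr//; lra.
  have h : 0 < e2 - e1 by lra.
  have n : e1 - e2 != 0 by rewrite lt_eqF//; lra.
  split=> //; have -> : e1 / (e1 - e2) = - e1 / (e2 - e1) by field; lra.
  by rewrite divr_ge0 ?oppr_ge0 ?(ltW h)// ler_pdivrMr//; lra.
move=> /andP[/frac[n1 u01] /frac[n2 t01]].
exists (orient c d a / (orient c d a - orient c d b)),
  (orient a b c / (orient a b c - orient a b d)).
have e : orient a b c - orient a b d = - (orient c d a - orient c d b).
  by rewrite /orient; ring.
split=> //.
- rewrite e; split; move: n2 => /[dup] n2; rewrite /orient => ?; field; lra.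
- by rewrite /height; field.
- by rewrite /height; field.
Qed.

Definition seg_disjoint a b c d := forall t u : R,
  0 <= t <= 1 -> 0 <= u <= 1 -> (1 - t) *: a + t *: b != (1 - u) *: c + u *: d.

(** Where the projections cross, the two heights differ because the segments do not meet in space,
    so exactly one of them is on top. *)
Lemma overDover a b c d : seg_disjoint a b c d ->
  overpass a b c d (+) overpass c d a b = cross a b c d.
Proof.
move=> dis; rewrite /overpass (crossC c d).
have [/cross_point[t [u [t01 u01 [ex ey] eh eh']]]|//] := boolP (cross a b c d).
rewrite /= -eh -eh'; case: ltgtP => // ez.
by have /eqP[] := dis t u t01 u01; apply: coord_inj; rewrite !coordE.
Qed.

Lemma over_pt a c d : overpass a a c d = false.
Proof. by rewrite /overpass cross_pt. Qed.

Lemma over_ptr a c d : overpass c d a a = false.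
Proof. by rewrite /overpass crossC cross_pt. Qed.

Lemma height_swap a b c d : height b a c d = height a b c d.
Proof. by rewrite /height -opprB -[X in _ / X]opprB invrN mulrNN. Qed.

Lemma height_swapr a b c d : height a b d c = height a b c d.
Proof.
rewrite /height !(orient_swap c d).
have -> : - orient c d a - - orient c d b = - (orient c d a - orient c d b) by ring.
by rewrite invrN mulrN -mulNr; congr (_ / _); ring.
Qed.

Lemma over_swap S a b c d : generic S -> a \in S -> b \in S -> c \in S ->
  d \in S -> a != c -> a != d -> b != c -> b != d ->
  overpass b a c d = overpass a b c d.
Proof.
move=> gS aS bS cS dS ac ad bc bd.
by rewrite /overpass (cross_swap gS)// (height_swap a b) (height_swapr c d a b).
Qed.

(** The height over x of the plane through a, b and c, interpolated by the barycentric coordinates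
    of the projection of x. *)
Definition tri_height a b c x : R :=
  (orient b c x * zc a + orient c a x * zc b + orient a b x * zc c)
  / orient a b c.

Lemma in_tri_weights a b c x : orient a b c != 0 -> in_tri a b c x ->
  exists w1 w2 w3 : R, [/\ [/\ 0 <= w1, 0 <= w2, 0 <= w3 & w1 + w2 + w3 = 1],
    w1 * xc a + w2 * xc b + w3 * xc c = xc x,
    w1 * yc a + w2 * yc b + w3 * yc c = yc x
  & w1 * zc a + w2 * zc b + w3 * zc c = tri_height a b c x].
Proof.
move=> D0 /andP[e1 e2].
have e : orient a b c = orient b c x + orient c a x + orient a b x.
  by rewrite /orient; ring.
exists (orient b c x / orient a b c), (orient c a x / orient a b c),
  (orient a b x / orient a b c); split.
- have pos (u v : R) : v != 0 -> (0 < u) = (0 < v) -> 0 <= u / v.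
    move=> v0 uv; case: (ltgtP 0 v) v0 uv => // v0 _ uv.
      by rewrite divr_ge0 ?ltW.
    by rewrite -mulrNN -invrN divr_ge0 ?oppr_ge0// ?(ltW v0)// leNgt uv.
  have e3 : ccw a b x = ccw a b c.
    move: e1 e2 D0; rewrite /ccw e.
    case: (ltP 0 (orient a b x)); case: (ltP 0 (orient b c x));
      case: (ltP 0 (orient c a x)) => //= h1 h2 h3 _ _ h; apply/esym.
      by apply/idP; lra.
    by apply/negbTE; rewrite -leNgt; lra.
  move: e1 e2; rewrite e3 => /eqP e1; rewrite -e1 => /eqP e2.
  by split; [exact: pos..|rewrite -!mulrDl -e divff].
- by move: D0; rewrite /orient => D0; field.
- by move: D0; rewrite /orient => D0; field.
- by rewrite /tri_height; field.
Qed.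

Definition tri_disjoint a b c r s := forall w1 w2 w3 u : R,
  0 <= w1 -> 0 <= w2 -> 0 <= w3 -> w1 + w2 + w3 = 1 -> 0 <= u <= 1 ->
  w1 *: a + w2 *: b + w3 *: c != (1 - u) *: r + u *: s.

Definition under_tri a b c x := in_tri a b c x && (zc x < tri_height a b c x).

(* Over the triangle, the vertical distance to the segment rs is affine and
   never vanishes, so rs is either entirely above or entirely below abc; in
   the first case every term is false, and the second is [cross_tri]. *)
Lemma over_tri_uniq S a b c r s : generic S -> a \in S -> b \in S -> c \in S ->
  r \in S -> s \in S -> uniq [:: a; b; c; r; s] -> tri_disjoint a b c r s ->
  overpass a b r s (+) overpass b c r s (+) overpass c a r s
  = under_tri a b c r (+) under_tri a b c s.
Proof.
move=> gS aS bS cS rS sS us dis.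
have abc0 : orient a b c != 0.
  move: us; rewrite /= !inE !negb_or => /and3P[/and3P[ab ac _] /andP[bc _] _].
  exact: (generic_orient gS).
pose I (w1 w2 w3 u : R) := [/\ [/\ 0 <= w1, 0 <= w2, 0 <= w3 & w1 + w2 + w3 = 1],
   0 <= u <= 1, w1 * xc a + w2 * xc b + w3 * xc c = (1 - u) * xc r + u * xc s
   & w1 * yc a + w2 * yc b + w3 * yc c = (1 - u) * yc r + u * yc s].
pose v (w1 w2 w3 u : R) := (1 - u) * zc r + u * zc s
  - (w1 * zc a + w2 * zc b + w3 * zc c).
have v0 w1 w2 w3 u : I w1 w2 w3 u -> v w1 w2 w3 u != 0.
  move=> [[h1 h2 h3 h] hu ex ey]; apply/eqP => ez.
  have /eqP[] := dis _ _ _ _ h1 h2 h3 h hu.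
  by apply: coord_inj; rewrite !coordE//; move: ez; rewrite /v; lra.
have ev_cross x y : [\/ x = a /\ y = b, x = b /\ y = c | x = c /\ y = a] ->
    cross x y r s -> exists w1 w2 w3 u, I w1 w2 w3 u /\
      v w1 w2 w3 u = height r s x y - height x y r s.
  move=> xyz /cross_point[t [u [/andP[t0 t1] u01 [ex ey] <- <-]]].
  case: xyz => -[? ?]; subst x y.
  - exists (1 - t), t, 0, u; rewrite /I /v; split; [split=> //; [split=> //|..]|]; lra.
  - exists 0, (1 - t), t, u; rewrite /I /v; split; [split=> //; [split=> //|..]|]; lra.
  - exists t, 0, (1 - t), u; rewrite /I /v; split; [split=> //; [split=> //|..]|]; lra.
have ev_in x : x = r \/ x = s -> in_tri a b c x ->
    exists w1 w2 w3 u, I w1 w2 w3 u /\ v w1 w2 w3 u = zc x - tri_height a b c x.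
  move=> xu /(in_tri_weights abc0)[w1 [w2 [w3 [hw ex ey <-]]]].
  exists w1, w2, w3; case: xu ex ey => -> ex ey; [exists 0|exists 1];
    rewrite /I /v; (split; [split; [exact: hw|..]|]); lra.
have [[w1 [w2 [w3 [u [Iw vw]]]]]|no] :=
    pselect (exists w1 w2 w3 u, I w1 w2 w3 u /\ v w1 w2 w3 u < 0).
- have neg w1' w2' w3' u' : I w1' w2' w3' u' -> v w1' w2' w3' u' < 0.
    move=> Iw'; rewrite ltNge; apply/negP => vw'.
    have hd : 0 < v w1' w2' w3' u' - v w1 w2 w3 u by lra.
    (* The weight at which interpolating between a negative and a positive value of the affine
       function v gives 0; the constraints [I] are convex, so the interpolated point satisfies
       them. *)
    pose k := v w1' w2' w3' u' / (v w1' w2' w3' u' - v w1 w2 w3 u).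
    have k0 : 0 <= k by rewrite divr_ge0// ltW.
    have k1 : k <= 1 by rewrite ler_pdivrMr//; lra.
    have hk : k * v w1 w2 w3 u + (1 - k) * v w1' w2' w3' u' = 0.
      by rewrite /k; field; lra.
    pose m (x y : R) := k * x + (1 - k) * y.
    have := v0 (m w1 w1') (m w2 w2') (m w3 w3') (m u u'); case/(_ _)/eqP.
      move: Iw Iw'; rewrite /I => -[[h1 h2 h3 h] hu ex ey] [[h1' h2' h3' h'] hu' ex' ey'].
      have mge (x y : R) : 0 <= x -> 0 <= y -> 0 <= m x y.
        by move=> x0 y0; rewrite addr_ge0// mulr_ge0//; lra.
      split.
      + split; [exact: mge..|].
        have -> : m w1 w1' + m w2 w2' + m w3 w3' = m (w1 + w2 + w3) (w1' + w2' + w3').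
          by rewrite /m; ring.
        by rewrite h h' /m; ring.
      + rewrite mge//=; [|lra..].
        have : 0 <= m (1 - u) (1 - u') by apply: mge; lra.
        by rewrite /m; lra.
      + have -> : (1 - m u u') * xc r + m u u' * xc s =
          m ((1 - u) * xc r + u * xc s) ((1 - u') * xc r + u' * xc s) by rewrite /m; ring.
        by rewrite -ex -ex' /m; ring.
      + have -> : (1 - m u u') * yc r + m u u' * yc s =
          m ((1 - u) * yc r + u * yc s) ((1 - u') * yc r + u' * yc s) by rewrite /m; ring.
        by rewrite -ey -ey' /m; ring.
    by rewrite -hk /v /m; ring.
  have ov x y : [\/ x = a /\ y = b, x = b /\ y = c | x = c /\ y = a] ->
      overpass x y r s = cross x y r s.
    move=> xyz; rewrite /overpass; have [cr|//] := boolP (cross x y r s).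
    have [? [? [? [? [+ e]]]]] := ev_cross _ _ xyz cr.
    by move=> /neg; rewrite e subr_lt0.
  have un x : x = r \/ x = s -> under_tri a b c x = in_tri a b c x.
    move=> xu; rewrite /under_tri; have [it|//] := boolP (in_tri a b c x).
    have [? [? [? [? [+ e]]]]] := ev_in _ xu it.
    by move=> /neg; rewrite e subr_lt0.
  rewrite (ov a b) ?(ov b c) ?(ov c a); [|by constructor 3|by constructor 2|by constructor 1].
  rewrite (un r) ?(un s); [|by right|by left].
  exact: (cross_tri gS).
- have ov x y : [\/ x = a /\ y = b, x = b /\ y = c | x = c /\ y = a] ->
      overpass x y r s = false.
    move=> xyz; apply/negP => /andP[cr hh].
    have [w1 [w2 [w3 [u [Iw e]]]]] := ev_cross _ _ xyz cr.
    by apply: no; exists w1, w2, w3, u; rewrite e subr_lt0.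
  have un x : x = r \/ x = s -> under_tri a b c x = false.
    move=> xu; apply/negP => /andP[cr hh].
    have [w1 [w2 [w3 [u [Iw e]]]]] := ev_in _ xu cr.
    by apply: no; exists w1, w2, w3, u; rewrite e subr_lt0.
  rewrite (ov a b) ?(ov b c) ?(ov c a); [|by constructor 3|by constructor 2|by constructor 1].
  by rewrite (un r) ?(un s); [|by right|by left].
Qed.

End SpaceGeometry.

(** * Polygonal chains modulo 2 *)

Section Chains.
Variable R : realType.
Local Notation P := 'rV[R]_3.
Local Notation chain := (seq (P * P)).
Implicit Types (a b c d p q x : P) (s t : P * P) (S : seq P) (A B : chain).

(** The boundary modulo 2 is paired with a test function instead of being computed as a set of
    points. Closedness is then used by choosing phi, and the order of the segments never matters. *)
Definition boundary A (phi : P -> bool) :=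
  \xor_(s <- A) (phi s.1 (+) phi s.2).

Definition closed_chain A := forall phi, boundary A phi = false.

Definition supported S A := all (fun s => (s.1 \in S) && (s.2 \in S)) A.

Definition apart A B := forall s t, s \in A -> t \in B ->
  [&& s.1 != t.1, s.1 != t.2, s.2 != t.1 & s.2 != t.2].

Definition crossings A B :=
  \xor_(s <- A) \xor_(t <- B) cross s.1 s.2 t.1 t.2.

(* For closed A and B in general position, the linking number modulo 2. *)
Definition overs A B :=
  \xor_(s <- A) \xor_(t <- B) overpass s.1 s.2 t.1 t.2.

Lemma supportedP S A s : supported S A -> s \in A -> s.1 \in S /\ s.2 \in S.
Proof. by move=> /allP h /h /andP. Qed.

Lemma supported_cat S A B : supported S (A ++ B) = supported S A && supported S B.
Proof. exact: all_cat. Qed.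

Lemma boundary_cat A B phi : boundary (A ++ B) phi = boundary A phi (+) boundary B phi.
Proof. by rewrite /boundary big_cat. Qed.

Lemma crossingsC A B : crossings A B = crossings B A.
Proof.
rewrite /crossings exchange_big; apply: eq_bigr => s _; apply: eq_bigr => t _.
exact: crossC.
Qed.

Lemma crossings_catl A B C : crossings (A ++ B) C = crossings A C (+) crossings B C.
Proof. by rewrite /crossings big_cat. Qed.

Lemma crossings_catr A B C : crossings C (A ++ B) = crossings C A (+) crossings C B.
Proof. by rewrite !(crossingsC C) crossings_catl. Qed.

Lemma overs_catl A B C : overs (A ++ B) C = overs A C (+) overs B C.
Proof. by rewrite /overs big_cat. Qed.

Lemma overs_catr A B C : overs C (A ++ B) = overs C A (+) overs C B.
Proof. by rewrite /overs -big_split; apply: eq_bigr => s _; rewrite big_cat. Qed.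

Lemma xor_eq0 (I : eqType) (r : seq I) (F : I -> bool) :
  {in r, forall i, F i = false} -> \xor_(i <- r) F i = false.
Proof. by move=> h; rewrite big_seq big1. Qed.

Lemma in_tri_aab a b x : in_tri a a b x -> orient a b x = 0.
Proof.
rewrite /in_tri ccwaac /ccw => /andP[/eqP/esym e1 /eqP/esym e2].
rewrite e1 in e2; apply/eqP; move: e1 e2 => /negbT + /negbT.
by rewrite -!leNgt (orient_swap a b) oppr_le0 => ? ?; apply/eqP/le_anti/andP.
Qed.

Lemma in_tri_rot a b c x : in_tri b c a x = in_tri a b c x.
Proof. by rewrite /in_tri; case: (ccw a b x); case: (ccw b c x); case: (ccw c a x). Qed.

Lemma cross_tri_gen S a b c (r s : P) : generic S -> a \in S -> b \in S -> c \in S ->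
  r \in S -> s \in S ->
  [&& a != r, a != s, b != r & b != s] -> c != r -> c != s ->
  cross a b r s (+) cross b c r s (+) cross c a r s = in_tri a b c r (+) in_tri a b c s.
Proof.
move=> gS aS bS cS rS sS /and4P[ar as_ br bs] cr cs.
have [<-|rs] := eqVneq r s; first by rewrite !(crossC _ _ r r) !cross_pt !addbb.
have it x y : x \in S -> y \in S -> x != y -> forall z, z \in [:: r; s] ->
    x != z -> y != z -> in_tri x x y z = false.
  move=> xS yS xy z zrs xz yz; apply/negP => /in_tri_aab/eqP; apply/negP.
  apply: (generic_orient gS) => //.
  by move: zrs; rewrite !inE => /orP[]/eqP->.
have it' x z : in_tri x x x z by rewrite /in_tri !ccwaac.
have [eab|ab] := eqVneq a b.
  rewrite -eab cross_pt addFb; have [<-|ac] := eqVneq a c.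
    by rewrite !cross_pt !it'.
  rewrite (cross_swap gS)// addbb !it// ?inE ?eqxx ?orbT//.
have [ebc|bc] := eqVneq b c.
  rewrite -ebc cross_pt addbF (cross_swap gS)// addbb.
  by rewrite -!(in_tri_rot a) !it// ?inE ?eqxx ?orbT// eq_sym.
have [eca|ca] := eqVneq c a.
  rewrite eca cross_pt addbF (cross_swap gS)// addbb.
  by rewrite !(in_tri_rot a a b) !it// ?inE ?eqxx ?orbT// eq_sym.
apply: (cross_tri gS) => //.
by rewrite /= !inE !negb_or ab bc ar as_ br bs cr cs rs (eq_sym a c) ca.
Qed.

(* Coning A from a point z shows that the number of crossings of A with a
   segment rs is W r + W s, where W x counts the triangles that contain x. *)
Lemma crossings_closed S A B : generic S -> supported S A -> supported S B ->
  apart A B -> closed_chain A -> closed_chain B -> crossings A B = false.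
Proof.
move=> gS sA sB apAB cA cB.
case: A sA apAB cA => [|s0 A0] sA apAB cA; first by rewrite /crossings big_nil.
have s0A : s0 \in s0 :: A0 by rewrite mem_head.
move: (s0 :: A0) s0A sA apAB cA => A s0A sA apAB cA.
pose z := s0.1; have [zS _] := supportedP sA s0A.
pose W x := \xor_(s <- A) in_tri z s.1 s.2 x.
rewrite crossingsC /crossings big_seq (eq_bigr (fun t => W t.1 (+) W t.2)).
  by rewrite -big_seq; exact: cB.
move=> t tB; rewrite /W -big_split /=.
(* With this test function, closedness of A says that the cone edges from z contribute nothing in
   total. *)
have := cA (fun x => cross z x t.1 t.2); rewrite /boundary => e.
rewrite -[LHS]addbF -[X in _ (+) X]e -big_split /= !big_seq; apply: eq_bigr => s sinA.
have [s1S s2S] := supportedP sA sinA; have [t1S t2S] := supportedP sB tB.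
have /and4P[h1 h2 h3 h4] := apAB _ _ sinA tB.
have /and4P[k1 k2 _ _] := apAB _ _ s0A tB.
rewrite -(cross_tri_gen gS zS s1S s2S t1S t2S) ?h1 ?h2 ?k1 ?k2//.
rewrite (crossC t.1) (cross_swap gS zS s2S)//.
by do 3!case: (cross _ _ _ _).
Qed.

Lemma overs_sym A B :
  (forall s t, s \in A -> t \in B -> seg_disjoint s.1 s.2 t.1 t.2) ->
  overs A B (+) overs B A = crossings A B.
Proof.
move=> dis; rewrite /overs [X in _ (+) X]exchange_big -big_split /crossings.
rewrite !big_seq; apply: eq_bigr => s sA; rewrite -big_split !big_seq.
by apply: eq_bigr => t tB; apply: overDover; exact: dis.
Qed.

(* [in_tri] may hold for triangles with equal vertices, which are excluded here. *)
Definition below a b c x := uniq [:: a; b; c] && under_tri a b c x.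

(** Disjointness at the ends of rs keeps r and s off the vertices of the triangle. If two of these
    vertices agree, one term is zero and the other two are equal. *)
Lemma over_tri S a b c (r s : P) : generic S -> a \in S -> b \in S -> c \in S ->
  r \in S -> s \in S -> tri_disjoint a b c r s ->
  overpass a b r s (+) overpass b c r s (+) overpass c a r s = below a b c r (+) below a b c s.
Proof.
move=> gS aS bS cS rS sS dis.
have [<-|rs] := eqVneq r s; first by rewrite !over_ptr !addbb.
have sc x y (u : R) : u = 0 -> (1 - u) *: x + u *: y = x :> P.
  by move=> ->; rewrite subr0 scale1r scale0r addr0.
have sc' x y (u : R) : u = 1 -> (1 - u) *: x + u *: y = y :> P.
  by move=> ->; rewrite subrr scale1r scale0r add0r.
have disr w1 w2 w3 : 0 <= w1 -> 0 <= w2 -> 0 <= w3 -> w1 + w2 + w3 = 1 ->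
    w1 *: a + w2 *: b + w3 *: c != r /\ w1 *: a + w2 *: b + w3 *: c != s.
  move=> h1 h2 h3 h; have := dis _ _ _ 0 h1 h2 h3 h; have := dis _ _ _ 1 h1 h2 h3 h.
  by rewrite (sc r s 0)// (sc' r s 1)// !lexx ler01 => -> // ->.
have [||||ar as_] := disr 1 0 0; rewrite ?ler01 ?addr0//.
have [||||br bs] := disr 0 1 0; rewrite ?ler01 ?addr0 ?add0r//.
have [||||cr cs] := disr 0 0 1; rewrite ?ler01 ?addr0 ?add0r//.
move: ar as_ br bs cr cs; rewrite !scale1r !scale0r ?addr0 ?add0r => ar as_ br bs cr cs.
rewrite /below; have [u3|] := boolP (uniq [:: a; b; c]).
  apply: (over_tri_uniq gS) => //; move: u3.
  rewrite /= !inE !negb_or => /and3P[/andP[-> ->] -> _].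
  by rewrite ar as_ br bs cr cs rs.
rewrite /= !inE !andbT negb_and !negbK.
move=> /orP[/orP[]|] /eqP e.
- by rewrite e over_pt (over_swap gS) ?addFb ?addbb -?e.
- by rewrite e over_pt addbF (over_swap gS)  ?addbb -?e.
- by rewrite e over_pt addbF (over_swap gS)  ?addbb -?e.
Qed.

(** Summed over B, the right-hand side of [over_tri] is the boundary of B at the test function
    [below a b c]. This is the only way in which disjointness in space makes a linking number
    vanish. *)
Lemma overs_triangle S a b c B : generic S -> a \in S -> b \in S -> c \in S ->
  supported S B -> closed_chain B ->
  (forall t, t \in B -> tri_disjoint a b c t.1 t.2) ->
  overs [:: (a, b); (b, c); (c, a)] B = false.
Proof.
move=> gS aS bS cS sB cB dis; rewrite /overs !big_cons big_nil addbF.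
rewrite -!big_split /= -[RHS](cB (below a b c)) /boundary !big_seq.
apply: eq_bigr => t tB; have [t1S t2S] := supportedP sB tB.
by rewrite -(over_tri gS)// ?addbA//; exact: dis.
Qed.

End Chains.

(** * Crossings of drawings of K_5 and K_{3,3} *)

Lemma addb_eq b c : b (+) c = false -> b = c.
Proof. by case: b; case: c. Qed.

(** Reduces a parity identity between unknown booleans to counting their names. *)
Lemma even_xor (T : eqType) (f : T -> bool) (r : seq T) :
  all (fun x => ~~ odd (count_mem x r)) r -> \xor_(x <- r) f x = false.
Proof.
move=> /allP ev; rewrite -big_undup_iterop_count xor_eq0// => x.
rewrite mem_undup => /ev; rewrite Monoid.iteropE.
have -> n : iter n (addb (f x)) false = odd n && f x.
  by elim: n => //= n ->; case: (odd n); case: (f x).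
by move=> /negbTE ->.
Qed.

Definition indep (e e' : nat * nat) :=
  [&& e.1 != e'.1, e.1 != e'.2, e.2 != e'.1 & e.2 != e'.2].

Lemma indepC e e' : indep e e' = indep e' e.
Proof.
rewrite /indep (eq_sym e.1 e'.1) (eq_sym e.1 e'.2) (eq_sym e.2 e'.1)
  (eq_sym e.2 e'.2).
by do 4!case: (_ != _).
Qed.

(** The edges disjoint from e form a triangle in K_5 and a 4-cycle in K_{3,3}. *)
Definition even_rest (E : seq (nat * nat)) := forall (psi : nat -> bool) e,
  e \in E -> \xor_(e' <- E | indep e e') (psi e'.1 (+) psi e'.2) = false.

Definition edges_K5 := [:: (0, 1); (0, 2); (0, 3); (0, 4); (1, 2); (1, 3);
  (1, 4); (2, 3); (2, 4); (3, 4)]%N.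

Definition edges_K33 := [:: (0, 3); (0, 4); (0, 5); (1, 3); (1, 4); (1, 5);
  (2, 3); (2, 4); (2, 5)]%N.

Lemma even_rest_K5 : even_rest edges_K5.
Proof.
move=> psi e; rewrite !inE; do ?[case/orP]; move/eqP->; rewrite !big_cons big_nil /=;
by case: (psi 0%N); case: (psi 1%N); case: (psi 2%N); case: (psi 3%N); case: (psi 4%N).
Qed.

Lemma even_rest_K33 : even_rest edges_K33.
Proof.
move=> psi e; rewrite !inE; do ?[case/orP]; move/eqP->; rewrite !big_cons big_nil /=;
by case: (psi 0%N); case: (psi 1%N); case: (psi 2%N); case: (psi 3%N);
  case: (psi 4%N); case: (psi 5%N).
Qed.

(** Independent edges have different first ends, so comparing these picks one order of each pair. *)
Lemma xor_sym (E : seq (nat * nat)) (F : nat * nat -> nat * nat -> bool) :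
  \xor_(e <- E) \xor_(e' <- E | indep e e') F e e' =
  \xor_(e <- E) \xor_(e' <- E | indep e e' && (e.1 < e'.1)%N) (F e e' (+) F e' e).
Proof.
under eq_bigr => e _ do rewrite (bigID (fun e' => e.1 < e'.1)%N) /=.
rewrite big_split /=.
under [RHS]eq_bigr => e _ do rewrite big_split /=.
rewrite big_split /=; congr (_ (+) _).
rewrite [in RHS](exchange_big_dep xpredT)//=; apply: eq_bigr => e _; apply: eq_bigl => e'.
rewrite indepC; case: (boolP (indep e' e)) => //= /and4P[h _ _ _].
by rewrite -leqNgt leq_eqVlt (negbTE h).
Qed.

Section VanKampen.
Variable R : realType.
Local Notation P := 'rV[R]_3.
Local Notation chain := (seq (P * P)).
Implicit Types (S : seq P) (A B : chain) (E : seq (nat * nat)).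

Definition straight_crossings E (pos : nat -> P) :=
  \xor_(e <- E) \xor_(e' <- E | indep e e' && (e.1 < e'.1)%N)
    cross (pos e.1) (pos e.2) (pos e'.1) (pos e'.2).

(* Formal names for the booleans in [four_points] and [in_tri_tetra], so that
   parity identities between them are decided by counting. *)
Definition config_val (pos : nat -> P) (w : seq nat) : bool :=
  if w is [:: k; a; b; c; d] then
    (if k == 0%N then @cross R else @in_tri R) (pos a) (pos b) (pos c) (pos d)
  else false.

Definition quad_word (w : seq nat) : seq (seq nat) :=
  if w is [:: a; b; c; d] then
    [:: [:: 0; a; b; c; d]; [:: 0; a; c; b; d]; [:: 0; a; d; b; c];
        [:: 1; a; b; c; d]; [:: 1; a; b; d; c]; [:: 1; a; c; d; b];
        [:: 1; b; c; d; a]]%N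
  else [::].

Definition tetra_word (w : seq nat) : seq (seq nat) :=
  if w is [:: a; b; c; d; x] then
    [:: [:: 1; a; b; c; x]; [:: 1; a; b; d; x]; [:: 1; a; c; d; x];
        [:: 1; b; c; d; x]]%N
  else [::].

Definition crossing_words E := [seq [:: 0; e.1; e.2; e'.1; e'.2]%N | e <- E,
  e' <- [seq e' <- E | indep e e' && (e.1 < e'.1)%N]].

Lemma straight_crossings_words E pos : straight_crossings E pos =
  \xor_(w <- crossing_words E) config_val pos w.
Proof.
rewrite big_allpairs_dep; apply: eq_bigr => e _.
by rewrite big_filter.
Qed.

(** Each word of Q stands for a sum that is true by [four_points], each word of T for one that is
    false by [in_tri_tetra]. If all names together occur evenly, the crossings have the parity of
    the number of words in Q. *)
Lemma straight_crossings_certificate n S pos E (Q T rest : seq (seq nat)) :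
  generic S -> (forall i, pos i \in S) -> {in [pred i | (i < n)%N] &, injective pos} ->
  all (fun w => [&& size w == 4%N, uniq w & all (ltn^~ n) w]) Q ->
  all (fun w => [&& size w == 5%N, uniq w & all (ltn^~ n) w]) T ->
  \xor_(w <- rest) config_val pos w = false ->
  let r := crossing_words E ++ flatten (map quad_word Q)
           ++ flatten (map tetra_word T) ++ rest in
  all (fun x => ~~ odd (count_mem x r)) r ->
  straight_crossings E pos = odd (size Q).
Proof.
move=> gS pS inj hQ hT hr r /(even_xor (config_val pos)).
have un s : all (ltn^~ n) s -> uniq s -> uniq (map pos s).
  by move=> /allP h us; rewrite map_inj_in_uniq// => i j /h hi /h hj; exact: inj.
rewrite !big_cat /= hr addbF -straight_crossings_words.
have -> : \xor_(w <- flatten (map tetra_word T)) config_val pos w = false.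
  elim: T hT {r} => [|w T IH]; first by rewrite big_nil.
  rewrite /= big_cat => /andP[/and3P[hw uw lw] /IH ->]; rewrite /= addbF.
  case: w hw uw lw => [//|a [//|b [//|c [//|d [//|x [|//]]]]]] _ uw lw.
  rewrite /tetra_word !big_cons big_nil /= addbF !addbA.
  by apply: (in_tri_tetra gS); rewrite ?pS//; exact: (un [:: a; b; c; d; x]).
rewrite /= addbF; have -> : \xor_(w <- flatten (map quad_word Q)) config_val pos w = odd (size Q).
  elim: Q hQ {r} => [|w Q IH]; first by rewrite big_nil.
  rewrite /= big_cat => /andP[/and3P[hw uw lw] /IH ->].
  case: w hw uw lw => [//|a [//|b [//|c [//|d [|//]]]]] _ uw lw.
  rewrite /quad_word !big_cons big_nil /= addbF !addbA.
  by rewrite (four_points gS) ?pS//; exact: (un [:: a; b; c; d]).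
exact: addb_eq.
Qed.

(** All five 4-subsets are used. Every point-in-triangle term occurs once there and once in the
    tetrahedron opposite to the point. *)
Lemma straight_crossings_K5 S pos : generic S -> (forall i, pos i \in S) ->
  {in [pred i | (i < 5)%N] &, injective pos} -> straight_crossings edges_K5 pos.
Proof.
move=> gS pS inj.
rewrite (straight_crossings_certificate (rest := [::])
  (Q := [:: [:: 0; 1; 2; 3]; [:: 0; 1; 2; 4]; [:: 0; 1; 3; 4]; [:: 0; 2; 3; 4];
            [:: 1; 2; 3; 4]]%N)
  (T := [:: [:: 0; 1; 2; 3; 4]; [:: 0; 1; 2; 4; 3]; [:: 0; 1; 3; 4; 2];
            [:: 0; 2; 3; 4; 1]; [:: 1; 2; 3; 4; 0]]%N) gS pS inj) //.
by rewrite big_nil.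
Qed.

(** Two points from each side give nine 4-subsets, whose pairings are two pairs of edges and one
    pair of segments within the sides. The latter are the crossings of the triangles 012 and 345, an
    even number. In T each of these two triangles occurs twice with each point of the other side. *)
Lemma straight_crossings_K33 S pos : generic S -> (forall i, pos i \in S) ->
  {in [pred i | (i < 6)%N] &, injective pos} -> straight_crossings edges_K33 pos.
Proof.
move=> gS pS inj.
pose tri := [:: (0, 1); (0, 2); (1, 2)]%N.
pose tri' := [:: (3, 4); (3, 5); (4, 5)]%N.
pose ch (t : seq (nat * nat)) : chain := [seq (pos e.1, pos e.2) | e <- t].
have cr : crossings (ch tri) (ch tri') = false.
  apply: (crossings_closed gS).
  - by apply/allP => s /mapP[e _ ->]; rewrite !pS.
  - by apply/allP => s /mapP[e _ ->]; rewrite !pS.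
  - have d i j : (i < 3)%N -> (2 < j < 6)%N -> pos i != pos j.
      move=> hi hj; apply/negP => /eqP /inj; rewrite !inE => h.
      have : i = j by apply: h; lia.
      lia.
    move=> s s' /mapP[e te ->] /mapP[e' te' ->] /=.
    have : [&& e.1 < 3, e.2 < 3, 2 < e'.1 < 6 & 2 < e'.2 < 6]%N.
      by move: te te'; rewrite !inE => /or3P[]/eqP-> /or3P[]/eqP->.
    by move=> /and4P[? ? ? ?]; rewrite !d.
  - move=> phi; rewrite /boundary !big_cons big_nil /=.
    by case: (phi (pos 0%N)); case: (phi (pos 1%N)); case: (phi (pos 2%N)).
  - move=> phi; rewrite /boundary !big_cons big_nil /=.
    by case: (phi (pos 3%N)); case: (phi (pos 4%N)); case: (phi (pos 5%N)).
rewrite (straight_crossings_certificate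
  (rest := [seq [:: 0; e.1; e.2; e'.1; e'.2]%N | e <- tri, e' <- tri'])
  (Q := [:: [:: 0; 1; 3; 4]; [:: 0; 1; 3; 5]; [:: 0; 1; 4; 5]; [:: 0; 2; 3; 4];
            [:: 0; 2; 3; 5]; [:: 0; 2; 4; 5]; [:: 1; 2; 3; 4]; [:: 1; 2; 3; 5];
            [:: 1; 2; 4; 5]]%N)
  (T := [:: [:: 0; 3; 4; 5; 1]; [:: 0; 3; 4; 5; 2]; [:: 1; 3; 4; 5; 0];
            [:: 1; 3; 4; 5; 2]; [:: 2; 3; 4; 5; 0]; [:: 2; 3; 4; 5; 1];
            [:: 0; 1; 2; 3; 4]; [:: 0; 1; 2; 3; 5]; [:: 0; 1; 2; 4; 3];
            [:: 0; 1; 2; 4; 5]; [:: 0; 1; 2; 5; 3]; [:: 0; 1; 2; 5; 4]]%N) gS pS inj) //.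
rewrite big_allpairs_dep -[RHS]cr /crossings big_map.
by apply: eq_bigr => e _; rewrite big_map.
Qed.

(* First sum: the contributions of the paths X cancel because the edges
   disjoint from a given edge form an even graph. Then, over a pair of disjoint
   edges, overs in both orders add up to the crossings; finally replacing every
   F e by the straight segment changes each by a closed chain. *)
Lemma linking_sum S E (pos : nat -> P) (F : nat * nat -> chain) (X : nat -> chain) apex :
  generic S -> (forall i, pos i \in S) -> even_rest E ->
  (forall e, e \in E -> supported S (F e)) ->
  (forall e phi, e \in E -> boundary (F e) phi = phi (pos e.1) (+) phi (pos e.2)) ->
  (forall u phi, boundary (X u) phi = phi (pos u) (+) phi apex) ->
  (forall e e', e \in E -> e' \in E -> indep e e' ->
     apart ((pos e.1, pos e.2) :: F e) ((pos e'.1, pos e'.2) :: F e')) ->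
  (forall e e' s t, e \in E -> e' \in E -> indep e e' -> s \in F e -> t \in F e' ->
     seg_disjoint s.1 s.2 t.1 t.2) ->
  \xor_(e <- E) overs (F e ++ X e.1 ++ X e.2)
     (flatten [seq F e' | e' <- E & indep e e']) = straight_crossings E pos.
Proof.
move=> gS pS ev sF bF bX apF disF.
have flat (f : chain -> chain -> bool) (f0 : forall A, f A [::] = false)
    (fc : forall A B C, f A (B ++ C) = f A B (+) f A C) A C (G : nat * nat -> chain) :
    f A (flatten [seq G e' | e' <- E & C e']) = \xor_(e' <- E | C e') f A (G e').
  elim: (E) => [|e E' IH]; first by rewrite big_nil f0.
  by rewrite big_cons /=; case: (C e); rewrite //= fc IH.
pose G e : chain := [:: (pos e.1, pos e.2)].
pose D (f : chain -> chain -> bool) (U V : nat * nat -> chain) :=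
  \xor_(e <- E) \xor_(e' <- E | indep e e' && (e.1 < e'.1)%N) f (U e) (V e').
have cG e e' : crossings (G e) (G e') = cross (pos e.1) (pos e.2) (pos e'.1) (pos e'.2).
  by rewrite /crossings !big_cons !big_nil /= !addbF.
transitivity (D (@crossings R) F F).
  transitivity (\xor_(e <- E) \xor_(e' <- E | indep e e') overs (F e) (F e')).
    under eq_bigr => e _ do rewrite !overs_catl.
    rewrite big_split /= -[RHS]addbF; congr (_ (+) _).
      apply: eq_bigr => e _; apply: flat => [A|A B C]; last exact: overs_catr.
      by rewrite /overs xor_eq0// => s _; rewrite big_nil.
    transitivity (\xor_(e <- E) \xor_(e' <- E | indep e e')
        (overs (X e.1) (F e') (+) overs (X e.2) (F e'))).
      apply: eq_bigr => e _; rewrite big_split /=.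
      congr (_ (+) _); apply: flat => [A|A B C]; try exact: overs_catr.
        by rewrite /overs xor_eq0// => s _; rewrite big_nil.
      by rewrite /overs xor_eq0// => s _; rewrite big_nil.
    rewrite (exchange_big_dep xpredT)//= xor_eq0// => e' eE'.
    rewrite -[RHS](ev (fun u => overs (X u) (F e')) _ eE').
    by apply: eq_bigl => e; rewrite indepC.
  rewrite xor_sym /D !big_seq; apply: eq_bigr => e eE; rewrite big_seq_cond [RHS]big_seq_cond.
  apply: eq_bigr => e' /and3P[eE' ee' _]; apply: overs_sym => s t sF' tF'.
  exact: (disF e e').
have cl e : e \in E -> closed_chain (F e ++ G e).
  by move=> eE phi; rewrite boundary_cat bF// /boundary big_cons big_nil /= addbF addbb.
have sG e : supported S (G e) by rewrite /supported /= !pS.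
have apFG e e' : e \in E -> e' \in E -> indep e e' -> apart (F e ++ G e) (F e' ++ G e').
  move=> eE eE' ee' s t sFG tFG; apply: (apF e e') => //.
    by move: sFG; rewrite mem_cat inE in_cons orbC.
  by move: tFG; rewrite mem_cat inE in_cons orbC.
(* [F e ++ G e] and [F e' ++ G e'] are closed and cross evenly; expanding this leaves the two mixed
   terms. *)
have FFGG : D (@crossings R) F F (+) D (@crossings R) G G =
    \xor_(e <- E) \xor_(e' <- E | indep e e') crossings (F e) (G e').
  rewrite xor_sym /D -big_split !big_seq; apply: eq_bigr => e eE.
  rewrite -big_split /= big_seq_cond [RHS]big_seq_cond.
  apply: eq_bigr => e' /and3P[eE' ee' _].
  have : crossings (F e ++ G e) (F e' ++ G e') = false.
    apply: (crossings_closed gS); rewrite ?supported_cat ?sG ?sF//.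
    + exact: apFG.
    + exact: cl.
    + exact: cl.
  rewrite !crossings_catl !crossings_catr (crossingsC (G e) (F e')).
  by do 4!case: (crossings _ _).
(* The straight edges disjoint from e form a closed chain, so F e may be replaced by G e; the sum is
   then symmetric and its terms cancel in pairs. *)
have FG0 : \xor_(e <- E) \xor_(e' <- E | indep e e') crossings (F e) (G e') = false.
  transitivity (\xor_(e <- E) \xor_(e' <- E | indep e e') crossings (G e) (G e')).
    rewrite !big_seq; apply: eq_bigr => e eE.
    pose BG := flatten [seq G e' | e' <- E & indep e e'].
    have BGP s : s \in BG -> exists2 e', e' \in E & indep e e' /\ s \in G e'.
      move=> /flattenP[_ /mapP[e' + ->]]; rewrite mem_filter => /andP[ee' eE'] sG'.
      by exists e'.
    have : crossings (F e ++ G e) BG = false.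
      apply: (crossings_closed gS); rewrite ?supported_cat ?sG ?sF//.
      - by apply/allP => s /BGP[e' _ [_ /(supportedP (sG e'))[-> ->]]].
      - by move=> s t sFG /BGP[e' eE' [ee' tG]]; apply: (apFG e e') => //; rewrite mem_cat tG orbT.
      - exact: cl.
      - move=> phi; rewrite (flat (fun _ B => boundary B phi) _ _ [::])//.
        + rewrite -[RHS](ev (phi \o pos) _ eE); apply: eq_bigr => e' _.
          by rewrite /boundary big_cons big_nil addbF.
        + by move=> _; rewrite /boundary big_nil.
        + by move=> *; exact: boundary_cat.
    rewrite /BG (flat (@crossings R)); last by move=> *; exact: crossings_catr.
      move=> h; apply: addb_eq; rewrite -big_split /= -[RHS]h.
      by apply: eq_bigr => e' _; rewrite crossings_catl.
    by move=> A; rewrite crossingsC /crossings big_nil.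
  rewrite xor_sym xor_eq0// => e eE; rewrite big1// => e' _.
  by rewrite crossingsC addbb.
move: FFGG; rewrite FG0 => /addb_eq ->.
by rewrite /D /straight_crossings; under eq_bigr => e _ do under eq_bigr => e' _ do rewrite cG.
Qed.

End VanKampen.

(** * Perturbation into general position *)

Section Perturbation.
Variable R : realType.
Local Notation P := 'rV[R]_3.
Implicit Types (p q x y : P) (S : seq P).

Lemma generic_sub S S' : {subset S' <= S} -> generic S -> generic S'.
Proof.
by move=> sub [h1 h2]; split=> [a b|a b c] *; [apply: h1|apply: h2] => //; exact: sub.
Qed.

Lemma polys_nonroot (ps : seq {poly R}) (e : R) : all (fun q : {poly R} => q != 0) ps -> 0 < e ->
  exists2 t, 0 < t < e & {in ps, forall p : {poly R}, p.[t] != 0}.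
Proof.
move=> ps0 e0; pose p : {poly R} := \prod_(q <- ps) q.
have p0 : p != 0 by rewrite prodf_seq_neq0.
(* More distinct candidates than p has roots; the index k.+2 keeps them below e. *)
pose rs := [seq e / k.+2%:R | k <- iota 0 (size p)].
have /allPn[t /mapP[k _ ->] nr] : ~~ all (root p) rs.
  apply/negP => /(max_poly_roots p0) lt.
  have : (size rs < size p)%N.
    apply: lt; rewrite map_inj_uniq ?iota_uniq// => i j.
    by move=> /(mulfI (lt0r_neq0 e0))/invr_inj/eqP; rewrite eqr_nat => /eqP[].
  by rewrite size_map size_iota ltnn.
exists (e / k.+2%:R).
  by rewrite divr_gt0//= ltr_pdivrMr// ltr_pMr// ltr1n.
by move: nr; rewrite /root horner_prod prodf_seq_neq0 => /allP.
Qed.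

(** The point y moves along the parabola t u + t^2 v, no arc of which lies on a line, whereas a
    straight path might stay on the line ab. Collinearity with a and b is a polynomial in t whose
    coefficients of degree 2 and 1 are, up to sign, the differences of the coordinates of a and
    b. *)
Lemma perturb1 S y (e : R) : generic S -> 0 < e ->
  exists2 y', `|y' - y| < e & generic (y' :: S).
Proof.
move=> [gS1 gS2] e0.
pose u : P := \row_j (if j == @Ordinal 3 0 isT then 1 else 0).
pose v : P := \row_j (if j == @Ordinal 3 1 isT then 1 else 0).
have [ux uy vx vy] : [/\ xc u = 1, yc u = 0, xc v = 0 & yc v = 1].
  by rewrite /xc /yc !mxE.
pose Q1 a : {poly R} := 'X - (xc a - xc y)%:P.
pose Q2 a b : {poly R} := if a == b then 1 else
  (xc b - xc a)%:P * ('X^2 + (yc y - yc a)%:P)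
  - (yc b - yc a)%:P * ('X + (xc y - xc a)%:P).
have [||t /andP[t0 te] tps] := @polys_nonroot
    ([seq Q1 a | a <- S] ++ [seq Q2 a b | a <- S, b <- S]) (Num.min 1 (e / (`|u| + `|v| + 1))).
- rewrite all_cat; apply/andP; split; apply/allP => q.
    by move=> /mapP[a _ ->]; rewrite polyXsubC_eq0.
  move=> /allpairsP[[a b] [/= aS bS ->]]; rewrite /Q2.
  have [_|ab] := eqVneq a b; first exact: oner_neq0.
  apply/eqP => /polyP h; have := gS1 _ _ aS bS ab; apply/negP/negPn.
  have := h 1%N; have := h 2%N; rewrite !(coefB, coefCM, coefD, coefXn, coefX, coefC, coef0) /=.
  rewrite !(addr0, mulr1, mulr0, add0r, subr0, sub0r) => /eqP + /eqP.
  by rewrite oppr_eq0 !subr_eq0 xpair_eqE eq_sym => -> ; rewrite eq_sym.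
- rewrite lt_min ltr01 /=; apply: divr_gt0 => //.
move: te; rewrite lt_min => /andP[t1 te].
pose y' := y + (t *: u + t ^+ 2 *: v).
have ex : xc y' = xc y + t by rewrite /y' !coordE ux vx; ring.
have ey : yc y' = yc y + t ^+ 2 by rewrite /y' !coordE uy vy; ring.
exists y'.
  rewrite /y' addrAC subrr add0r (le_lt_trans (ler_normD _ _))// !normrZ.
  rewrite !ger0_norm ?exprn_ge0 ?(ltW t0)//.
  have h1 : 0 < `|u| + `|v| + 1 by have := normr_ge0 u; have := normr_ge0 v; lra.
  have h2 : t ^+ 2 * `|v| <= t * `|v|.
    by rewrite ler_wpM2r// expr2 ler_piMr// ltW.
  by move: te; rewrite ltr_pdivlMr//; lra.
have new a : a \in S -> xc a != xc y'.
  move=> aS; have : (Q1 a).[t] != 0 by apply: tps; rewrite mem_cat map_f.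
  by rewrite /Q1 hornerXsubC ex => h; apply/eqP => e'; move/eqP: h; apply; rewrite e'; ring.
have new2 a b : a \in S -> b \in S -> a != b -> orient a b y' != 0.
  move=> aS bS ab; have : (Q2 a b).[t] != 0.
    by apply: tps; rewrite mem_cat allpairs_f ?orbT.
  rewrite /Q2 (negbTE ab) !(hornerD, hornerN, hornerM, hornerC, hornerX, hornerXn).
  rewrite /orient ex ey => h; apply/eqP => e'.
  by move/eqP: h; apply; rewrite -[RHS]e'; ring.
split=> [a b|a b c]; rewrite !inE.
- move=> /orP[/eqP->|aS] /orP[/eqP->|bS]; first by rewrite eqxx.
  + by move=> _; rewrite xpair_eqE negb_and eq_sym new.
  + by move=> _; rewrite xpair_eqE negb_and new.
  + exact: gS1.
- move=> /orP[/eqP->|aS] /orP[/eqP->|bS] /orP[/eqP->|cS]; rewrite ?eqxx//.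
  + by move=> _ bc _; rewrite -orient_rot; exact: new2.
  + by move=> _ _ ac; rewrite orient_swap oppr_eq0 -orient_rot; exact: new2.
  + by move=> ab _ _; exact: new2.
  + exact: gS2.
Qed.

(** S stays fixed because it may hold chains already in general position. As tau is a function of
    points, equal points move together and chains stay connected. *)
Lemma perturb S (L : seq P) (e : R) : generic S -> 0 < e ->
  exists2 tau : P -> P, {in L, forall y, `|tau y - y| < e}
                      & generic (S ++ map tau L).
Proof.
move=> gS e0; elim: L => [|y L [tau tauL gL]]; first by exists id; rewrite ?cats0.
have [yL|yL] := boolP (y \in L).
  exists tau => [z|].
    by rewrite inE => /orP[/eqP->|]; exact: tauL.
  apply: generic_sub gL => z; rewrite !mem_cat inE => /or3P[->//|/eqP->|->].
    by rewrite map_f ?orbT.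
  by rewrite orbT.
have [y' yy' gy'] := perturb1 y gL e0.
exists (fun z => if z == y then y' else tau z) => [z|].
  by rewrite inE; have [->//|_ /=] := eqVneq z y; exact: tauL.
apply: generic_sub gy' => z; rewrite mem_cat /= !inE eqxx mem_cat.
move=> /or3P[->|->//|/mapP[x xL ->]]; rewrite ?orbT//.
have [exy|_] := eqVneq x y; first by rewrite -exy xL in yL.
by rewrite map_f ?orbT.
Qed.

End Perturbation.

(** * Split links have linking number zero *)

Section Splitting.
Variable R : realType.
Local Notation P := 'rV[R]_3.
Local Notation chain := (seq (P * P)).
Implicit Types (p q x y : P) (A B K : set P) (S : seq P).

Lemma compact_uniform m n (f : 'rV[R]_m -> 'rV[R]_n) (K : set 'rV[R]_m) (e : R) :
  compact K -> {within K, continuous f} -> 0 < e ->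
  exists2 d, 0 < d & forall x y : 'rV_m, K x -> K y -> `|x - y| < d -> `|f x - f y| < e.
Proof.
move=> /compact_near_coveringP cK /subspace_continuousP cf e0.
pose Q (d : R) (x : 'rV_m) := K x -> forall y : 'rV_m, K y -> `|x - y| < d -> `|f x - f y| < e.
have : \forall d \near 0^'+, K `<=` Q d.
  apply: (cK R 0^'+ Q) => x Kx.
  have /cvgrPdist_lt /(_ (e / 2)) := cf x Kx.
  rewrite divr_gt0// => /(_ isT) /nbhs_ballP[r /= r0 hr].
  have r20 : 0 < r / 2 by rewrite divr_gt0.
  exists (ball x (r / 2), [set d | d < r / 2]) => /=.
    by split; [exact: nbhsx_ballx|exact: nbhs_right_lt].
  move=> [x' d] /= []; rewrite -ball_normE /= => xx' dr Kx' y Ky xy.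
  have h1 := hr x'; have h2 := hr y; move: h1 h2; rewrite -ball_normE /= => h1 h2.
  have {}h1 : `|f x - f x'| < e / 2 by apply: h1 => //; lra.
  have {}h2 : `|f x - f y| < e / 2.
    by apply: h2 => //; have := ler_distD x' x y; lra.
  have := ler_distD (f x) (f x') (f y); rewrite (distrC (f x') (f x)); lra.
move=> h; have [d [hd d0]] : exists d : R, K `<=` Q d /\ 0 < d.
  apply: (@filter_ex _ (0 : R)^'+); apply: filterI => //; exact: nbhs_right_gt.
by exists d => // x y Kx Ky xy; exact: hd.
Qed.

Lemma compact_dist A B : compact A -> compact B -> A `&` B = set0 ->
  exists2 d : R, 0 < d & forall x y, A x -> B y -> d <= `|x - y|.
Proof.
move=> /compact_near_coveringP cA cB AB.
have clB : closed B by apply: compact_closed => //; exact: norm_hausdorff.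
pose Q (d : R) x := forall y, B y -> d <= `|x - y|.
have : \forall d \near 0^'+, A `<=` Q d.
  apply: (cA R 0^'+ Q) => x Ax.
  have : nbhs x (~` B).
    apply: open_nbhs_nbhs; split; first exact: closed_openC.
    by move=> Bx; have : (A `&` B) x by []; rewrite AB.
  move=> /nbhs_ballP[r /= r0 hr].
  have r20 : 0 < r / 2 by rewrite divr_gt0.
  exists (ball x (r / 2), [set d | d < r / 2]) => /=.
    by split; [exact: nbhsx_ballx|exact: nbhs_right_lt].
  move=> [x' d] /= []; rewrite -ball_normE /= => xx' dr y By.
  rewrite leNgt; apply/negP => xy.
  by apply: (hr y) => //; rewrite -ball_normE /=; have := ler_distD x' x y; lra.
move=> h; have [d [hd d0]] : exists d : R, A `<=` Q d /\ 0 < d.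
  apply: (@filter_ex _ (0 : R)^'+); apply: filterI => //; exact: nbhs_right_gt.
by exists d => // x y Ax By; exact: hd.
Qed.

Definition sqnorm x : R := \sum_i x ord0 i ^+ 2.

Lemma sqnormE x : sqnorm x = xc x ^+ 2 + yc x ^+ 2 + zc x ^+ 2.
Proof.
rewrite /sqnorm !big_ord_recl big_ord0 addr0 addrA /xc /yc /zc.
by congr (x _ _ ^+ 2 + x _ _ ^+ 2 + x _ _ ^+ 2); apply/val_inj.
Qed.

Lemma sqnorm_ge0 x : 0 <= sqnorm x.
Proof. by apply: sumr_ge0 => i _; exact: sqr_ge0. Qed.

Lemma sqnorm_norm x : sqnorm x <= 1 -> `|x| <= 1.
Proof.
move=> h; rewrite [leLHS]/Num.norm /= mx_normrE; apply/bigmax_leP; split=> // -[i j] _ /=.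
rewrite (ord1 i) -(@ler_pXn2r _ 2) ?nnegrE// expr1n real_normK ?num_real//.
apply: le_trans h; rewrite /sqnorm (bigD1 j)//= lerDl.
by apply: sumr_ge0 => k _; exact: sqr_ge0.
Qed.

Lemma sqnorm_continuous : continuous sqnorm.
Proof.
have -> : sqnorm = (fun x => xc x ^+ 2 + yc x ^+ 2 + zc x ^+ 2).
  by apply/funext => x; exact: sqnormE.
have sq i : continuous (fun x : P => x ord0 i ^+ 2).
  move=> x; apply: (@continuous_comp _ _ _ (fun x : P => x ord0 i) (fun t : R => t ^+ 2)).
    exact: coord_continuous.
  exact: exprn_continuous.
have add (f g : P -> R) : continuous f -> continuous g -> continuous (fun x => f x + g x).
  by move=> cf cg x; apply: continuousD; [exact: cf|exact: cg].
by apply: (add (fun x => xc x ^+ 2 + yc x ^+ 2)); [apply: add|]; exact: sq.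
Qed.

Lemma sqnorm_ball_compact : compact [set x | sqnorm x <= 1].
Proof.
apply: bounded_closed_compact.
  exists 1; split=> // M M1 x /= /sqnorm_norm h.
  by apply: le_trans h _; exact: ltW.
by apply: (@closed_comp _ _ _ [set t : R | t <= 1]) => [x _|]; [exact: sqnorm_continuous|exact: closed_le].
Qed.

Definition near_chain (d : R) A (c : chain) := forall s, s \in c ->
  [/\ exists2 x, A x & `|s.1 - x| < d, exists2 x, A x & `|s.2 - x| < d
    & `|s.1 - s.2| < d].

Lemma near_chainW (d d' : R) A A' c : d <= d' -> A `<=` A' -> near_chain d A c ->
  near_chain d' A' c.
Proof.
move=> dd AA nc s /nc[[x Ax sx] [y Ay sy] ss].
by split; [exists x|exists y|]; rewrite ?(lt_le_trans _ dd)//; exact: AA.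
Qed.

Lemma near_segment (p q x : P) (d u : R) : `|p - x| < d -> `|p - q| < d -> 0 <= u <= 1 ->
  `|x - ((1 - u) *: p + u *: q)| < d + d.
Proof.
move=> px pq /andP[u0 u1].
have -> : x - ((1 - u) *: p + u *: q) = (x - p) + u *: (p - q).
  by rewrite scalerBl scale1r scalerBr !opprD !opprK !addrA.
rewrite (le_lt_trans (ler_normD _ _))// normrZ (ger0_norm u0) distrC ltr_leD//.
apply: le_trans (ltW pq); by rewrite ler_piMl.
Qed.

(** Every point of a segment is within 2 d of its set, whence the factor 4. *)
Lemma near_chain_disjoint (d : R) A B a b :
  (forall x y, A x -> B y -> 4 * d <= `|x - y|) ->
  near_chain d A a -> near_chain d B b ->
  forall s t, s \in a -> t \in b -> seg_disjoint s.1 s.2 t.1 t.2.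
Proof.
move=> dAB na nb s t /na[[x Ax sx] _ ss] /nb[[y By ty] _ tt] v u v01 u01.
apply/eqP => e; have := near_segment sx ss v01; have := near_segment ty tt u01.
rewrite -e distrC => h1 h2.
have := dAB _ _ Ax By; have := ler_distD ((1 - v) *: s.1 + v *: s.2) x y; lra.
Qed.

Lemma seg_disjoint_apart (a b : chain) :
  (forall s t, s \in a -> t \in b -> seg_disjoint s.1 s.2 t.1 t.2) -> apart a b.
Proof.
move=> h s t /h{}h /h{}h.
have e0 (p q : P) : p = (1 - 0) *: p + 0 *: q by rewrite subr0 scale1r scale0r addr0.
have e1 (p q : P) : q = (1 - 1) *: p + 1 *: q by rewrite subrr scale1r scale0r add0r.
have hh (v u : R) : 0 <= v <= 1 -> 0 <= u <= 1 ->
    (1 - v) *: s.1 + v *: s.2 != (1 - u) *: t.1 + u *: t.2 by exact: h.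
have i0 : 0 <= (0 : R) <= 1 by rewrite lexx ler01.
have i1 : 0 <= (1 : R) <= 1 by rewrite lexx ler01.
apply/and4P; split.
- by rewrite (e0 s.1 s.2) (e0 t.1 t.2); exact: hh.
- by rewrite (e0 s.1 s.2) [t.2](e1 t.1); exact: hh.
- by rewrite [s.2](e1 s.1) (e0 t.1 t.2); exact: hh.
- by rewrite [s.2](e1 s.1) [t.2](e1 t.1); exact: hh.
Qed.

(** The triangle stays within 3 d of k and the segment within 2 d of x. *)
Lemma tri_disjoint_far (a b c r s k x : P) (d : R) :
  `|a - k| < 3 * d -> `|b - k| < 3 * d -> `|c - k| < 3 * d ->
  `|r - x| < d -> `|r - s| < d -> 5 * d <= `|k - x| -> tri_disjoint a b c r s.
Proof.
move=> ak bk ck rx rs kx w1 w2 w3 u w10 w20 w30 w u01; apply/eqP => e.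
have := near_segment rx rs u01; rewrite -e => h1.
have h2 : `|w1 *: a + w2 *: b + w3 *: c - k| <= 3 * d.
  have -> : w1 *: a + w2 *: b + w3 *: c - k = w1 *: (a - k) + w2 *: (b - k) + w3 *: (c - k).
    have -> : w3 = 1 - w1 - w2 by lra.
    by apply/rowP => i; rewrite !mxE; ring.
  rewrite (le_trans (ler_normD _ _))//; have := ler_normD (w1 *: (a - k)) (w2 *: (b - k)).
  rewrite !normrZ !ger0_norm// => h3.
  have k1 : w1 * `|a - k| <= w1 * (3 * d) by rewrite ler_wpM2l// ltW.
  have k2 : w2 * `|b - k| <= w2 * (3 * d) by rewrite ler_wpM2l// ltW.
  have k3 : w3 * `|c - k| <= w3 * (3 * d) by rewrite ler_wpM2l// ltW.
  have -> : 3 * d = w1 * (3 * d) + w2 * (3 * d) + w3 * (3 * d) by rewrite -!mulrDl w mul1r.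
  lra.
move: (w1 *: a + w2 *: b + w3 *: c) h1 h2 {e} => y; rewrite distrC => h1 h2.
by have := ler_distD y k x; rewrite (distrC k y); lra.
Qed.

(** A square of the ladder cut into two triangles: b2 is the diagonal, b1 and b4 lie on consecutive
    levels, b3 and b5 join the levels. *)
Lemma xor_ladder (b1 b2 b3 b4 b5 : bool) :
  b1 (+) b2 (+) b3 = false -> b2 (+) b4 (+) b5 = false -> b1 (+) b4 = b3 (+) b5.
Proof. by case: b1; case: b2; case: b3; case: b4; case: b5. Qed.

Lemma dist3 (x y z w : P) (e : R) :
  `|x - y| < e -> `|y - z| < e -> `|z - w| < e -> `|x - w| < 3 * e.
Proof.
by move=> h1 h2 h3; have := ler_distD y x w; have := ler_distD z y w; lra.
Qed.

(* Contract A to a point inside the image under h^-1 of the open unit ball: A is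
   joined to a constant chain by a ladder of small triangles that avoid B. *)
Lemma overs_inside A B (h g : P -> P) : compact A -> compact B ->
  continuous h -> continuous g -> cancel h g -> cancel g h ->
  (forall x, A x -> sqnorm (h x) < 1) -> (forall x, B x -> 1 < sqnorm (h x)) ->
  exists2 d : R, 0 < d & forall S (a b : chain), generic S -> supported S a ->
    supported S b -> closed_chain a -> closed_chain b ->
    near_chain d A a -> near_chain d B b -> overs a b = false.
Proof.
move=> cA cB ch cg hg gh hA hB.
have [d0 d00 dKB] : exists2 d0 : R, 0 < d0 &
    forall x y, sqnorm x <= 1 -> B y -> d0 <= `|g x - y|.
  pose K := g @` [set y | sqnorm y <= 1].
  have cK : compact K.
    apply: continuous_compact; last exact: sqnorm_ball_compact.
    exact: continuous_subspaceT.
  have KB : K `&` B = set0.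
    by apply/seteqP; split=> // _ [[y /= hy <-]] /hB; rewrite gh ltNge hy.
  have [d0 d00 dKB] := compact_dist cK cB KB.
  by exists d0 => // x y hx By; apply: dKB => //; exists x.
(* Leaves room for the distance 5 * e required by [tri_disjoint_far]. *)
have [e e0 ed] : exists2 e : R, 0 < e & d0 = 8 * e.
  by exists (d0 / 8); [rewrite divr_gt0|field].
have [eta eta0 ug] := compact_uniform sqnorm_ball_compact (continuous_subspaceT cg) e0.
have [d1 d10 uh] := compact_uniform cA (continuous_subspaceT ch) eta0.
have [d [d_gt0 de dd1]] : exists d : R, [/\ 0 < d, d <= e & 3 * d <= d1].
  exists (Num.min e (d1 / 3)); split.
  - by rewrite lt_min e0 divr_gt0.
  - by rewrite ge_min lexx.
  - by rewrite mulrC -ler_pdivlMr// ge_min lexx orbT.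
have [M M1] : exists M : nat, M.+1%:R^-1 < eta.
  by have [M] := ltr_add_invr eta0; rewrite add0r => hM; exists M.
exists d => // S a b gS sa sb ca cb na nb.
(* The vertices of the chain are only close to A, but h is controlled on A, so nearby points of A
   are contracted in their place; 0 is a default value. *)
pose near p := xget 0 [set x | A x /\ `|p - x| < d].
have nearP p : (exists2 x, A x & `|p - x| < d) -> A (near p) /\ `|p - near p| < d.
  by move=> [x Ax px]; rewrite /near; case: xgetP => [y -> //|/(_ x)[]].
(* The factor falls from 1 at level 0 to 0 at level M.+1. The ball is star-shaped, so all points T p
   j stay in its preimage, away from B. *)
pose c (j : nat) : R := 1 - j%:R / M.+1%:R.
pose T p j := g (c j *: h (near p)).
pose L := [seq T p j | p <- [seq s.1 | s <- a] ++ [seq s.2 | s <- a], j <- iota 0 M.+2].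
have [tau tauL gL] := perturb L gS e0.
(* Level 0 is the given chain itself, which is not perturbed. *)
pose rho p (j : nat) := if j == 0%N then p else tau (T p j).
pose pts := [set p | exists2 x, A x & `|p - x| < d].
pose a_ j : chain := [seq (rho s.1 j, rho s.2 j) | s <- a].
have c01 j : (j <= M.+1)%N -> 0 <= c j <= 1.
  move=> jM; rewrite subr_ge0 ler_pdivrMr ?mul1r ?ler_nat//= jM /=.
  by rewrite lerBlDr lerDl divr_ge0.
have inK p j : pts p -> (j <= M.+1)%N -> sqnorm (c j *: h (near p)) <= 1.
  move=> /nearP[/hA + _] /c01/andP[c0 c1]; rewrite !sqnormE !coordE => hp.
  rewrite !exprMn -!mulrDr.
  have : c j ^+ 2 <= 1 by rewrite expr_le1.
  have := sqr_ge0 (c j); move: hp; rewrite -!sqnormE; have := sqnorm_ge0 (h (near p)).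
  by move=> *; nra.
have TK p j x : pts p -> (j <= M.+1)%N -> B x -> d0 <= `|T p j - x|.
  by move=> pp jM; apply: dKB; exact: inK.
have tl s j : s \in a -> (j <= M.+1)%N -> T s.1 j \in L /\ T s.2 j \in L.
  by move=> sa' jM; split; apply: allpairs_f; rewrite ?mem_cat ?mem_iota// map_f ?orbT.
have endpts s : s \in a -> pts s.1 /\ pts s.2 by move=> /na[].
have T_edge s j : s \in a -> (j <= M.+1)%N -> `|T s.2 j - T s.1 j| < e.
  move=> sa' jM; have [_ _ ss] := na _ sa'; have [p1 p2] := endpts _ sa'.
  have [[A1 n1] [A2 n2]] := (nearP _ p1, nearP _ p2).
  have h1 : `|near s.2 - near s.1| < d1.
    rewrite distrC in n2; rewrite distrC in ss.
    exact: lt_le_trans (dist3 n2 ss n1) dd1.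
  apply: ug; [exact: inK|exact: inK|].
  rewrite -scalerBr normrZ; have /andP[c0 c1] := c01 _ jM.
  rewrite (ger0_norm c0); apply: le_lt_trans (uh _ _ A2 A1 h1).
  by rewrite ler_piMl.
have T_step p j : pts p -> (j < M.+1)%N -> `|T p j - T p j.+1| < e.
  move=> pp jM; apply: ug; [by apply: inK => //; exact: ltnW|exact: inK|].
  have /sqnorm_norm h1 : sqnorm (h (near p)) <= 1.
    by apply: ltW; apply: hA; have [] := nearP _ pp.
  have cc : c j - c j.+1 = M.+1%:R^-1.
    by rewrite /c -(natr1 j) mulrDl mul1r; move: (M.+1%:R^-1) => m; ring.
  rewrite -scalerBl normrZ cc ger0_norm ?invr_ge0//; apply: le_lt_trans M1.
  by rewrite ler_piMr// invr_ge0.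
have rhoT s j : s \in a -> (j <= M.+1)%N ->
    `|rho s.1 j - T s.1 j| < e /\ `|rho s.2 j - T s.2 j| < e.
  move=> sa' jM; have [t1 t2] := tl _ _ sa' jM; rewrite /rho.
  have [->|_] := eqVneq j 0%N; last by split; exact: tauL.
  have T0 p : T p 0%N = near p by rewrite /T /c mul0r subr0 scale1r hg.
  have [p1 p2] := endpts _ sa'; rewrite !T0.
  have [_ n1] := nearP _ p1; have [_ n2] := nearP _ p2.
  by split; [exact: lt_le_trans n1 de|exact: lt_le_trans n2 de].
have rhoS s j : s \in a -> (j <= M.+1)%N ->
    rho s.1 j \in S ++ map tau L /\ rho s.2 j \in S ++ map tau L.
  move=> sa' jM; have [t1 t2] := tl _ _ sa' jM; rewrite /rho.
  have [_|_] := eqVneq j 0%N; last by rewrite !mem_cat !map_f ?orbT.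
  by have [s1S s2S] := supportedP sa sa'; rewrite !mem_cat s1S s2S.
have sb' : supported (S ++ map tau L) b.
  by apply/allP => t /(supportedP sb)[t1S t2S]; rewrite !mem_cat t1S t2S.
have step j : (j < M.+1)%N -> overs (a_ j) b = overs (a_ j.+1) b.
  move=> jM; have jM' := ltnW jM.
  pose ov x y := overs [:: (x, y)] b.
  have ovE i : overs (a_ i) b = \xor_(s <- a) ov (rho s.1 i) (rho s.2 i).
    rewrite /overs big_map; apply: eq_bigr => s _.
    by rewrite /ov /overs big_cons big_nil addbF.
  have tri s (x y z : P) : s \in a ->
      [&& x \in S ++ map tau L, y \in S ++ map tau L & z \in S ++ map tau L] ->
      [/\ `|x - T s.1 j| < 3 * e, `|y - T s.1 j| < 3 * e & `|z - T s.1 j| < 3 * e] ->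
      ov x y (+) ov y z (+) ov z x = false.
    move=> sa' /and3P[xS yS zS] [hx hy hz].
    have := overs_triangle gL xS yS zS sb' cb.
    rewrite /ov /overs !big_cons !big_nil !addbF => h'; rewrite -addbA; apply: h' => t tb.
    have [[y0 By0 ty0] _ tt] := nb _ tb.
    apply: (tri_disjoint_far hx hy hz (x := y0)).
    + exact: lt_le_trans de.
    + exact: lt_le_trans de.
    + by have := TK _ _ _ (endpts _ sa').1 jM' By0; lra.
  apply: addb_eq; rewrite !ovE -big_split /=.
  (* The segments joining the two levels cancel because a is closed. *)
  rewrite -[RHS](ca (fun p => ov (rho p j.+1) (rho p j))) /boundary !big_seq.
  apply: eq_bigr => s sa'.
  have [r1 r2] := rhoT _ _ sa' jM'; have [r3 r4] := rhoT _ _ sa' jM.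
  have [S1 S2] := rhoS _ _ sa' jM'; have [S3 S4] := rhoS _ _ sa' jM.
  have [p1 p2] := endpts _ sa'.
  have t1 := T_step _ _ p1 jM; have t2 := T_step _ _ p2 jM; have t3 := T_edge _ _ sa' jM'.
  have e00 x : `|x - x| < e by rewrite subrr normr0.
  rewrite distrC in t1; rewrite distrC in t2.
  have k1 := dist3 r1 (e00 _) (e00 _); have k2 := dist3 r2 t3 (e00 _).
  have k3 := dist3 r3 t1 (e00 _); have k4 := dist3 r4 t2 t3.
  have := tri s (rho s.1 j) (rho s.2 j) (rho s.1 j.+1) sa'; rewrite S1 S2 S3.
  move=> /(_ isT (And3 k1 k2 k3)) tr1.
  have := tri s (rho s.2 j) (rho s.1 j.+1) (rho s.2 j.+1) sa'; rewrite S2 S3 S4.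
  move=> /(_ isT (And3 k2 k3 k4)) tr2.
  exact: xor_ladder tr1 tr2.
transitivity (overs (a_ 0%N) b).
  by congr overs; rewrite /a_ /rho /= -[LHS]map_id; apply: eq_map => -[].
have -> : overs (a_ 0%N) b = overs (a_ M.+1) b.
  have stepn m : (m <= M.+1)%N -> overs (a_ 0%N) b = overs (a_ m) b.
    by elim: m => // m IH mM; rewrite (IH (ltnW mM)); exact: step.
  exact: stepn.
(* At the last level every vertex is tau (g 0), so all segments are points. *)
rewrite /overs xor_eq0// => _ /mapP[s sa' ->]; rewrite /rho /= /T /c.
rewrite divff ?pnatr_eq0// subrr !scale0r.
by rewrite xor_eq0// => t _; rewrite over_pt.
Qed.

(* The two cases of the definition are exchanged by [overs_sym], as crossings
   of closed chains are even. *)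
Lemma overs_split A B : compact A -> compact B -> split_link A B ->
  exists2 d : R, 0 < d & forall S (a b : chain), generic S -> supported S a ->
    supported S b -> closed_chain a -> closed_chain b ->
    near_chain d A a -> near_chain d B b -> overs a b = false.
Proof.
move=> cA cB [h [ch [g [cg hg gh]]] [[hA hB]|[hB hA]]].
  exact: (overs_inside cA cB ch cg).
have [d1 d10 H] := overs_inside cB cA ch cg hg gh hB hA.
have AB : A `&` B = set0.
  by apply/seteqP; split=> // x [/hA h1 /hB]; rewrite ltNge ltW.
have [d2 d20 dAB] := compact_dist cA cB AB.
exists (Num.min d1 (d2 / 4)) => [|S a b gS sa sb ca cb na nb].
  by rewrite lt_min d10 divr_gt0.
have na1 : near_chain d1 A a by apply: near_chainW na => //; rewrite ge_min lexx.
have nb1 : near_chain d1 B b by apply: near_chainW nb => //; rewrite ge_min lexx.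
have na2 : near_chain (d2 / 4) A a by apply: near_chainW na => //; rewrite ge_min lexx orbT.
have nb2 : near_chain (d2 / 4) B b by apply: near_chainW nb => //; rewrite ge_min lexx orbT.
have dis : forall s t, s \in a -> t \in b -> seg_disjoint s.1 s.2 t.1 t.2.
  apply: near_chain_disjoint na2 nb2 => x y Ax By.
  by have := dAB _ _ Ax By; rewrite mulrC divfK ?pnatr_eq0.
have := overs_sym dis; rewrite (H S b a)// addbF => ->.
exact: (crossings_closed gS sa sb (seg_disjoint_apart dis)).
Qed.

End Splitting.

(** * Linked cycles over K_5 and K_{3,3} *)

Section LinkedCore.
Variable R : realType.
Local Notation P := 'rV[R]_3.
Local Notation chain := (seq (P * P)).
Implicit Types (p q x y : P) (K : set P) (S : seq P) (E : seq (nat * nat)).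

(** The discrete substitute for a path from x to y in K. *)
Definition chainable K x y := forall d : R, 0 < d -> exists l : seq P,
  [/\ last x l = y, path (fun p q => `|p - q| < d) x l
    & forall p, p \in x :: l -> K p].

Definition segs x (l : seq P) : chain := pairmap pair x l.

Lemma boundary_segs x l phi : boundary (segs x l) phi = phi x (+) phi (last x l).
Proof.
elim: l x => [|y l IH] x; first by rewrite /boundary big_nil addbb.
rewrite /boundary big_cons /= -[X in _ (+) X]/(boundary (segs y l) phi) IH.
by case: (phi y); case: (phi x); case: (phi _).
Qed.

Lemma segsP x l s (d : R) : path (fun p q => `|p - q| < d) x l -> s \in segs x l ->
  [/\ s.1 \in x :: l, s.2 \in x :: l & `|s.1 - s.2| < d].
Proof.
elim: l x => [//|y l IH] x /= /andP[xy pl]; rewrite inE => /orP[/eqP->|sl] /=.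
  by rewrite !inE !eqxx orbT.
by have [h1 h2 h3] := IH _ pl sl; rewrite !in_cons in h1 h2 *; rewrite h1 h2 !orbT.
Qed.

Lemma segs_map (tau : P -> P) x l :
  segs (tau x) (map tau l) = [seq (tau s.1, tau s.2) | s <- segs x l].
Proof. by elim: l x => //= y l IH x; rewrite /segs /= -IH. Qed.

Lemma common_radius (T : eqType) (s : seq T) (Q : T -> R -> Prop) :
  (forall t, t \in s -> exists2 d : R, 0 < d & Q t d) ->
  (forall t (d d' : R), 0 < d' -> d' <= d -> Q t d -> Q t d') ->
  exists2 d : R, 0 < d & forall t, t \in s -> Q t d.
Proof.
move=> + mono; elim: s => [|t s IH] H; first by exists 1.
have [|d d0 hd] := IH; first by move=> u us; apply: H; rewrite inE us orbT.
have [d' d'0 hd'] := H t (mem_head _ _).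
exists (Num.min d d') => [|u]; first by rewrite lt_min d0 d'0.
have m0 : 0 < Num.min d d' by rewrite lt_min d0 d'0.
rewrite inE => /orP[/eqP->|us]; first by apply: mono hd'; rewrite ?ge_min ?lexx ?orbT.
by apply: mono (hd _ us); rewrite ?ge_min ?lexx.
Qed.

(** Phi and Xi stand for the images of the base edges and of the paths, A and B for the two cycles,
    of which only the stated inclusions matter. By [linking_sum], terms that all vanish would add up
    to an odd number of crossings. *)
Lemma linked_core n E (Q : nat -> P) apex (Phi A B : nat * nat -> set P)
    (Xi : nat -> set P) :
  (0 < n)%N -> even_rest E ->
  (forall S pos, generic S -> (forall i, pos i \in S) ->
     {in [pred i | (i < n)%N] &, injective pos} -> straight_crossings E pos) ->
  (forall e, e \in E -> (e.1 < n)%N && (e.2 < n)%N) ->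
  {in [pred i | (i < n)%N] &, injective Q} ->
  (forall e, e \in E -> chainable (Phi e) (Q e.1) (Q e.2)) ->
  (forall u, (u < n)%N -> chainable (Xi u) (Q u) apex) ->
  (forall e, e \in E -> [/\ compact (Phi e), compact (A e) & compact (B e)]) ->
  (forall e e', e \in E -> e' \in E -> indep e e' -> Phi e `&` Phi e' = set0) ->
  (forall e, e \in E -> [/\ Phi e `<=` A e, Xi e.1 `<=` A e & Xi e.2 `<=` A e]) ->
  (forall e e', e \in E -> e' \in E -> indep e e' -> Phi e' `<=` B e) ->
  ~ (forall e, e \in E -> split_link (A e) (B e)).
Proof.
move=> n0 evE scE En Qinj Phich Xich cpt dis subA subB spl.
have [d1 d10 H1] : exists2 d : R, 0 < d & forall e, e \in E ->
    forall S (a b : chain), generic S -> supported S a ->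
    supported S b -> closed_chain a -> closed_chain b ->
    near_chain d (A e) a -> near_chain d (B e) b -> overs a b = false.
  apply: common_radius => [e eE|e d d' d'0 dd H S a b gS sa sb ca cb na nb].
    by have [_ cA cB] := cpt e eE; exact: overs_split cA cB (spl e eE).
  by apply: (H S) => //; [apply: near_chainW na|apply: near_chainW nb].
have [d2 d20 H2] : exists2 d : R, 0 < d & forall ee, ee \in [seq (e, e') | e <- E, e' <- E] ->
    indep ee.1 ee.2 -> forall x y, Phi ee.1 x -> Phi ee.2 y -> 4 * d <= `|x - y|.
  apply: common_radius => [_ /allpairsP[[e e'] [/= eE eE' ->]]|ee d d' d'0 dd H ind x y px py].
    have [i /=|_] := boolP (indep e e'); last by exists 1.
    have [[c1 _ _] [c2 _ _]] := (cpt e eE, cpt e' eE').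
    have [d d0 hd] := compact_dist c1 c2 (dis _ _ eE eE' i).
    by exists (d / 4); [rewrite divr_gt0|move=> _ x y px py; rewrite mulrC divfK ?pnatr_eq0//; exact: hd].
  by apply: le_trans (H ind x y px py); rewrite ler_wpM2l.
have [d3 d30 H3] : exists2 d : R, 0 < d & forall ij, ij \in [seq (i, j) | i <- iota 0 n, j <- iota 0 n] ->
    ij.1 != ij.2 -> d <= `|Q ij.1 - Q ij.2|.
  apply: common_radius => [_ /allpairsP[[i j] [/= + + ->]]|ij d d' d'0 dd H ne].
    rewrite !mem_iota !add0n => /andP[_ hi] /andP[_ hj].
    have [->|ij] := eqVneq i j; first by exists 1; rewrite /= ?eqxx.
    exists `|Q i - Q j| => //; rewrite normr_gt0 subr_eq0.
    by apply/eqP => /(Qinj _ _ hi hj)/eqP; rewrite (negbTE ij).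
  exact: le_trans (H ne).
have [d [d0 dd1 dd2 dd3]] : exists d : R, [/\ 0 < d, d <= d1, d <= d2 & d <= d3].
  exists (Num.min d1 (Num.min d2 d3)); rewrite !lt_min d10 d20 d30; split=> //.
  - by rewrite ge_min lexx.
  - by rewrite !ge_min lexx orbT.
  - by rewrite !ge_min lexx !orbT.
(* A step shorter than e, with both ends moved by less than e, is still shorter than d. *)
have [e [e0 ed]] : exists e : R, 0 < e /\ 3 * e = d.
  by exists (d / 3); rewrite divr_gt0// mulrC divfK ?pnatr_eq0.
have /choice[l hl] : forall f, exists l, f \in E ->
    [/\ last (Q f.1) l = Q f.2, path (fun p q => `|p - q| < e) (Q f.1) l
    & forall p, p \in Q f.1 :: l -> Phi f p].
  move=> f; have [fE|_] := boolP (f \in E); last by exists [::].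
  by have [l hl] := Phich _ fE _ e0; exists l.
have /choice[m hm] : forall u, exists m, (u < n)%N ->
    [/\ last (Q u) m = apex, path (fun p q => `|p - q| < e) (Q u) m
    & forall p, p \in Q u :: m -> Xi u p].
  move=> u; have [un|_] := boolP (u < n)%N; last by exists [::].
  by have [l' hl'] := Xich _ un _ e0; exists l'.
pose L := flatten [seq Q f.1 :: l f | f <- E] ++ flatten [seq Q u :: m u | u <- iota 0 n].
have g0 : generic ([::] : seq P) by [].
have [tau tauL gL] := perturb L g0 e0; rewrite cat0s in gL.
(* Sends labels out of range to 0, so that [pos] and [X] behave well on all numbers, as
   [linking_sum] requires. *)
pose r u := if (u < n)%N then u else 0%N.
have rn u : (r u < n)%N by rewrite /r; case: ifP.
have rE u : (u < n)%N -> r u = u by rewrite /r => ->.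
pose pos u := tau (Q (r u)).
pose F f := segs (tau (Q f.1)) (map tau (l f)).
pose X u := segs (tau (Q (r u))) (map tau (m (r u))).
have mL f p : f \in E -> p \in Q f.1 :: l f -> p \in L.
  move=> fE pf; rewrite mem_cat; apply/orP; left; apply/flattenP.
  by exists (Q f.1 :: l f) => //; exact: (map_f (fun f => Q f.1 :: l f)).
have mL' u p : (u < n)%N -> p \in Q u :: m u -> p \in L.
  move=> un pu; rewrite mem_cat; apply/orP; right; apply/flattenP; exists (Q u :: m u) => //.
  by apply: (map_f (fun u => Q u :: m u)); rewrite mem_iota.
have near1 p : p \in L -> `|tau p - p| < d.
  by move=> /tauL; lra.
have Fin f s : f \in E -> s \in F f -> exists p q,
    [/\ s = (tau p, tau q), p \in Q f.1 :: l f, q \in Q f.1 :: l f & `|tau p - tau q| < d].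
  move=> fE; rewrite /F segs_map => /mapP[t ts ->].
  have [_ pa _] := hl _ fE; have [t1 t2 t12] := segsP pa ts.
  exists t.1, t.2; split=> //; rewrite -ed.
  by apply: (@dist3 _ (tau t.1) t.1 t.2 (tau t.2)) => //; [|rewrite distrC]; exact/tauL/(mL f).
have Xin u s : s \in X u -> exists p q,
    [/\ s = (tau p, tau q), p \in Q (r u) :: m (r u), q \in Q (r u) :: m (r u)
      & `|tau p - tau q| < d].
  rewrite /X segs_map => /mapP[t ts ->].
  have [_ pa _] := hm _ (rn u); have [t1 t2 t12] := segsP pa ts.
  exists t.1, t.2; split=> //; rewrite -ed.
  by apply: (@dist3 _ (tau t.1) t.1 t.2 (tau t.2)) => //; [|rewrite distrC]; exact/tauL/(mL' (r u)).
have sF f : f \in E -> supported (map tau L) (F f).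
  move=> fE; apply/allP => s /(Fin _ _ fE)[p [q [-> /(mL _ _ fE) pL /(mL _ _ fE) qL _]]].
  by rewrite /= !map_f.
have sX u : supported (map tau L) (X u).
  apply/allP => s /Xin[p [q [-> /(mL' _ _ (rn u)) pL /(mL' _ _ (rn u)) qL _]]].
  by rewrite /= !map_f.
have pS i : pos i \in map tau L.
  by apply: map_f; apply: (mL' (r i)); rewrite ?mem_head.
have bF f phi : f \in E -> boundary (F f) phi = phi (pos f.1) (+) phi (pos f.2).
  move=> fE; have /andP[f1 f2] := En _ fE; have [lf _ _] := hl _ fE.
  by rewrite boundary_segs last_map lf /pos !rE.
have bX u phi : boundary (X u) phi = phi (pos u) (+) phi (tau apex).
  by have [lu _ _] := hm _ (rn u); rewrite boundary_segs last_map lu.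
have FnearPhi f : f \in E -> near_chain d (Phi f) (F f).
  move=> fE s /(Fin _ _ fE)[p [q [-> pf qf pq]]]; have [_ _ inPhi] := hl _ fE.
  by split=> //; [exists p|exists q] => //; [exact: inPhi|exact/near1/(mL f)|exact: inPhi|exact/near1/(mL f)].
have XnearXi u : (u < n)%N -> near_chain d (Xi u) (X u).
  move=> un s /Xin[p [q [-> + + pq]]]; rewrite rE// => pf qf; have [_ _ inXi] := hm _ un.
  by split=> //; [exists p|exists q] => //; [exact: inXi|exact/near1/(mL' u)|exact: inXi|exact/near1/(mL' u)].
have far f f' : f \in E -> f' \in E -> indep f f' ->
    forall x y, Phi f x -> Phi f' y -> 4 * d <= `|x - y|.
  move=> fE fE' ff' x y px py; apply: le_trans (H2 (f, f') _ ff' _ _ px py) => /=.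
    by rewrite ler_wpM2l.
  exact: allpairs_f.
have disF e' f s t : e' \in E -> f \in E -> indep e' f -> s \in F e' -> t \in F f ->
    seg_disjoint s.1 s.2 t.1 t.2.
  move=> eE fE ef; exact: near_chain_disjoint (far _ _ eE fE ef) (FnearPhi _ eE) (FnearPhi _ fE) s t.
have ends f s : f \in E -> s \in (pos f.1, pos f.2) :: F f -> exists p q,
    [/\ s = (tau p, tau q), p \in Q f.1 :: l f & q \in Q f.1 :: l f].
  move=> fE; rewrite inE => /orP[/eqP->|/(Fin _ _ fE)[p [q [-> pl ql _]]]]; last by exists p, q.
  have /andP[f1 f2] := En _ fE; have [lf _ _] := hl _ fE.
  exists (Q f.1), (Q f.2); rewrite /pos !rE// mem_head; split=> //.
  by rewrite -lf mem_last.
have apF e' f : e' \in E -> f \in E -> indep e' f ->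
    apart ((pos e'.1, pos e'.2) :: F e') ((pos f.1, pos f.2) :: F f).
  move=> eE fE ef s t /(ends _ _ eE)[p [q [-> pe qe]]] /(ends _ _ fE)[p' [q' [-> pf qf]]].
  have neq x y : x \in Q e'.1 :: l e' -> y \in Q f.1 :: l f -> tau x != tau y.
    move=> xe yf; have [_ _ /(_ _ xe) px] := hl _ eE; have [_ _ /(_ _ yf) py] := hl _ fE.
    have := far _ _ eE fE ef _ _ px py; apply: contraTneq => exy.
    have h1 := near1 _ (mL _ _ eE xe); have h2 := near1 _ (mL _ _ fE yf).
    have e00 : `|tau y - tau y| < d by rewrite subrr normr0.
    rewrite exy distrC in h1; have := dist3 h1 e00 h2; rewrite -ltNge; lra.
  by rewrite /= !neq.
have posinj : {in [pred i | (i < n)%N] &, injective pos}.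
  move=> i j; rewrite !inE /pos => hi hj; rewrite !rE// => eij; apply/eqP; apply: contraT => ij.
  have := H3 (i, j) _ ij; rewrite allpairs_f ?mem_iota//= => /(_ isT).
  have h1 := tauL _ (mL' _ _ hi (mem_head _ _)); have h2 := tauL _ (mL' _ _ hj (mem_head _ _)).
  have e00 : `|tau (Q j) - tau (Q j)| < e by rewrite subrr normr0.
  by rewrite eij distrC in h1; have := dist3 h1 e00 h2; lra.
have := linking_sum gL pS evE sF bF bX apF disF.
rewrite (scE _ _ gL pS posinj) xor_eq0// => f fE.
have flatP s : s \in flatten [seq F e' | e' <- E & indep f e'] ->
    exists2 e', e' \in E & indep f e' /\ s \in F e'.
  by move=> /flattenP[_ /mapP[e' + ->] sF']; rewrite mem_filter => /andP[fe eE]; exists e'.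
have /andP[f1 f2] := En _ fE; have [sA1 sA2 sA3] := subA _ fE.
apply: (H1 _ fE _ _ _ gL).
- by rewrite !supported_cat sF// !sX.
- by apply/allP => s /flatP[e' eE [_ /(supportedP (sF _ eE))[-> ->]]].
- move=> phi; rewrite !boundary_cat bF// !bX.
  by case: (phi (pos f.1)); case: (phi (pos f.2)); case: (phi _).
- move=> phi; rewrite -[RHS](evE (phi \o pos) _ fE) /boundary.
  elim: (E) (bF) => [|e' E' IH] bF'; first by rewrite !big_nil.
  rewrite big_cons /=; case: (indep f e') => /=.
    rewrite big_cat /= -[X in X (+) _]/(boundary (F e') phi) bF' ?mem_head//.
    by rewrite IH// => e'' phi' e''E; apply: bF'; rewrite inE e''E orbT.
  by rewrite IH// => e'' phi' e''E; apply: bF'; rewrite inE e''E orbT.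
- move=> s; rewrite !mem_cat => /or3P[] sin.
  + exact: (near_chainW dd1 sA1 (FnearPhi _ fE)).
  + exact: (near_chainW dd1 sA2 (XnearXi _ f1)).
  + exact: (near_chainW dd1 sA3 (XnearXi _ f2)).
- move=> s /flatP[e' eE [fe sF']].
  exact: (near_chainW dd1 (subB _ _ fE eE fe) (FnearPhi _ eE)).
Qed.

End LinkedCore.

(** * Edges and cycles in the geometric realization *)

Section Cells.
Variable R : realType.
Local Notation P := 'rV[R]_3.

Lemma segment_is_compact m (x y : 'rV[R]_m) : compact (segment x y).
Proof.
apply: (@continuous_compact _ _ (fun t : R => (1 - t) *: x + t *: y) `[0, 1]%classic);
  last exact: segment_compact.
apply: continuous_subspaceT => t.
apply: (@continuousD R 'rV[R]_m R^o (fun t : R => (1 - t) *: x) (fun t : R => t *: y)).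
  apply: (@continuousZr_tmp R 'rV[R]_m R^o (fun t : R => 1 - t)).
  by apply: (@continuousB R R^o R^o (fun=> 1) id); [exact: cst_continuous|].
exact: (@continuousZr_tmp R 'rV[R]_m R^o id).
Qed.

Lemma segmentC m (x y : 'rV[R]_m) : segment x y = segment y x.
Proof.
suff h (a b : 'rV[R]_m) : segment a b `<=` segment b a by apply/seteqP; split; exact: h.
move=> _ [t /= /andP[t0 t1] <-]; exists (1 - t) => /=.
  by rewrite subr_ge0 t1 lerBlDr lerDl.
by rewrite subKr addrC.
Qed.

Lemma chainable_segment m (f : 'rV[R]_m -> P) x y :
  {within segment x y, continuous f} -> chainable (f @` segment x y) (f x) (f y).
Proof.
move=> cf d d0.
have [e e0 he] := compact_uniform (@segment_is_compact _ x y) cf d0.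
have xy0 : 0 < `|x - y| + 1 by rewrite ltr_wpDl.
have [M] := ltr_add_invr (divr_gt0 e0 xy0); rewrite add0r => hM.
pose t (i : nat) : R := i%:R / M.+1%:R.
pose p i := (1 - t i) *: x + t i *: y.
have pin i : (i <= M.+1)%N -> segment x y (p i).
  by move=> iM; exists (t i) => //=; rewrite divr_ge0//= ler_pdivrMr// mul1r ler_nat.
have p0 : p 0%N = x by rewrite /p /t mul0r subr0 scale1r scale0r addr0.
have pM : p M.+1 = y by rewrite /p /t divff ?pnatr_eq0// subrr scale0r scale1r add0r.
have step i : (i < M.+1)%N -> `|f (p i) - f (p i.+1)| < d.
  move=> iM; apply: he; [apply: pin; exact: ltnW|exact: pin|].
  have -> : p i - p i.+1 = M.+1%:R^-1 *: (x - y).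
    rewrite /p /t -(natr1 i) mulrDl mul1r; move: (_^-1) (i%:R) => u v.
    by apply/rowP => k; rewrite !mxE; ring.
  rewrite normrZ ger0_norm ?invr_ge0//.
  move: hM; rewrite ltr_pdivlMr// => hM; apply: le_lt_trans hM.
  by rewrite ler_wpM2l ?invr_ge0// lerDl.
exists [seq f (p i) | i <- iota 1 M.+1]; rewrite -{1 2 3}p0; split.
- rewrite -[M.+1]addn1 iotaD map_cat last_cat /= add1n pM//.
- suff pth k j : (j + k <= M.+1)%N ->
      path (fun q r : P => `|q - r| < d) (f (p j)) [seq f (p i) | i <- iota j.+1 k].
    exact: pth.
  elim: k j => // k IH j jk /=; rewrite IH ?addSnnS// andbT step//.
  by apply: leq_trans jk; rewrite addnS ltnS leq_addr.
- move=> q; rewrite inE => /orP[/eqP->|/mapP[i + ->]].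
    by exists (p 0%N) => //; exact: pin.
  by rewrite mem_iota add1n ltnS => /andP[_ iM]; exists (p i) => //; exact: pin.
Qed.

Lemma chainable_trans (K : set P) x y z :
  chainable K x y -> chainable K y z -> chainable K x z.
Proof.
move=> h1 h2 d d0; have [l1 [e1 p1 k1]] := h1 d d0; have [l2 [e2 p2 k2]] := h2 d d0.
exists (l1 ++ l2); rewrite last_cat cat_path e1 p1 p2; split=> // p.
rewrite in_cons mem_cat orbA => /orP[pl|pl]; first by apply: k1; rewrite in_cons.
by apply: k2; rewrite in_cons pl orbT.
Qed.

Lemma chainableW (K K' : set P) x y : K `<=` K' -> chainable K x y -> chainable K' x y.
Proof.
by move=> KK h d d0; have [l [e1 p1 k1]] := h d d0; exists l; split=> // p /k1 /KK.
Qed.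

Section Graph.
Variable G : sgraph.
Implicit Types (u v w : G) (x : 'rV[R]_#|G|).

Lemma edge_cellC u v : @edge_cell R G u v = edge_cell v u.
Proof. exact: segmentC. Qed.

Lemma edge_cellE u v w (t : R) :
  ((1 - t) *: vertex_point R u + t *: vertex_point R v) ord0 (enum_rank w) =
  (1 - t) * (w == u)%:R + t * (w == v)%:R.
Proof. by rewrite !mxE !eqxx !(inj_eq enum_rank_inj). Qed.

Lemma edge_cell_support u v w x : edge_cell u v x -> w != u -> w != v ->
  x ord0 (enum_rank w) = 0.
Proof.
move=> [t _ <-] /negbTE wu /negbTE wv.
by rewrite edge_cellE wu wv !mulr0 addr0.
Qed.

Lemma edge_cell_pos u v x : edge_cell u v x ->
  x ord0 (enum_rank u) != 0 \/ x ord0 (enum_rank v) != 0.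
Proof.
move=> [t _ <-]; rewrite !edge_cellE !eqxx (eq_sym v).
have [_|_] := eqVneq u v; first by left; rewrite !mulr1 subrK oner_neq0.
rewrite !mulr1 !mulr0 add0r addr0.
have [->|] := eqVneq t 0; last by right.
by left; rewrite subr0 oner_neq0.
Qed.

(** A point of an edge has a nonzero barycentric coordinate at one of its ends and zero coordinates
    elsewhere. *)
Lemma edge_cell_disjoint u v u' v' :
  [&& u != u', u != v', v != u' & v != v'] ->
  @edge_cell R G u v `&` edge_cell u' v' = set0.
Proof.
move=> /and4P[h1 h2 h3 h4]; apply/seteqP; split=> // x [hx hx'].
by case: (edge_cell_pos hx) => /eqP; apply; apply: edge_cell_support hx' _ _.
Qed.

Lemma edge_cell_realization u v : adj u v -> @edge_cell R G u v `<=` @realization R G.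
Proof. by move=> uv x hx; exists u, v; rewrite uv orbT. Qed.

Lemma cycle_cell_realization (s : seq G) : ucycleb adj s ->
  @cycle_cell R G s `<=` @realization R G.
Proof.
move=> /andP[cs us] x [u /= su hx]; apply: edge_cell_realization hx.
exact: next_cycle.
Qed.

Lemma cycle_cell_compact (s : seq G) : compact (@cycle_cell R G s).
Proof.
rewrite /cycle_cell bigcup_seq; apply: bigsetU_compact => u _.
exact: segment_is_compact.
Qed.

End Graph.

End Cells.

(** * Combinatorial certificates of linking *)

Lemma next_map_in (T U : eqType) (m : T -> U) (s : seq T) x :
  {in s &, injective m} -> x \in s -> next [seq m y | y <- s] (m x) = m (next s x).
Proof.
case: s => [//|y0 s] inj xs /=.
have x0 : y0 \in y0 :: s by rewrite mem_head.
suff h y r : {subset y :: r <= y0 :: s} ->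
    next_at (m x) (m y0) (m y) [seq m z | z <- r] = m (next_at x y0 y r) by exact: h.
elim: r y => [|z r IH] y sub /=.
  have ys : y \in y0 :: s by apply: sub; rewrite mem_head.
  by rewrite (inj_in_eq inj xs ys); case: ifP.
have ys : y \in y0 :: s by apply: sub; rewrite mem_head.
rewrite (inj_in_eq inj xs ys); case: ifP => // _.
by apply: IH => w wr; apply: sub; rewrite inE wr orbT.
Qed.

Definition on_cycle (s : seq nat) (ab : nat * nat) :=
  ((ab.1 \in s) && (next s ab.1 == ab.2)) || ((ab.2 \in s) && (next s ab.2 == ab.1)).

(* Labelled certificate that a graph containing the relation e on labels < N is
   linked: base edges E on labels < n, joined to the vertex apex by the paths
   u :: X u; C e is a cycle through e and the two paths at its ends, and D e is a
   cycle through all the base edges disjoint from e. *)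
Definition link_certificate (N n apex : nat) (e : rel nat) (E : seq (nat * nat))
    (X : nat -> seq nat) (C D : nat * nat -> seq nat) :=
  [&& (0 < n <= N)%N,
      all (fun f => [&& (f.1 < n)%N, (f.2 < n)%N & e f.1 f.2]) E,
      all (fun u => [&& X u != [::], last u (X u) == apex, path e u (X u) & all (ltn^~ N) (X u)])
          (iota 0 n),
      all (fun f => all (fun s => [&& (2 < size s)%N, cycle e s, uniq s & all (ltn^~ N) s])
          [:: C f; D f] && ~~ has (mem (D f)) (C f)) E,
      all (fun f => all (on_cycle (C f)) (f :: pairmap pair f.1 (X f.1)
          ++ pairmap pair f.2 (X f.2))) E
    & all (fun f => all (fun g => indep f g ==> on_cycle (D f) g) E) E].

Section Certificate.
Variable R : realType.
Local Notation P := 'rV[R]_3.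

(** Vertices are labelled by numbers, so that for each concrete graph the conditions on the cycles
    are settled by computation. *)
Lemma certificate_linked (G : sgraph) (m : nat -> G) N n apex (e : rel nat) E X C D :
  {in [pred i | (i < N)%N] &, injective m} ->
  (forall i j, (i < N)%N -> (j < N)%N -> e i j -> adj (m i) (m j)) ->
  even_rest E ->
  (forall S (pos : nat -> P), generic S -> (forall i, pos i \in S) ->
     {in [pred i | (i < n)%N] &, injective pos} -> straight_crossings E pos) ->
  link_certificate N n apex e E X C D -> intrinsically_linked R G.
Proof.
move=> minj madj evE scE /and5P[/andP[n0 nN] /allP cE /allP cX /allP cCD] /andP[/allP cC /allP cD].
move=> f [fcont finj] _; apply: contrapT => no.
have lN (s : seq nat) : all (ltn^~ N) s -> {in s &, injective m}.
  by move=> /allP h i j /h hi /h hj; exact: minj.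
have cyc (s : seq nat) : [&& (2 < size s)%N, cycle e s, uniq s & all (ltn^~ N) s] ->
    graph_cycle (map m s).
  move=> /and4P[s2 cs us sN]; rewrite /graph_cycle size_map s2 /=.
  apply/andP; split; last by rewrite map_inj_in_uniq//; exact: lN.
  move: cs sN {s2 us}; case: s => //= i s cs /andP[iN sN].
  rewrite -map_rcons; move: cs; have : all (ltn^~ N) (rcons s i) by rewrite all_rcons /= iN.
  move: (rcons s i) => r; elim: r i iN {sN} => //= j r IH i iN /andP[jN rN] /andP[ij pr].
  by rewrite madj//= IH.
pose cell (ab : nat * nat) := @edge_cell R G (m ab.1) (m ab.2).
have cell_cycle s ab : all (ltn^~ N) s -> on_cycle s ab ->
    f @` cell ab `<=` f @` cycle_cell (map m s).
  move=> sN; case: ab => a b; rewrite /on_cycle /=.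
  wlog : a b / (a \in s) && (next s a == b).
    move=> H /orP[h|h]; first by apply: (H a b); rewrite ?h.
    by rewrite /cell /= edge_cellC; apply: (H b a); rewrite ?h.
  move=> /andP[aS /eqP nb] _ _ [x hx <-]; exists x => //.
  exists (m a) => /=; first exact: map_f.
  by rewrite next_map_in ?nb//; exact: lN.
have eN g : g \in E -> [/\ (g.1 < N)%N, (g.2 < N)%N & adj (m g.1) (m g.2)].
  move=> /cE/and3P[g1 g2 eg]; have h1 := leq_trans g1 nN; have h2 := leq_trans g2 nN.
  by split=> //; exact: madj.
pose B g := f @` cycle_cell (map m (D g)); pose A g := f @` cycle_cell (map m (C g)).
have CD g : g \in E -> [/\ graph_cycle (map m (C g)), graph_cycle (map m (D g)),
    all (ltn^~ N) (C g), all (ltn^~ N) (D g) & {in map m (C g), forall x, x \notin map m (D g)}].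
  move=> /cCD/andP[/=/and3P[hC hD _] /hasPn CD0].
  have [/and4P[_ _ _ CN] /and4P[_ _ _ DN]] := (hC, hD).
  split; [exact: cyc|exact: cyc|by []|by []|].
  move=> _ /mapP[i iC ->]; apply/negP => /mapP[j jD eij].
  have := CD0 _ iC; have -> : i = j by apply: minj eij; [exact: (allP CN)|exact: (allP DN)].
  by rewrite /= jD.
have spl g : g \in E -> split_link (A g) (B g).
  move=> gE; apply: contrapT => nspl; apply: no; exists (map m (C g)), (map m (D g)).
  by have [h1 h2 _ _ h3] := CD _ gE.
have cell_real g : adj (m g.1) (m g.2) -> cell g `<=` @realization R G.
  exact: edge_cell_realization.
have fcell K : K `<=` @realization R G -> {within K, continuous f}.
  by move=> KR; exact: continuous_subspaceW fcont.
pose Xi u : set P := [set p | exists2 ab, ab \in pairmap pair u (X u) & (f @` cell ab) p].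
have ch a b : adj (m a) (m b) ->
    chainable (f @` cell (a, b)) (f (vertex_point R (m a))) (f (vertex_point R (m b))).
  by move=> ab; apply: chainable_segment; apply: fcell; exact: (cell_real (a, b)).
apply: (@linked_core R n E (fun i => f (vertex_point R (m i))) (f (vertex_point R (m apex)))
  (fun g => f @` cell g) A B Xi n0 evE scE _ _ _ _ _ _ _ _ spl).
- by move=> g /cE/and3P[-> ->].
- move=> i j; rewrite !inE => hi hj eij; apply: minj; rewrite ?inE ?(leq_trans _ nN)//.
  have vr u : @realization R G (vertex_point R u).
    exists u, u; rewrite eqxx; split=> //; exists 0; first by rewrite /= lexx ler01.
    by rewrite subr0 scale1r scale0r addr0.
  have := finj _ _ (mem_set (vr _)) (mem_set (vr _)) eij => /matrixP/(_ ord0 (enum_rank (m i))).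
  rewrite !mxE !eqxx (inj_eq enum_rank_inj) /= => /eqP.
  by have [//|_] := eqVneq (m i) (m j); rewrite oner_eq0.
- by move=> g /eN[g1 g2 ag]; case: g ag {g1 g2} => a b; exact: ch.
- move=> u un; have : u \in iota 0 n by rewrite mem_iota.
  move=> /cX/and4P[X0 /eqP <- + XN]; rewrite /Xi; have uN := leq_trans un nN.
  case: (X u) X0 XN => //= v r _; elim: r u v uN {un} => [|w r IH] u v uN /andP[vN rN] /andP[uv pr].
    apply: chainableW (ch _ _ (madj _ _ uN vN uv)) => p pc.
    by exists (u, v) => //; rewrite mem_head.
  apply: (@chainable_trans _ _ _ (f (vertex_point R (m v)))).
    apply: chainableW (ch _ _ (madj _ _ uN vN uv)) => p pc.
    by exists (u, v) => //; rewrite mem_head.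
  apply: chainableW (IH v w vN rN pr) => p [ab abr pab].
  by exists ab => //; rewrite inE abr orbT.
- move=> g gE; have [h1 h2 _ _ _] := CD _ gE; have [_ _ ag] := eN _ gE.
  have cpt K : K `<=` @realization R G -> compact K -> compact (f @` K).
    by move=> /fcell; exact: continuous_compact.
  split; apply: cpt.
  + exact: cell_real.
  + exact: segment_is_compact.
  + by apply: cycle_cell_realization; case/andP: h1.
  + exact: cycle_cell_compact.
  + by apply: cycle_cell_realization; case/andP: h2.
  + exact: cycle_cell_compact.
- move=> g g' gE g'E /and4P[i1 i2 i3 i4].
  have [gn1 gn2 ag] := eN _ gE; have [gn1' gn2' ag'] := eN _ g'E.
  have mne i j : (i < N)%N -> (j < N)%N -> i != j -> m i != m j.
    by move=> hi hj; apply: contraNneq => /minj -> //.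
  have /seteqP[sub _] : @edge_cell R G (m g.1) (m g.2) `&` edge_cell (m g'.1) (m g'.2) = set0.
    by apply: edge_cell_disjoint; rewrite !mne.
  apply/seteqP; split=> // _ [[x hx <-] [y hy exy]].
  have eyx : y = x.
    by apply: finj => //; apply: mem_set; [exact: (cell_real g')|exact: (cell_real g)].
  by apply: (sub x); split=> //; rewrite -eyx.
- move=> g gE; have := cC _ gE; rewrite /= all_cat => /and3P[h0 /allP h1 /allP h2].
  have [_ _ CN _ _] := CD _ gE.
  split; first exact: cell_cycle.
    by move=> p [ab /h1 hab]; exact: cell_cycle.
  by move=> p [ab /h2 hab]; exact: cell_cycle.
- move=> g g' gE g'E gg'; have [_ _ _ DN _] := CD _ gE.
  by apply: cell_cycle => //; have /allP/(_ _ g'E)/implyP/(_ gg') := cD _ gE.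
Qed.

End Certificate.

(** * Subgraphs and complete multipartite graphs *)

Definition embeds (H G : sgraph) : Prop :=
  exists2 phi : H -> G, injective phi & forall x y, adj x y -> adj (phi x) (phi y).

Lemma embeds_trans K H G : embeds K H -> embeds H G -> embeds K G.
Proof.
move=> [phi phiI phiA] [psi psiI psiA]; exists (psi \o phi); first exact: inj_comp.
by move=> x y /phiA /psiA.
Qed.

Lemma iso_embeds H G : sgraph_iso H G -> embeds H G.
Proof. by move=> [f /bij_inj fI fA]; exists f => // x y; rewrite fA. Qed.

Lemma iso_embedsV H G : sgraph_iso H G -> embeds G H.
Proof.
move=> [f [g fg gf] fA]; exists g; first exact: can_inj gf.
by move=> x y; rewrite -(fA (g x)) !gf.
Qed.

Lemma sgraph_iso_refl G : sgraph_iso G G.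
Proof. by exists id => //; exists id. Qed.

(** Nested induction on the numbers of vertices and of adjacent pairs of G: a vertex outside the
    image is deleted, otherwise an edge that does not come from H; when neither exists, the
    embedding is an isomorphism. *)
Lemma embeds_minor H G : embeds H G -> is_minor H G.
Proof.
have [n] := ubnP #|G|; elim: n => // n IHn in G *.
have [k] := ubnP #|[pred p : G * G | adj p.1 p.2]|; elim: k => // k IHk in G *.
rewrite !ltnS => Ek Gn [phi phiI phiA].
have [/existsP[v vphi]|/existsPn surj] := boolP [exists v, v \notin codom phi].
  apply: (@MinorDelVertex _ _ v); apply: IHn.
    by apply: leq_trans Gn; rewrite [X in (X < _)%N]card_sig /= (cardC1 v) prednK// (cardD1 v).
  have phiv x : phi x != v by apply: contraNneq vphi => <-; exact: codom_f.
  exists (fun x => exist _ (phi x) (phiv x)).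
    by move=> x y [] /phiI.
  by move=> x y; exact: phiA.
have [/existsP[x /existsP[y /andP[axy nxy]]]|/existsPn full] :=
    boolP [exists x, exists y, adj (phi x) (phi y) && ~~ adj x y].
  apply: (@MinorDelEdge _ _ (phi x) (phi y)) => //; apply: IHk => //.
    have lt : (#|[pred p : G * G | del_edge_rel (phi x) (phi y) p.1 p.2]|
               < #|[pred p : G * G | adj p.1 p.2]|)%N.
      apply: proper_card; apply/properP; split.
        by apply/fintype.subsetP => p; rewrite !inE => /andP[].
      by exists (phi x, phi y); rewrite !inE //= /del_edge_rel /= !eqxx andbF.
    exact: leq_trans lt Ek.
  exists phi => // a b ab; rewrite /= /del_edge_rel phiA//=.
  apply: contra nxy => /orP[]/andP[/eqP/phiI <- /eqP/phiI <-] //.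
  by rewrite adj_sym.
apply: MinorIso; exists phi => [|x y].
  apply: inj_card_bij => //; rewrite -(card_codom phiI); apply/subset_leq_card/fintype.subsetP => v _.
  by have := surj v; rewrite negbK.
apply/idP/idP => [axy|/phiA//]; apply: contraT => nxy.
by have /existsPn/(_ y) := full x; rewrite axy nxy.
Qed.

Section Multipartite.
Variable a : seq nat.

(** Replaces dependent pairs by pairs of numbers, on which maps between these graphs can be defined
    by plain case analysis. *)
Definition coords (x : 'KP a) : nat * nat := (val (tag x), val (tagged x)).

Lemma coords_inj : injective coords.
Proof.
move=> [i j] [i' j'] [/= /val_inj ii']; case: _ / ii' j' => j' /val_inj ->.
by [].
Qed.

Lemma coords_adj (x y : 'KP a) : adj x y = ((coords x).1 != (coords y).1).
Proof. by []. Qed.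

Definition valid_coords (c : nat * nat) := (c.1 < size a)%N && (c.2 < nth 0 a c.1)%N.

Lemma coords_valid x : valid_coords (coords x).
Proof. by case: x => i j; rewrite /valid_coords /= !ltn_ord. Qed.

Lemma coords_surj c : valid_coords c -> exists x, coords x = c.
Proof.
case: c => i j /andP[/= hi hj].
by exists (Tagged (fun i : 'I_(size a) => 'I_(nth 0 a i)) (Ordinal hj : 'I_(nth 0 a (Ordinal hi)))).
Qed.

End Multipartite.

Lemma embeds_KP a b (sigma : nat -> nat) :
  {in [pred i | (i < size a)%N] &, injective sigma} ->
  (forall i, (i < size a)%N -> (sigma i < size b)%N && (nth 0 a i <= nth 0 b (sigma i))%N) ->
  embeds 'KP a 'KP b.
Proof.
move=> inj h.
have /choice[phi hphi] : forall x : 'KP a, exists y : 'KP b,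
    coords y = (sigma (coords x).1, (coords x).2).
  move=> x; apply: coords_surj; have /andP[x1 x2] := coords_valid x.
  have /andP[s1 s2] := h _ x1; rewrite /valid_coords /= s1 /=.
  exact: leq_trans s2.
have cin (x : 'KP a) : (coords x).1 \in [pred i | (i < size a)%N].
  by have /andP[] := coords_valid x.
exists phi => [x y exy|x y].
  have := congr1 (@coords b) exy; rewrite !hphi => -[/(inj _ _ (cin x) (cin y)) e1 e2].
  by apply: coords_inj; exact: injective_projections.
rewrite !coords_adj !hphi /=; apply: contraNneq => /(inj _ _ (cin x) (cin y)) exy; exact/eqP.
Qed.

Lemma embeds_KP_nth a b : (size a <= size b)%N ->
  (forall i, (i < size a)%N -> (nth 0 a i <= nth 0 b i)%N) -> embeds 'KP a 'KP b.
Proof.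
move=> sab h; apply: (@embeds_KP _ _ id) => // i ia.
by rewrite (leq_trans ia sab) h.
Qed.

Lemma embeds_KP_perm a b : perm_eq a b -> embeds 'KP a 'KP b.
Proof.
move=> ab; have /(perm_iotaP 0%N)[s sp ea] := ab.
have sz : size s = size b by have := perm_size sp; rewrite size_iota.
have sa : size a = size b by rewrite ea size_map.
apply: (@embeds_KP _ _ (nth 0%N s)) => [i j|i ia].
  rewrite !inE sa -sz => hi hj; move/eqP; rewrite nth_uniq//; first by move/eqP.
  by rewrite (perm_uniq sp) iota_uniq.
have : nth 0%N s i \in s by rewrite mem_nth// sz -sa.
rewrite (perm_mem sp) mem_iota add0n => /andP[_ ->] /=.
by rewrite [in leqLHS]ea (nth_map 0%N) ?sz -?sa.
Qed.

Lemma embeds_K n k : (n <= k)%N -> embeds 'K_n 'K_k.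
Proof.
move=> nk; exists (widen_ord nk); first by move=> i j [] /val_inj.
by move=> i j; apply: contra => /eqP [] /val_inj ->.
Qed.

Definition has_model N (e : rel nat) (G : sgraph) := exists2 m : nat -> G,
  {in [pred i | (i < N)%N] &, injective m}
  & forall i j, (i < N)%N -> (j < N)%N -> e i j -> adj (m i) (m j).

Lemma has_model_embeds N e H G : embeds H G -> has_model N e H -> has_model N e G.
Proof.
move=> [phi phiI phiA] [m mI mA]; exists (phi \o m) => [i j hi hj /phiI|i j hi hj ij].
  exact: mI.
exact/phiA/mA.
Qed.

Lemma has_model_K N : (0 < N)%N -> has_model N (fun i j => i != j) 'K_N.
Proof.
case: N => // N _; exists inord => [i j|i j hi hj ij].
  by rewrite !inE => hi hj /(congr1 (@nat_of_ord _)); rewrite !inordK.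
by apply: contra ij => /eqP/(congr1 (@nat_of_ord _)); rewrite !inordK// => ->.
Qed.

Lemma has_model_KP (N : nat) (e : rel nat) a (c : seq (nat * nat)) : (0 < N)%N ->
  size c = N -> all (valid_coords a) c -> uniq c ->
  all (fun i => all (fun j => e i j ==> ((nth (0, 0) c i).1 != (nth (0, 0) c j).1))
    (iota 0 N)) (iota 0 N) ->
  has_model N e 'KP a.
Proof.
move=> N0 sc vc uc hc.
have /choice[m hm] : forall i : nat, exists x : 'KP a,
    coords x = nth (0, 0)%N c (if (i < N)%N then i else 0%N).
  move=> i; apply: coords_surj; apply: (allP vc); rewrite mem_nth// sc.
  by case: ifP.
exists m => [i j|i j hi hj ij].
  rewrite !inE => hi hj /(congr1 (@coords a)); rewrite !hm hi hj => /eqP.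
  by rewrite nth_uniq ?sc// => /eqP.
rewrite coords_adj !hm hi hj.
have := allP hc i; rewrite mem_iota add0n => /(_ hi)/allP/(_ j).
by rewrite mem_iota add0n => /(_ hj)/implyP; apply.
Qed.

Section LinkedGraphs.
Local Open Scope nat_scope.
Variable R : realType.

(** The ten edges of K_5 correspond to the ten pairs of complementary triangles, each given by its
    triangle through 5. *)
Lemma linked_K6 G : has_model 6 (fun i j => i != j) G -> intrinsically_linked R G.
Proof.
move=> [m mI mA]; apply: (certificate_linked (apex := 5)
  (X := fun=> [:: 5])
  (C := fun e => [:: e.1; e.2; 5])
  (D := fun e => [seq i <- iota 0 5 | (i != e.1) && (i != e.2)]) mI mA even_rest_K5).
- exact: straight_crossings_K5.
- by vm_compute.
Qed.

Definition rest_cycle (e : nat * nat) : seq nat :=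
  let a := [seq i <- iota 0 3 | i != e.1] in
  let b := [seq i <- iota 3 3 | i != e.2] in
  [:: nth 0 a 0; nth 0 b 0; nth 0 a 1; nth 0 b 1].

Lemma linked_K331 G : has_model 7 (fun i j => i %/ 3 != j %/ 3) G ->
  intrinsically_linked R G.
Proof.
move=> [m mI mA]; apply: (certificate_linked (apex := 6)
  (X := fun=> [:: 6]) (C := fun e => [:: e.1; e.2; 6]) (D := rest_cycle) mI mA even_rest_K33).
- exact: straight_crossings_K33.
- by vm_compute.
Qed.

(* Contracting the edge 67 of this K_{4,4} gives K_{3,3,1}. *)
Lemma linked_K44 G :
  has_model 8 (fun i j => (i \in [:: 0; 1; 2; 6]) != (j \in [:: 0; 1; 2; 6])) G ->
  intrinsically_linked R G.
Proof.
move=> [m mI mA]; apply: (certificate_linked (apex := 6)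
  (X := fun u => if (u < 3) then [:: 7; 6] else [:: 6])
  (C := fun e => [:: e.1; e.2; 6; 7]) (D := rest_cycle) mI mA even_rest_K33).
- exact: straight_crossings_K33.
- by vm_compute.
Qed.

End LinkedGraphs.

(** * Unlinked embeddings of cones over plane graphs *)

Section FlatSplit.
Variable R : realType.
Local Notation P := 'rV[R]_3.
Implicit Types (p q : P) (A B : set P).

Let e3 : P := \row_j (if j == @Ordinal 3 2 isT then 1 else 0).

Let xe3 : xc e3 = 0. Proof. by rewrite /xc mxE. Qed.
Let ye3 : yc e3 = 0. Proof. by rewrite /yc mxE. Qed.
Let ze3 : zc e3 = 1. Proof. by rewrite /zc mxE. Qed.

Lemma zc_continuous : continuous (@zc R).
Proof. exact: coord_continuous. Qed.

Lemma rV_continuousD m n (f g : 'rV[R]_m -> 'rV[R]_n) : continuous f -> continuous g ->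
  continuous (fun x => f x + g x).
Proof. by move=> cf cg x; apply: (@continuousD R 'rV[R]_n _ f g); [exact: cf|exact: cg]. Qed.

Lemma rV_continuousZ m n (f : 'rV[R]_m -> R) (a : 'rV[R]_n) : continuous f ->
  continuous (fun x => f x *: a).
Proof. by move=> cf x; apply: (@continuousZr_tmp R 'rV[R]_n _ f); exact: cf. Qed.

Lemma continuous_fcomp (T U V : topologicalType) (f : T -> U) (g : U -> V) :
  continuous f -> continuous g -> continuous (g \o f).
Proof. by move=> cf cg x; apply: continuous_comp; [exact: cf|exact: cg]. Qed.

(* A continuous vertical shear depending only on the xy-projection fixes B and
   lifts A strictly above the plane; then a large round sphere separates them. *)
Lemma flat_split A B : compact A -> compact B -> A `&` B = set0 ->
  (forall p, A p -> 0 <= zc p) -> (forall p, B p -> zc p = 0) -> A !=set0 ->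
  split_link A B.
Proof.
move=> cA cB AB zA zB [a0 Aa0].
pose A0 := A `&` [set p | zc p = 0].
have cA0 : compact A0.
  apply: compact_closedI => //; apply: (@closed_comp _ _ _ [set 0]) => [p _|].
    exact: zc_continuous.
  exact: closed_eq.
have BA0 : B `&` A0 = set0.
  by apply/seteqP; split=> // p [Bp [Ap _]]; have : (A `&` B) p by []; rewrite AB.
have [d d0 hd] := compact_dist cB cA0 BA0.
have sep : uniform_separator B A0.
  apply: uniform_separatorW; exists [set xy | ball xy.1 d xy.2].
    by rewrite -entourage_ballE; exists d.
  apply/seteqP; split=> // -[x y] [[/= Bx Ay]]; rewrite -ball_normE /=.
  by rewrite ltNge hd.
pose U : P -> R := Urysohn B A0.
have cU : continuous U by exact: Urysohn_continuous.
have U0 p : 0 <= U p.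
  have := @Urysohn_range _ R B A0 (U p); rewrite /= in_itv /= => h.
  by have /andP[] := h (ex_intro2 _ _ p I erefl).
have UB p : B p -> U p = 0.
  by move=> Bp; apply: (Urysohn_sub0 sep); exists p.
have UA p : A0 p -> U p = 1.
  by move=> Ap; apply: (Urysohn_sub1 sep); exists p.
(* U is evaluated at the projection to the plane, so g is constant on vertical lines and the shear
   by g is undone by the shear by - g. *)
pose g p := U (p + (- zc p) *: e3).
have cg : continuous g.
  apply: (@continuous_fcomp _ _ _ (fun p => p + (- zc p) *: e3)) => //.
  apply: (rV_continuousD (f := id)); [by move=> p|apply: rV_continuousZ => p].
  by apply: (@continuousN R R^o _ (@zc R)); exact: zc_continuous.
have gshift p t : g (p + t *: e3) = g p.
  rewrite /g; congr U; rewrite !coordE ze3 mulr1 -addrA -scalerDl.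
  by congr (_ + _ *: _); ring.
have flat p : zc p = 0 -> g p = U p by rewrite /g => ->; rewrite oppr0 scale0r addr0.
have zt p t : zc (p + t *: e3) = zc p + t by rewrite !coordE ze3 mulr1.
have xt p t : xc (p + t *: e3) = xc p by rewrite !coordE xe3 mulr0 addr0.
have yt p t : yc (p + t *: e3) = yc p by rewrite !coordE ye3 mulr0 addr0.
have gA p : A p -> 0 < zc p + g p.
  move=> Ap; have := zA _ Ap; rewrite le_eqVlt => /orP[/eqP z0|z0].
    by rewrite -z0 add0r flat// UA//; split => //=.
  by rewrite ltr_wpDr//; exact: U0.
have gB p : B p -> g p = 0 by move=> Bp; rewrite flat ?UB//; exact: zB.
have [e [e0 eA]] : exists e : R, 0 < e /\ forall p, A p -> e <= zc p + g p.
  have cz : continuous (fun p => zc p + g p).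
    by move=> p; apply: (@continuousD R R^o _ (@zc R) g); [exact: zc_continuous|exact: cg].
  have [|c cA' hc] := compact_EVT_min _ cA (continuous_subspaceT cz); first by exists a0.
  exists (zc c + g c); split; first by apply: gA; exact: set_mem.
  by move=> p Ap; apply: hc; exact: mem_set.
have [Q [Q0 hQ]] : exists Q : R, 0 < Q /\ forall p, B p -> sqnorm p <= Q.
  have [[b0 Bb0]|noB] := pselect (B !=set0); last first.
    by exists 1; split=> // p Bp; case: noB; exists p.
  have [|c cB' hc] := compact_EVT_max _ cB (continuous_subspaceT (@sqnorm_continuous R)).
    by exists b0.
  exists (sqnorm c + 1); split; first by rewrite ltr_wpDl// sqnorm_ge0.
  by move=> p Bp; rewrite ler_wpDr// hc//; exact: mem_set.
(* The sphere has centre (0, 0, - s) and radius r = s + e / 2. Squared distances from the centre are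
   at most Q + s^2 < r^2 on B, and at least (s + e)^2 > r^2 on the lifted A. *)
pose s := (Q + 1) / e; have es : e * s = Q + 1 by rewrite /s mulrC divfK// gt_eqF.
have s0 : 0 < s by rewrite divr_gt0// addr_gt0.
pose r := s + e / 2; have r0 : 0 < r by rewrite addr_gt0// divr_gt0.
have r2 : r ^+ 2 = s ^+ 2 + Q + 1 + e ^+ 2 / 4.
  by rewrite -addrA -addrA (addrA Q) -es /r; field.
have rn : r != 0 by rewrite gt_eqF.
pose h p := r^-1 *: (p + (g p + s) *: e3).
pose k q := let p := r *: q + (- s) *: e3 in p + (- g p) *: e3.
have ch : continuous h.
  have c1 : continuous (fun p => p + (g p + s) *: e3).
    apply: (rV_continuousD (f := id)); [by move=> p|apply: rV_continuousZ => p].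
    by apply: (@continuousD R R^o _ g (fun=> s)); [exact: cg|exact: cst_continuous].
  by move=> p; apply: (@continuousZl_tmp R _ _ (fun p => p + (g p + s) *: e3)); exact: c1.
have ck : continuous k.
  have c1 : continuous (fun q : P => r *: q + (- s) *: e3).
    by apply: rV_continuousD => p; [exact: scaler_continuous|exact: cst_continuous].
  apply: (@continuous_fcomp _ _ _ (fun q : P => r *: q + (- s) *: e3)
    (fun p => p + (- g p) *: e3)) => //.
  apply: (rV_continuousD (f := id)); [by move=> p|apply: rV_continuousZ => p].
  by apply: (@continuousN R R^o _ g); exact: cg.
have sq p : sqnorm (h p) = r ^- 2 * (xc p ^+ 2 + yc p ^+ 2 + (zc p + g p + s) ^+ 2).
  by rewrite sqnormE /h !(xcZ, ycZ, zcZ) xt yt zt !exprMn !exprVn addrA; ring.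
exists h.
  split=> //; exists k; split=> // p.
    have hp : r *: h p + (- s) *: e3 = p + g p *: e3.
      by rewrite /h scalerA divff// scale1r -addrA -scalerDl addrK.
    by rewrite /k hp gshift -addrA -scalerDl subrr scale0r addr0.
  rewrite /k /=; move ep : (r *: p + - s *: e3) => p'.
  rewrite /h gshift -addrA -scalerDl addrA addNr add0r -ep -addrA -scalerDl addNr.
  by rewrite scale0r addr0 scalerA mulVf// scale1r.
right; split=> p.
  move=> Bp; rewrite -/(sqnorm (h p)) sq gB// zB// !add0r mulrC ltr_pdivrMr ?exprn_gt0// mul1r r2.
  have := hQ _ Bp; rewrite sqnormE zB// expr0n addr0 => h1.
  have := sqr_ge0 e; lra.
move=> Ap; rewrite -/(sqnorm (h p)) sq mulrC ltr_pdivlMr ?exprn_gt0// mul1r r2.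
have hz := eA _ Ap; have h1 : (e + s) ^+ 2 <= (zc p + g p + s) ^+ 2.
  by rewrite ler_pXn2r// ?nnegrE ?lerD2r//; lra.
have := sqr_ge0 (xc p); have := sqr_ge0 (yc p).
have h2 : (e + s) ^+ 2 = e ^+ 2 + 2 * (e * s) + s ^+ 2 by ring.
have : 0 < e ^+ 2 by rewrite exprn_gt0.
by rewrite h2 es in h1; lra.
Qed.
End FlatSplit.

(** * Straight drawings with at most one vertex above the plane *)

Section ApexDrawings.
Variable R : realType.
Local Notation P := 'rV[R]_3.

(* The last clause says that the affine extension of pos to the realization is
   injective, in terms of barycentric coordinates. *)
Definition apex_drawing (G : sgraph) (pos : G -> P) : Prop :=
  [/\ forall v, 0 <= zc (pos v),
      forall u v, 0 < zc (pos u) -> 0 < zc (pos v) -> u = v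
    & forall (u v u' v' : G) (t s : R), (u == v) || adj u v -> (u' == v') || adj u' v' ->
        0 <= t <= 1 -> 0 <= s <= 1 ->
        (1 - t) *: pos u + t *: pos v = (1 - s) *: pos u' + s *: pos v' ->
        forall w, (1 - t) * (w == u)%:R + t * (w == v)%:R
                  = (1 - s) * (w == u')%:R + s * (w == v')%:R].

Lemma apex_drawing_embeds (H G : sgraph) (pos : G -> P) : embeds H G -> apex_drawing pos ->
  exists pos' : H -> P, apex_drawing pos'.
Proof.
move=> [phi phiI phiA] [z0 z1 sl]; exists (pos \o phi); split=> [v|u v|] /=.
- exact: z0.
- by move=> hu hv; apply: phiI; exact: z1.
- move=> u v u' v' t s uv uv' t01 s01 e w.
  have ph a b : (a == b) || adj a b -> (phi a == phi b) || adj (phi a) (phi b).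
    by move=> /orP[/eqP->|/phiA->]; rewrite ?eqxx ?orbT.
  have := sl _ _ _ _ t s (ph _ _ uv) (ph _ _ uv') t01 s01 e (phi w).
  by rewrite !(inj_eq phiI).
Qed.

Lemma segment_image m (f : 'rV[R]_m -> P) x y :
  (forall t : R, f ((1 - t) *: x + t *: y) = (1 - t) *: f x + t *: f y) ->
  f @` segment x y = segment (f x) (f y).
Proof.
move=> fl; apply/seteqP; split=> [_ [_ [t t01 <-] <-]|_ [t t01 <-]].
  by exists t => //; rewrite fl.
by exists ((1 - t) *: x + t *: y); [exists t|rewrite fl].
Qed.

Lemma split_link_sym (A B : set P) : split_link A B -> split_link B A.
Proof. by move=> [h hh [[h1 h2]|[h1 h2]]]; exists h => //; [right|left]. Qed.

Lemma apex_drawing_unlinked (G : sgraph) (pos : G -> P) :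
  apex_drawing pos -> ~ intrinsically_linked R G.
Proof.
move=> [z0 z1 sl] /(_ (fun x => \sum_(v : G) x ord0 (enum_rank v) *: pos v)).
set f := (fun x => _).
have fE u v t : f ((1 - t) *: vertex_point R u + t *: vertex_point R v) =
    (1 - t) *: pos u + t *: pos v.
  rewrite /f; under eq_bigr => w _ do rewrite edge_cellE scalerDl -!scalerA.
  rewrite big_split /= -!scaler_sumr; congr (_ *: _ + _ *: _).
    rewrite (bigD1 u)//= eqxx scale1r big1 ?addr0// => w /negbTE->; exact: scale0r.
  rewrite (bigD1 v)//= eqxx scale1r big1 ?addr0// => w /negbTE->; exact: scale0r.
have fv u : f (vertex_point R u) = pos u.
  by have := fE u u 0; rewrite subr0 !scale1r !scale0r !addr0.
have cf : continuous f.
  rewrite /f; elim: (index_enum G) => [|v r IH].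
    have -> : (fun x : 'rV[R]_#|G| => \sum_(v <- [::]) x ord0 (enum_rank v) *: pos v) = fun=> 0.
      by apply/funext => x; rewrite big_nil.
    by move=> x; exact: cst_continuous.
  have -> : (fun x : 'rV[R]_#|G| => \sum_(w <- v :: r) x ord0 (enum_rank w) *: pos w) =
      (fun x => x ord0 (enum_rank v) *: pos v + \sum_(w <- r) x ord0 (enum_rank w) *: pos w).
    by apply/funext => x; rewrite big_cons.
  apply: rV_continuousD => //; apply: rV_continuousZ; exact: coord_continuous.
case.
- split; first exact: continuous_subspaceT.
  move=> x y /set_mem[u [v [uv [t t01 <-]]]] /set_mem[u' [v' [uv' [s s01 <-]]]].
  rewrite !fE => e; apply/rowP => k; rewrite -(enum_valK k) !edge_cellE.
  exact: sl.
- exists id; first by split; [move=> x|exists id; split=> // x].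
  move=> u v _; exists [:: (pos u, pos v)]; rewrite image_id.
  have -> : f @` edge_cell u v = segment (pos u) (pos v).
    by rewrite -!fv; apply: segment_image => t; rewrite fE !fv.
  by rewrite bigcup_seq big_cons big_nil setU0.
move=> s1 [s2 [/andP[g1 c1] /andP[g2 c2] dis]]; apply.
have cpt s : compact (f @` cycle_cell s).
  apply: continuous_compact; last exact: cycle_cell_compact.
  exact: continuous_subspaceT.
have zcell s p : (f @` cycle_cell s) p -> 0 <= zc p.
  move=> [_ [u _ [t /andP[t0 t1] <-]] <-]; rewrite fE !coordE.
  by rewrite addr_ge0// mulr_ge0// subr_ge0.
have flat s p : (forall v, v \in s -> zc (pos v) = 0) -> (f @` cycle_cell s) p -> zc p = 0.
  move=> zs [_ [u /= us [t _ <-]] <-]; rewrite fE !coordE !zs ?mem_next//.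
  by rewrite !mulr0 addr0.
have inh s : (2 < size s)%N -> (f @` cycle_cell s) !=set0.
  case: s => [//|u s _]; exists (f (vertex_point R u)), (vertex_point R u) => //.
  exists u; first by rewrite /= mem_head.
  by exists 0; rewrite /= ?lexx ?ler01// subr0 scale1r scale0r addr0.
(* A common point would have the same barycentric coordinates on both edges. These vanish on the
   first cycle, yet those at the ends of its edge add up to 1. *)
have cap : (f @` cycle_cell s1) `&` (f @` cycle_cell s2) = set0.
  apply/seteqP; split=> // _ [[x [u us1 hx] <-] [y [v vs2 hy] exy]].
  have a1 : adj u (next s1 u) by apply: next_cycle => //; case/andP: c1.
  have a2 : adj v (next s2 v) by apply: next_cycle => //; case/andP: c2.
  move: hx hy exy => [t t01 <-] [s s01 <-]; rewrite !fE => e.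
  have := sl _ _ _ _ _ _ _ _ s01 t01 e.
  rewrite a1 a2 !orbT => /(_ isT isT) sl'.
  have n1 w : w \in s1 -> (1 - t) * (w == u)%:R + t * (w == next s1 u)%:R = 0.
    move=> ws1; rewrite -sl'.
    have ne w' : w' \in s2 -> (w == w') = false.
      by move=> ws2; apply/negbTE; apply: contraTneq ws2 => <-; exact: dis.
    by rewrite !ne ?mem_next// !mulr0 addr0.
  have := n1 u us1; have := n1 (next s1 u); rewrite mem_next => /(_ us1).
  rewrite !eqxx (eq_sym (next s1 u)); case: eqP => _; rewrite ?mulr1 ?mulr0 ?addr0 ?add0r; lra.
have [[a [as1 za]]|no] := pselect (exists a, a \in s1 /\ 0 < zc (pos a)).
  apply: flat_split => //; [exact: zcell| |exact: inh].
  move=> p; apply: flat => v vs2; apply/eqP; rewrite eq_le z0 andbT leNgt; apply/negP => zv.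
  by have := dis _ as1; rewrite (z1 _ _ za zv) vs2.
apply: split_link_sym; apply: flat_split => //; [by rewrite setIC|exact: zcell| |exact: inh].
move=> p; apply: flat => v vs1; apply/eqP; rewrite eq_le z0 andbT leNgt; apply/negP => zv.
by apply: no; exists v.
Qed.

End ApexDrawings.

(** * A path joined to a triangle *)

Section Fan.
Variable n : nat.

(** Contains K_{n,1,1,1}, and for n = 3 it is K_{2,1,1,1,1}, the ends of the path being the part of
    size 2; so one drawing serves both. *)
Definition fan_rel : rel ('I_n + 'I_3)%type := fun x y =>
  match x, y with
  | inl i, inl j => (i.+1 == j) || (j.+1 == i)
  | inr c, inr d => c != d
  | _, _ => true
  end.

Fact fan_sym : symmetric fan_rel.
Proof. by move=> [i|c] [j|d] //=; rewrite 1?orbC 1?eq_sym. Qed.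

Fact fan_irr : irreflexive fan_rel.
Proof. by move=> [i|c] /=; rewrite ?eqxx//; apply/negbTE; lia. Qed.

Definition fan : sgraph := SGraph fan_sym fan_irr.

End Fan.

Section FanDrawing.
Variables (R : realType) (n : nat).
Local Notation P := 'rV[R]_3.

Definition vec3 (x y z : R) : P :=
  \row_j (if j == @Ordinal 3 0 isT then x else if j == @Ordinal 3 1 isT then y else z).

Lemma xc_vec3 x y z : xc (vec3 x y z) = x. Proof. by rewrite /xc mxE. Qed.
Lemma yc_vec3 x y z : yc (vec3 x y z) = y. Proof. by rewrite /yc mxE. Qed.
Lemma zc_vec3 x y z : zc (vec3 x y z) = z. Proof. by rewrite /zc mxE. Qed.
Definition vec3E := (xc_vec3, yc_vec3, zc_vec3).

(** The path runs up the y-axis and starts at height 1, not 0, since the edge between (-1, 0, 0) and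
    (1, 0, 0) passes through the origin. *)
Definition fan_pos (v : fan n) : P :=
  match v with
  | inl i => vec3 0 i.+1%:R 0
  | inr c => nth 0 [:: vec3 (-1) 0 0; vec3 1 0 0; vec3 0 0 1] c
  end.

(* The barycentric coordinates of a point of the fan: a and b on the consecutive
   path vertices k and k+1, and h0, h1, h2 on the triangle. *)
Definition fan_weights (W : fan n -> R) (k : nat) (a b h0 h1 h2 : R) :=
  [/\ [/\ 0 <= a, 0 <= b, 0 <= h0 & 0 <= h1],
      a + b + h0 + h1 + h2 = 1,
      0 < h0 -> 0 < h1 -> [/\ a = 0, b = 0 & h2 = 0],
      forall i : 'I_n, W (inl i) = a * (i == k :> nat)%:R + b * (i == k.+1 :> nat)%:R
    & forall c : 'I_3, W (inr c) = nth 0 [:: h0; h1; h2] c].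

Lemma fan_weightsP (u v : fan n) (t : R) : (u == v) || adj u v -> 0 <= t <= 1 ->
  exists k a b h0 h1 h2,
    fan_weights (fun w => (1 - t) * (w == u)%:R + t * (w == v)%:R) k a b h0 h1 h2
    /\ (1 - t) *: fan_pos u + t *: fan_pos v
       = vec3 (h1 - h0) (k.+1%:R * a + k.+2%:R * b) h2.
Proof.
move=> + /andP[t0 t1]; have t1' : 0 <= 1 - t by lra.
have eqs : (forall i j : 'I_n, ((inl i : fan n) == inl j) = (i == j :> nat)) *
    (forall c d : 'I_3, ((inr c : fan n) == inr d) = (c == d :> nat)) *
    (forall (i : 'I_n) (d : 'I_3), ((inl i : fan n) == inr d) = false) *
    (forall (i : 'I_n) (d : 'I_3), ((inr d : fan n) == inl i) = false) by [].
case: u v => [i|c] [j|d] /= uv.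
- have : [\/ i = j :> nat, i.+1 = j | j.+1 = i].
    by case/or3P: uv => /eqP; [move=> [->]|..]; [constructor 1|constructor 2|constructor 3].
  case=> [/val_inj ij|ij|ij].
  + exists i, 1, 0, 0, 0, 0; split; last first.
      by apply: coord_inj; rewrite !coordE /fan_pos /= !vec3E; rewrite ?ij; ring.
    by split=> // [|? |w|[[|[|[|//]]] w]]; rewrite /= ?eqs ?ij; lra.
  + exists i, (1 - t), t, 0, 0, 0; split; last first.
      by apply: coord_inj; rewrite !coordE /fan_pos /= !vec3E -?ij; ring.
    by split=> // [|? |w|[[|[|[|//]]] w]]; rewrite /= ?eqs -?ij; lra.
  + exists j, t, (1 - t), 0, 0, 0; split; last first.
      by apply: coord_inj; rewrite !coordE /fan_pos /= !vec3E -?ij; ring.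
    by split=> // [|? |w|[[|[|[|//]]] w]]; rewrite /= ?eqs -?ij; lra.
- case: d uv => [[|[|[|//]]] d] _.
  + exists i, (1 - t), 0, t, 0, 0; split; last first.
      by apply: coord_inj; rewrite !coordE /fan_pos /= !vec3E; ring.
    by split=> // [|? ? |w|[[|[|[|//]]] w]]; rewrite /= ?eqs /=; lra.
  + exists i, (1 - t), 0, 0, t, 0; split; last first.
      by apply: coord_inj; rewrite !coordE /fan_pos /= !vec3E; ring.
    by split=> // [|? ? |w|[[|[|[|//]]] w]]; rewrite /= ?eqs /=; lra.
  + exists i, (1 - t), 0, 0, 0, t; split; last first.
      by apply: coord_inj; rewrite !coordE /fan_pos /= !vec3E; ring.
    by split=> // [|? ? |w|[[|[|[|//]]] w]]; rewrite /= ?eqs /=; lra.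
- case: c uv => [[|[|[|//]]] c] _.
  + exists j, t, 0, (1 - t), 0, 0; split; last first.
      by apply: coord_inj; rewrite !coordE /fan_pos /= !vec3E; ring.
    by split=> // [|? ? |w|[[|[|[|//]]] w]]; rewrite /= ?eqs /=; lra.
  + exists j, t, 0, 0, (1 - t), 0; split; last first.
      by apply: coord_inj; rewrite !coordE /fan_pos /= !vec3E; ring.
    by split=> // [|? ? |w|[[|[|[|//]]] w]]; rewrite /= ?eqs /=; lra.
  + exists j, t, 0, 0, 0, (1 - t); split; last first.
      by apply: coord_inj; rewrite !coordE /fan_pos /= !vec3E; ring.
    by split=> // [|? ? |w|[[|[|[|//]]] w]]; rewrite /= ?eqs /=; lra.
- pose h (k : nat) : R := (1 - t) * (k == c :> nat)%:R + t * (k == d :> nat)%:R.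
  exists 0%N, 0, 0, (h 0%N), (h 1%N), (h 2%N); split; last first.
    by rewrite /h; case: c d uv {h} => [[|[|[|//]]] c] [[|[|[|//]]] d] _;
      apply: coord_inj; rewrite !coordE /fan_pos /= !vec3E; ring.
  rewrite /h; case: c d uv {h} => [[|[|[|//]]] c] [[|[|[|//]]] d] _;
    (split; [split|..|by move=> [[|[|[|//]]] w]]); rewrite /=; try lra;
    try (by move=> ? ?; split; lra); by move=> w; rewrite ?eqs /=; lra.
Qed.

(** The x-coordinate gives h1 - h0. If h0 and h1 are not both positive, one of them is 0 and both
    are known; if they are, y = 0 forces a = b = 0 and the total weight gives their sum. Then y / (a
    + b) lies in the interval from k + 1 to k + 2, and such intervals share at most a vertex of the
    path. *)
Lemma fan_weights_uniq W W' k a b h0 h1 h2 k' a' b' h0' h1' h2' :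
  fan_weights W k a b h0 h1 h2 -> fan_weights W' k' a' b' h0' h1' h2' ->
  h1 - h0 = h1' - h0' -> h2 = h2' ->
  k.+1%:R * a + k.+2%:R * b = k'.+1%:R * a' + k'.+2%:R * b' -> W =1 W'.
Proof.
move=> [[a0 b0 h00 h10] S1 hub Wl Wr] [[a0' b0' h00' h10'] S1' hub' Wl' Wr'] ex ez ey.
wlog kk : W W' k k' a a' b b' h0 h0' h1 h1' h2 h2' a0 a0' b0 b0' h00 h00' h10 h10'
    S1 S1' hub hub' Wl Wl' Wr Wr' ex ez ey / (k <= k')%N.
  move=> H; have [kk|/ltnW kk] := leqP k k'.
    by apply: (H W W' k k' a a' b b' h0 h0' h1 h1' h2 h2').
  move=> w; apply/esym; move: w.
  by apply: (H W' W k' k a' a b' b h0' h0 h1' h1 h2' h2).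
have k0 : 0 <= k%:R :> R by []. have k0' : 0 <= k'%:R :> R by [].
rewrite -!(natr1 k.+1) -!(natr1 k) -!(natr1 k'.+1) -!(natr1 k') in ey.
have pos0 (j x y : R) : 0 <= j -> 0 <= x -> 0 <= y -> (j + 1) * x + (j + 1 + 1) * y = 0 -> x = 0 /\ y = 0.
  by move=> *; split; nra.
have [e0 e1] : h0 = h0' /\ h1 = h1'.
  have [[p0 p1]|no] := pselect (0 < h0 /\ 0 < h1).
    have [za zb z2] := hub p0 p1; rewrite za zb !mulr0 addr0 in ey.
    have [za' zb'] := pos0 _ _ _ k0' a0' b0' (esym ey).
    by move: S1 S1'; rewrite za zb za' zb' -ez z2; lra.
  have [[p0 p1]|no'] := pselect (0 < h0' /\ 0 < h1').
    have [za zb z2] := hub' p0 p1; rewrite za zb !mulr0 addr0 in ey.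
    have [za' zb'] := pos0 _ _ _ k0 a0 b0 ey.
    by move: S1 S1'; rewrite za zb za' zb' ez z2; lra.
  have z (x y : R) : 0 <= x -> 0 <= y -> ~ (0 < x /\ 0 < y) -> x = 0 \/ y = 0.
    move=> x0 y0 h; have [|x1] := leP x 0; first by left; lra.
    have [|y1] := leP y 0; first by right; lra.
    by case: h.
  by case: (z _ _ h00 h10 no) => ?; case: (z _ _ h00' h10' no') => ?; split; lra.
have X : a + b = a' + b' by lra.
have WW : forall i : 'I_n, W (inl i) = W' (inl i).
  move=> i; rewrite Wl Wl'.
  have [ek|kk'] := eqVneq k k'.
    have eb : b = b' by move: ey; rewrite ek; nra.
    have ea : a = a' by lra.
    by rewrite ea eb ek.
  have lek : k%:R + 1 <= k'%:R :> R by rewrite natr1 ler_nat ltn_neqAle kk'.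
  have [X0|X0] := eqVneq (a + b) 0.
    have [-> ->] : a = 0 /\ b = 0 by lra.
    have [-> ->] : a' = 0 /\ b' = 0 by lra.
    by rewrite !mul0r.
  have eqs : [/\ a = 0, b' = 0 & k'%:R = k%:R + 1 :> R].
    pose D : R := k'%:R - k%:R; have D1 : 1 <= D by rewrite /D; lra.
    have eb : b = b' + D * (a + b).
      have ea' : a' = a + b - b' by lra.
      by rewrite /D; move: ey; rewrite ea'; lra.
    have DX : a + b <= D * (a + b) by rewrite ler_peMl// addr_ge0.
    have [za zb] : a = 0 /\ b' = 0 by split; lra.
    split=> //; have : D * (a + b) = 1 * (a + b) by rewrite mul1r; lra.
    by move/(mulIf X0); rewrite /D; lra.
  have [za zb /eqP] := eqs; rewrite natr1 eqr_nat => /eqP ->.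
  by rewrite za zb !mul0r addr0 add0r; congr (_ * _); lra.
move=> [i|c]; first exact: WW.
by rewrite Wr Wr' e0 e1 ez.
Qed.

Lemma fan_drawing : apex_drawing fan_pos.
Proof.
split=> [[i|[[|[|[|//]]] c]]|[i|[[|[|[|//]]] c]] [j|[[|[|[|//]]] d]]|];
  rewrite /= ?vec3E ?ltxx ?ler01//; first by move=> _ _; congr inr; exact: val_inj.
move=> u v u' v' t s uv uv' t01 s01.
have [k [a [b [h0 [h1 [h2 [fw ->]]]]]]] := fan_weightsP uv t01.
have [k' [a' [b' [h0' [h1' [h2' [fw' ->]]]]]]] := fan_weightsP uv' s01.
move=> e w; apply: (fan_weights_uniq fw fw').
- by have := congr1 (@xc R) e; rewrite !vec3E.
- by have := congr1 (@zc R) e; rewrite !vec3E.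
- by have := congr1 (@yc R) e; rewrite !vec3E.
Qed.

End FanDrawing.

(** * The cone over the octahedron *)

Section OctahedronDrawing.
Variable R : realType.
Local Notation P := 'rV[R]_3.

(* K_{2,2,2,1} on the labels 0..6, with parts {0,1}, {2,3}, {4,5}, {6}. *)
Definition cone_rel : rel 'I_7 := fun i j => (i %/ 2 != j %/ 2)%N.
Fact cone_sym : symmetric cone_rel.
Proof. by move=> i j; rewrite /cone_rel eq_sym. Qed.
Fact cone_irr : irreflexive cone_rel.
Proof. by move=> i; rewrite /cone_rel eqxx. Qed.
Definition cone_octahedron : sgraph := SGraph cone_sym cone_irr.

(* A large triangle 0, 2, 4 around a small inverted one 1, 3, 5: in barycentric
   coordinates modulo (1,1,1), the vertices of part i are 4 e_i and - e_i. *)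
Definition cone_pos (v : cone_octahedron) : P :=
  nth 0 [:: vec3 4 0 0; vec3 (-1) 0 0; vec3 0 4 0; vec3 0 (-1) 0;
    vec3 (-4) (-4) 0; vec3 1 1 0; vec3 0 0 1] v.

(** When a or b is 0, the weight a + b is a function of x = 4 a - b, equal to x / 4 for positive x
    and to - x for negative x, so its slope is at most 1/4. *)
Lemma cone_lipschitz (a b a' b' d : R) : 0 <= a -> 0 <= b -> 0 <= a' -> 0 <= b' ->
  a = 0 \/ b = 0 -> a' = 0 \/ b' = 0 -> 0 <= d -> 4 * a' - b' = 4 * a - b + d ->
  a' + b' <= a + b + d / 4.
Proof. by move=> a0 b0 a0' b0' [->|->] [->|->] d0 e; lra. Qed.

(** Weights on the two vertices of each part and on the apex. A point of an edge never uses both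
    vertices of a part, and it misses at least one of the three parts. *)
Definition cone_weights (a1 b1 a2 b2 a3 b3 h : R) :=
  [/\ [/\ 0 <= a1, 0 <= b1, 0 <= a2 & 0 <= b2], [/\ 0 <= a3, 0 <= b3 & a1 + b1 + a2 + b2 + a3 + b3 + h = 1],
      [/\ a1 = 0 \/ b1 = 0, a2 = 0 \/ b2 = 0 & a3 = 0 \/ b3 = 0]
    & [\/ a1 = 0 /\ b1 = 0, a2 = 0 /\ b2 = 0 | a3 = 0 /\ b3 = 0]].

(* A common shift d > 0 of the coordinates 4 a_i - b_i would change the total
   weight by at most d/4 on two of the parts and by - d on the part that vanishes. *)
Lemma cone_shift a1 b1 a2 b2 a3 b3 h a1' b1' a2' b2' a3' b3' d :
  cone_weights a1 b1 a2 b2 a3 b3 h -> cone_weights a1' b1' a2' b2' a3' b3' h ->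
  0 <= d -> 4 * a1' - b1' = 4 * a1 - b1 + d -> 4 * a2' - b2' = 4 * a2 - b2 + d ->
  4 * a3' - b3' = 4 * a3 - b3 + d -> d = 0.
Proof.
move=> [[p1 q1 p2 q2] [p3 q3 S] [z1 z2 z3] _] [[p1' q1' p2' q2'] [p3' q3' S'] [z1' z2' z3'] zz].
move=> d0 e1 e2 e3.
have l1 := cone_lipschitz p1 q1 p1' q1' z1 z1' d0 e1.
have l2 := cone_lipschitz p2 q2 p2' q2' z2 z2' d0 e2.
have l3 := cone_lipschitz p3 q3 p3' q3' z3 z3' d0 e3.
case: zz => -[x y].
- by case: z1 => z; lra.
- by case: z2 => z; lra.
- by case: z3 => z; lra.
Qed.

(** The drawing only records differences of the numbers 4 a_i - b_i, so these agree up to a common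
    shift, which [cone_shift] excludes in either direction. *)
Lemma cone_weights_uniq a1 b1 a2 b2 a3 b3 h a1' b1' a2' b2' a3' b3' :
  cone_weights a1 b1 a2 b2 a3 b3 h -> cone_weights a1' b1' a2' b2' a3' b3' h ->
  (4 * a1 - b1) - (4 * a3 - b3) = (4 * a1' - b1') - (4 * a3' - b3') ->
  (4 * a2 - b2) - (4 * a3 - b3) = (4 * a2' - b2') - (4 * a3' - b3') ->
  [/\ a1 = a1' /\ b1 = b1', a2 = a2' /\ b2 = b2' & a3 = a3' /\ b3 = b3'].
Proof.
move=> w w' e1 e2.
have d0 : (4 * a3' - b3') - (4 * a3 - b3) = 0.
  have [d0|/ltW d0] := leP 0 ((4 * a3' - b3') - (4 * a3 - b3)).
    by apply: (cone_shift w w'); lra.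
  suff : (4 * a3 - b3) - (4 * a3' - b3') = 0 by lra.
  by apply: (cone_shift w' w); lra.
move: w w' => [[p1 q1 p2 q2] [p3 q3 _] [z1 z2 z3] _] [[p1' q1' p2' q2'] [p3' q3' _] [z1' z2' z3'] _].
split.
- by case: z1 => z; case: z1' => z'; lra.
- by case: z2 => z; case: z2' => z'; lra.
- by case: z3 => z; case: z3' => z'; lra.
Qed.

Lemma cone_drawing : apex_drawing cone_pos.
Proof.
pose W (u v : 'I_7) (t : R) (w : nat) := (1 - t) * (w == u)%:R + t * (w == v)%:R.
have cw u v t : (u == v) || cone_rel u v -> 0 <= t <= 1 ->
    cone_weights (W u v t 0%N) (W u v t 1%N) (W u v t 2%N) (W u v t 3%N)
      (W u v t 4%N) (W u v t 5%N) (W u v t 6%N) /\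
    (1 - t) *: cone_pos u + t *: cone_pos v = vec3
      ((4 * W u v t 0%N - W u v t 1%N) - (4 * W u v t 4%N - W u v t 5%N))
      ((4 * W u v t 2%N - W u v t 3%N) - (4 * W u v t 4%N - W u v t 5%N))
      (W u v t 6%N).
  move=> uv /andP[t0 t1]; have t1' : 0 <= 1 - t by lra.
  have W0 w : 0 <= W u v t w by rewrite addr_ge0// mulr_ge0.
  have z w : (w != u :> nat) && (w != v :> nat) -> W u v t w = 0.
    by rewrite /W => /andP[/negbTE-> /negbTE->]; rewrite !mulr0 addr0.
  pose c (i : nat) (x : 'I_7) : R := (i == x :> nat)%:R.
  have c1 (x : 'I_7) : c 0%N x + c 1%N x + c 2%N x + c 3%N x + c 4%N x + c 5%N x + c 6%N x = 1.
    by case: x => [[|[|[|[|[|[|[|//]]]]]]]] ?; rewrite /c /=; lra.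
  have cp (x : 'I_7) : cone_pos x = vec3 ((4 * c 0%N x - c 1%N x) - (4 * c 4%N x - c 5%N x))
      ((4 * c 2%N x - c 3%N x) - (4 * c 4%N x - c 5%N x)) (c 6%N x).
    by case: x => [[|[|[|[|[|[|[|//]]]]]]]] ?; rewrite /c /cone_pos /=; congr vec3; lra.
  split; last first.
    by apply: coord_inj; rewrite !cp !coordE !vec3E /W -!/(c _ _); ring.
  have zor i j : ((i != u :> nat) && (i != v :> nat)) || ((j != u :> nat) && (j != v :> nat)) ->
      W u v t i = 0 \/ W u v t j = 0.
    by move=> /orP[/z|/z] ->; [left|right].
  split.
  - by split.
  - split=> //.
    transitivity ((1 - t) * (c 0%N u + c 1%N u + c 2%N u + c 3%N u + c 4%N u + c 5%N u + c 6%N u)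
      + t * (c 0%N v + c 1%N v + c 2%N v + c 3%N v + c 4%N v + c 5%N v + c 6%N v)).
      by rewrite /W -!/(c _ _); ring.
    by rewrite !c1; ring.
  - by move: uv zor; clear; case: u => [[|[|[|[|[|[|[|//]]]]]]]] ?;
      case: v => [[|[|[|[|[|[|[|//]]]]]]]] ? uv zor; split; exact: zor.
  - have zand i j : [&& i != u :> nat, i != v :> nat, j != u :> nat & j != v :> nat] ->
        W u v t i = 0 /\ W u v t j = 0.
      by move=> /and4P[h1 h2 h3 h4]; split; apply: z; apply/andP.
    move: zand; clear; case: u => [[|[|[|[|[|[|[|//]]]]]]]] ?;
      case: v => [[|[|[|[|[|[|[|//]]]]]]]] ? zand;
      by [constructor 1; exact: zand|constructor 2; exact: zand|constructor 3; exact: zand].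
split.
- by case=> [[|[|[|[|[|[|[|//]]]]]]]] ?; rewrite /cone_pos /= vec3E.
- by do 2![case=> [[|[|[|[|[|[|[|//]]]]]]]] ?]; rewrite /cone_pos /= !vec3E ?ltxx// => _ _; exact: val_inj.
move=> u v u' v' t s uv uv' t01 s01.
have [w ->] := cw _ _ _ uv t01; have [w' ->] := cw _ _ _ uv' s01 => e.
have ez : W u v t 6%N = W u' v' s 6%N by have := congr1 (@zc R) e; rewrite !vec3E.
rewrite -ez in w'.
have [[e0 e1] [e2 e3] [e4 e5]] := cone_weights_uniq w w'
  (etrans (etrans (esym (xc_vec3 _ _ _)) (congr1 (@xc R) e)) (xc_vec3 _ _ _))
  (etrans (etrans (esym (yc_vec3 _ _ _)) (congr1 (@yc R) e)) (yc_vec3 _ _ _)).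
by case=> [[|[|[|[|[|[|[|//]]]]]]]] ?; rewrite -!val_eqE.
Qed.

End OctahedronDrawing.

(** * Classification *)

Local Open Scope nat_scope.

Lemma embeds_KP_coords a (G : sgraph) (F : nat * nat -> G) :
  (forall c d, valid_coords a c -> valid_coords a d -> F c = F d -> c = d) ->
  (forall c d, valid_coords a c -> valid_coords a d -> c.1 != d.1 -> adj (F c) (F d)) ->
  embeds 'KP a G.
Proof.
move=> inj ad; exists (F \o @coords a) => [x y|x y].
  by move=> /(inj _ _ (coords_valid x) (coords_valid y)) /coords_inj.
by rewrite coords_adj; apply: ad; exact: coords_valid.
Qed.

Lemma embeds_KP_map a b (F : nat * nat -> nat * nat) :
  (forall c, valid_coords a c -> valid_coords b (F c)) ->
  (forall c d, valid_coords a c -> valid_coords a d -> F c = F d -> c = d) ->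
  (forall c d, valid_coords a c -> valid_coords a d -> c.1 != d.1 -> (F c).1 != (F d).1) ->
  embeds 'KP a 'KP b.
Proof.
move=> val inj ad.
have /choice[phi hphi] : forall x : 'KP a, exists y : 'KP b, coords y = F (coords x).
  by move=> x; apply: coords_surj; apply: val; exact: coords_valid.
exists phi => [x y exy|x y].
  apply/coords_inj/(inj _ _ (coords_valid x) (coords_valid y)).
  by rewrite -!hphi exy.
by rewrite !coords_adj !hphi; apply: ad; exact: coords_valid.
Qed.

Lemma embeds_KP_all2 a b : all2 leq a b -> embeds 'KP a 'KP b.
Proof.
move=> ab; apply: embeds_KP_nth => [|i ia].
  by elim: a b ab => [|x a IH] [|y b] //= /andP[_ /IH].
elim: a b ab i ia => [|x a IH] [|y b] //= /andP[xy ab] [//|i] ia.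
exact: IH.
Qed.

Lemma embeds_K_KP n a : n <= size a -> all (ltn 0) a -> embeds 'K_n 'KP a.
Proof.
move=> na /allP pos.
have /choice[phi hphi] : forall i : 'K_n, exists y : 'KP a, coords y = (val i, 0).
  move=> i; apply: coords_surj; have ia : val i < size a by exact: leq_trans (ltn_ord i) na.
  by rewrite /valid_coords /= ia; apply: pos; exact: mem_nth.
exists phi => [i j eij|i j].
  by apply/val_inj; have := congr1 (@coords a) eij; rewrite !hphi => -[].
by rewrite coords_adj !hphi.
Qed.

Lemma embeds_fan n : embeds 'KP [:: n.+1; 1; 1; 1] (fan n.+1).
Proof.
apply: (@embeds_KP_coords _ (fan n.+1) (fun c => if c.1 is i.+1 then inr (inord i) else inl (inord c.2))).
- move=> [[|i] j] [[|k] l] //=; rewrite /valid_coords /=.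
    by move=> jn ln [/(congr1 val)/=]; rewrite !inordK// => ->.
  move=> /andP[i3 j0] /andP[k3 l0] [/(congr1 val)/=]; rewrite !inordK// => ik.
  by subst k; case: i i3 j0 k3 l0 => [|[|[|i]]] //=; case: j l => [|j] [|l].
- move=> [[|i] j] [[|k] l] //=; rewrite /valid_coords /= => /andP[i3 _] /andP[k3 _].
  by apply: contra => /eqP/(congr1 val)/=; rewrite !inordK// => ->; rewrite eqxx.
Qed.

Lemma embeds_fan3 : embeds 'KP [:: 2; 1; 1; 1; 1] (fan 3).
Proof.
apply: (@embeds_KP_coords _ (fan 3) (fun c => match c.1 with
  | 0 => inl (inord (2 * c.2)) | 1 => inl (inord 1) | i.+2 => inr (inord i) end)).
- move=> [[|[|i]] j] [[|[|k]] l] //=; rewrite /valid_coords /=.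
  + by move=> j2 l2 [/(congr1 val)/=]; rewrite !inordK; [move=> ?; congr pair; lia|lia..].
  + by move=> j2 l1 [/(congr1 val)/=]; rewrite !inordK//; lia.
  + by move=> j1 l2 [/(congr1 val)/=]; rewrite !inordK//; lia.
  + by case: j l => [|j] [|l].
  + move=> /andP[i3 j0] /andP[k3 l0] [/(congr1 val)/=]; rewrite !inordK// => ik.
    by subst k; case: i i3 j0 k3 l0 => [|[|[|i]]] //=; case: j l => [|j] [|l].
- move=> [[|[|i]] j] [[|[|k]] l] //=; rewrite /valid_coords /=.
  + by move=> j2 l1 _; rewrite !inordK//; lia.
  + by move=> j1 l2 _; rewrite !inordK//; lia.
  + move=> /andP[i3 _] /andP[k3 _].
    by apply: contra => /eqP/(congr1 val)/=; rewrite !inordK// => ->; rewrite eqxx.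
Qed.

Lemma embeds_cone_octahedron : embeds 'KP [:: 2; 2; 2; 1] cone_octahedron.
Proof.
have val6 c : valid_coords [:: 2; 2; 2; 1] c -> 2 * c.1 + c.2 < 7 /\ c.2 < 2.
  by case: c => [[|[|[|[|i]]]] j] //; rewrite /valid_coords /=; lia.
apply: (@embeds_KP_coords _ cone_octahedron (fun c => inord (2 * c.1 + c.2))).
- move=> c d /val6[c7 c2] /val6[d7 d2] /(congr1 val)/=; rewrite !inordK// => e.
  by apply: injective_projections; lia.
- move=> c d /val6[c7 c2] /val6[d7 d2] cd; rewrite /= /cone_rel !inordK//.
  by rewrite !(mulnC 2) !divnMDl// !divn_small// !addn0.
Qed.

Lemma unlinked_fan (R : realType) G n : embeds G 'KP [:: n; 1; 1; 1] -> 0 < n ->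
  ~ intrinsically_linked R G.
Proof.
case: n => // n h _; have [pos d] := apex_drawing_embeds (embeds_trans h (embeds_fan n)) (fan_drawing R n.+1).
exact: apex_drawing_unlinked d.
Qed.

Lemma unlinked_fan3 (R : realType) G : embeds G 'KP [:: 2; 1; 1; 1; 1] ->
  ~ intrinsically_linked R G.
Proof.
move=> h; have [pos d] := apex_drawing_embeds (embeds_trans h embeds_fan3) (fan_drawing R 3).
exact: apex_drawing_unlinked d.
Qed.

Lemma unlinked_cone (R : realType) G : embeds G 'KP [:: 2; 2; 2; 1] ->
  ~ intrinsically_linked R G.
Proof.
move=> h; have [pos d] := apex_drawing_embeds (embeds_trans h embeds_cone_octahedron) (cone_drawing R).
exact: apex_drawing_unlinked d.
Qed.

Lemma embeds_Kn3 n : embeds 'KP [:: n; 3] 'KP [:: n; 1; 1; 1].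
Proof.
apply: (@embeds_KP_map _ _ (fun c => if c.1 is 0 then c else (c.2.+1, 0))).
- by move=> [[|[|i]] j] //; rewrite /valid_coords /=; case: j => [|[|[|j]]].
- by move=> [[|[|i]] j] [[|[|k]] l] //; rewrite /valid_coords /= => _ _ [->].
- by move=> [[|[|i]] j] [[|[|k]] l].
Qed.

Lemma embeds_Kn21 n : embeds 'KP [:: n; 2; 1] 'KP [:: n; 1; 1; 1].
Proof.
apply: (@embeds_KP_map _ _ (fun c => match c.1 with
  0 => c | 1 => (c.2.+1, 0) | _ => (3, 0) end)).
- by move=> [[|[|[|i]]] j] //; rewrite /valid_coords /=; case: j => [|[|j]].
- move=> [[|[|[|i]]] j] [[|[|[|k]]] l] //; rewrite /valid_coords /=.
  + by move=> _ _ [->].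
  + by case: j => [|[|j]].
  + by case: l => [|[|l]].
  + by case: j l => [|j] [|l].
- by move=> [[|[|[|i]]] j] [[|[|[|k]]] l] //; rewrite /valid_coords /=; case: j l => [|[|j]] [|[|l]].
Qed.

(** The third vertex of the large part becomes the apex. *)
Lemma embeds_K322 : embeds 'KP [:: 3; 2; 2] 'KP [:: 2; 2; 2; 1].
Proof.
apply: (@embeds_KP_map _ _ (fun c => if c == (0, 2) then (3, 0) else c)).
- by move=> [[|[|[|i]]] j] //; rewrite /valid_coords /=; case: j => [|[|[|j]]].
- move=> [[|[|[|i]]] [|[|[|j]]]] [[|[|[|k]]] [|[|[|l]]]] //.
- by move=> [[|[|[|i]]] [|[|[|j]]]] [[|[|[|k]]] [|[|[|l]]]] //.
Qed.

Lemma unlinked_list_unlinked (R : realType) k H G : unlinked_list k H -> embeds G H ->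
  ~ intrinsically_linked R G.
Proof.
case: k => [//|[|[|[|[|[|//]]]]]] /=.
- move=> /iso_embeds HK GH; apply: unlinked_fan3; apply: embeds_trans GH _.
  apply: embeds_trans HK _; exact: embeds_K_KP.
- move=> [n n0 /iso_embeds HK] GH; apply: (@unlinked_fan _ _ n) => //.
  exact: embeds_trans GH (embeds_trans HK (embeds_Kn3 n)).
- move=> [/iso_embeds HK|[n n0 /iso_embeds HK]] GH.
    exact/unlinked_cone/(embeds_trans GH (embeds_trans HK embeds_K322)).
  apply: (@unlinked_fan _ _ n) => //.
  exact: embeds_trans GH (embeds_trans HK (embeds_Kn21 n)).
- move=> [/iso_embeds HK|[n n0 /iso_embeds HK]] GH.
    exact/unlinked_cone/(embeds_trans GH HK).
  by apply: (@unlinked_fan _ _ n) => //; exact: embeds_trans GH HK.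
- by move=> /iso_embeds HK GH; exact/unlinked_fan3/(embeds_trans GH HK).
Qed.

Lemma linked_list_linked (R : realType) k H G : linked_list k H -> embeds H G ->
  intrinsically_linked R G.
Proof.
have K331 a c : [&& size c == 7, all (valid_coords a) c, uniq c &
    all (fun i => all (fun j => (i %/ 3 != j %/ 3) ==>
      ((nth (0, 0) c i).1 != (nth (0, 0) c j).1)) (iota 0 7)) (iota 0 7)] ->
    sgraph_iso H 'KP a -> embeds H G -> intrinsically_linked R G.
  move=> /and4P[/eqP sc vc uc hc] /iso_embedsV HK HG; apply: linked_K331.
  by apply: has_model_embeds (embeds_trans HK HG) _; exact: (has_model_KP (c := c)).
have K44 a c : [&& size c == 8, all (valid_coords a) c, uniq c &
    all (fun i => all (fun j => ((i \in [:: 0; 1; 2; 6]) != (j \in [:: 0; 1; 2; 6])) ==>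
      ((nth (0, 0) c i).1 != (nth (0, 0) c j).1)) (iota 0 8)) (iota 0 8)] ->
    sgraph_iso H 'KP a -> embeds H G -> intrinsically_linked R G.
  move=> /and4P[/eqP sc vc uc hc] /iso_embedsV HK HG; apply: linked_K44.
  by apply: has_model_embeds (embeds_trans HK HG) _; exact: (has_model_KP (c := c)).
case: k => [//|[|[|[|[|[|//]]]]]] /=.
- move=> /iso_embedsV HK HG; apply: linked_K6.
  by apply: has_model_embeds (embeds_trans HK HG) _; exact: has_model_K.
(* In the lists for [K44] the seventh vertex is on the side of the first three, the eighth on that
   of the next three. *)
- by apply: (K44 _ [:: (0, 0); (0, 1); (0, 2); (1, 0); (1, 1); (1, 2); (0, 3); (1, 3)]).
- case; first by apply: (K331 _ [:: (0, 0); (0, 1); (0, 2); (1, 0); (1, 1); (1, 2); (2, 0)]).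
  by apply: (K44 _ [:: (0, 0); (0, 1); (0, 2); (1, 0); (1, 1); (2, 0); (0, 3); (2, 1)]).
- case.
    by apply: (K44 _ [:: (0, 0); (0, 1); (1, 0); (2, 0); (2, 1); (3, 0); (1, 1); (3, 1)]).
  by apply: (K331 _ [:: (0, 0); (0, 1); (0, 2); (1, 0); (1, 1); (2, 0); (3, 0)]).
- case.
    by apply: (K331 _ [:: (0, 0); (0, 1); (2, 0); (1, 0); (1, 1); (3, 0); (4, 0)]).
  by apply: (K331 _ [:: (0, 0); (0, 1); (0, 2); (1, 0); (2, 0); (3, 0); (4, 0)]).
Qed.

(** With the part sizes in decreasing order, comparison with the lists is entrywise, and a few
    thresholds on single sizes decide every case. *)
Lemma classification k G : 1 <= k <= 5 -> complete_partite k G ->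
  (exists2 H, linked_list k H & embeds H G) \/
  (exists2 H, unlinked_list k H & embeds G H).
Proof.
move=> /andP[k1 k5]; rewrite /complete_partite; have [->|kn1] := eqVneq k 1.
  move=> [n n0 iG]; have [n6|n5] := leqP 6 n.
    left; exists 'K_6; first exact: sgraph_iso_refl.
    exact: embeds_trans (embeds_K n6) (iso_embedsV iG).
  right; exists 'K_5; first exact: sgraph_iso_refl.
  exact: embeds_trans (iso_embeds iG) (@embeds_K n 5 n5).
move=> [a [sa pa iG]]; pose b := sort geq a.
have ab : perm_eq b a by rewrite perm_sort.
have bG : embeds 'KP b G := embeds_trans (embeds_KP_perm ab) (iso_embedsV iG).
have Gb : embeds G 'KP b.
  by apply: embeds_trans (iso_embeds iG) (embeds_KP_perm _); rewrite perm_sym.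
have pb : all (ltn 0) b by rewrite (perm_all _ ab).
have sb : size b = k by rewrite (perm_size ab).
have ob : sorted geq b by apply: sort_sorted => x y; exact: leq_total.
have L c : all2 leq c b -> linked_list k 'KP c -> exists2 H, linked_list k H & embeds H G.
  by move=> cb lc; exists 'KP c => //; exact: embeds_trans (embeds_KP_all2 cb) bG.
have U c : all2 leq b c -> unlinked_list k 'KP c -> exists2 H, unlinked_list k H & embeds G H.
  by move=> bc uc; exists 'KP c => //; exact: embeds_trans Gb (embeds_KP_all2 bc).
have refl := sgraph_iso_refl.
clearbody b; clear a sa pa iG ab bG Gb; move: pb sb ob L U.
case: k k1 k5 kn1 => [//|[//|[|[|[|[|//]]]]]] _ _ _.
- case: b => [//|x [//|y [|//]]] /= pb _ ob L U.
  have [y4|y3] := leqP 4 y.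
    by left; apply: (L [:: 4; 4]) => //=; lia.
  right; apply: (U [:: x; 3]) => /=; first by lia.
  by exists x => //; lia.
- case: b => [//|x [//|y [//|z [|//]]]] /= pb _ ob L U.
  have [z2|z1] := leqP 2 z.
    have [x4|x3] := leqP 4 x.
      by left; apply: (L [:: 4; 2; 2]) => /=; [lia|right].
    have [y3|y2] := leqP 3 y.
      by left; apply: (L [:: 3; 3; 1]) => /=; [lia|left].
    by right; apply: (U [:: 3; 2; 2]) => /=; [lia|left].
  have [y3|y2] := leqP 3 y.
    by left; apply: (L [:: 3; 3; 1]) => /=; [lia|left].
  right; apply: (U [:: x; 2; 1]) => /=; first by lia.
  by right; exists x => //; lia.
- case: b => [//|x [//|y [//|z [//|w [|//]]]]] /= pb _ ob L U.
  have [w2|w1] := leqP 2 w.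
    by left; apply: (L [:: 2; 2; 2; 2]) => /=; [lia|left].
  have [y2|y1] := leqP 2 y.
    have [x3|x2] := leqP 3 x.
      by left; apply: (L [:: 3; 2; 1; 1]) => /=; [lia|right].
    by right; apply: (U [:: 2; 2; 2; 1]) => /=; [lia|left].
  right; apply: (U [:: x; 1; 1; 1]) => /=; first by lia.
  by right; exists x => //; lia.
- case: b => [//|x [//|y [//|z [//|w [//|v [|//]]]]]] /= pb _ ob L U.
  have [x3|x2] := leqP 3 x.
    by left; apply: (L [:: 3; 1; 1; 1; 1]) => /=; [lia|right].
  have [y2|y1] := leqP 2 y.
    by left; apply: (L [:: 2; 2; 1; 1; 1]) => /=; [lia|left].
  by right; apply: (U [:: 2; 1; 1; 1; 1]) => /=; [lia|].
Qed.

Theorem theorem1 (R : realType) (k : nat) (hk : (1 <= k)%N) :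
  ((k <= 5)%N ->
     [/\ forall G : sgraph, linked_list k G -> intrinsically_linked R G,
         forall G : sgraph, unlinked_list k G -> ~ intrinsically_linked R G
       & forall G : sgraph, complete_partite k G ->
           ((exists2 H, linked_list k H & is_minor H G)
              /\ intrinsically_linked R G)
           \/
           ((exists2 H, unlinked_list k H & is_minor G H)
              /\ ~ intrinsically_linked R G)])
  /\
  ((6 <= k)%N ->
     forall G : sgraph, complete_partite k G -> intrinsically_linked R G).
Proof.
have embeds_refl G : embeds G G by apply/iso_embeds/sgraph_iso_refl.
split=> [k5|k6 G].
  split=> G.
  - by move=> h; exact: linked_list_linked h (embeds_refl G).
  - by move=> h; exact: unlinked_list_unlinked h (embeds_refl G).
  move=> /(@classification k G); rewrite hk k5 => /(_ isT)[[H LH HG]|[H UH GH]]; [left|right].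
    by split; [exists H => //; exact: embeds_minor|exact: linked_list_linked LH HG].
  by split; [exists H => //; exact: embeds_minor|exact: unlinked_list_unlinked UH GH].
(* One vertex from each of six parts gives K_6. *)
rewrite /complete_partite; case: eqVneq k6 => [->//|_ k6 [a [sa pa iG]]].
apply: linked_K6; apply: has_model_embeds (has_model_K _) => //.
by apply: embeds_trans (iso_embedsV iG); apply: embeds_K_KP; rewrite ?sa.
Qed.
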